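(* Let $G$ be a residually finite, finitely presented group such that $\delta(H)-1=[G:H](\delta(G)-1)$ for every subgroup $H$ of finite index in $G$, and suppose that $G$ does not have a finite 2-dimensional classifying space $K(G,1)$. Then there exists a subgroup $H$ of finite index in $G$ such that $H$ has a (finite) presentation with a relation gap.
   Context: The deficiency $\delta(G)$ of a finitely presented group $G$ is the maximum of $|X|-|R|$ over all finite presentations $G=\langle X\mid R\rangle$. Given a finite presentation $\langle X\mid R\rangle$ of a group $H$, let $F$ be the free group on $X$ and $N$ the normal closure of $R$ in $F$, so $H\cong F/N$. Conjugation of $F$ on $N$ induces an action of $H$ on $N^{ab}=N/[N,N]$, making it a $\mathbb ZH$-module (the relation module). $d_H(N^{ab})$ denotes the minimal number of generators of $N^{ab}$ as a $\mathbb ZH$-module, and $d_F(N)$ denotes the minimal number of elements of $N$ whose normal closure in $F$ is $N$. The presentation has a relation gap if $d_H(N^{ab})\neq d_F(N)$. *)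

(* Defs.v *)
From HB Require Import structures.
From mathcomp Require Import all_boot all_order all_algebra.
From mathcomp Require Import finmap.
From mathcomp Require Import all_classical all_reals all_analysis.
Set Implicit Arguments.
Unset Strict Implicit.
Unset Printing Implicit Defensive.
Import Order.TTheory GRing.Theory Num.Theory.
Import numFieldNormedType.Exports.

Local Open Scope classical_set_scope.
Local Open Scope group_scope.

Section FreeGroup.
Variable T : choiceType.

(* (x, true) stands for the letter x, (x, false) for its inverse. *)
Implicit Types (a b : T * bool) (u v w : seq (T * bool)).

Definition inv_letter a : T * bool := (a.1, ~~ a.2).

Definition reduced w : bool := sorted (fun a b => b != inv_letter a) w.

Definition cons_red a w : seq (T * bool) :=
  if w is b :: w' then if b == inv_letter a then w' else a :: w else [:: a].

Definition mul_words u v : seq (T * bool) := foldr cons_red v u.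

Definition inv_word w : seq (T * bool) := rev (map inv_letter w).

Lemma inv_letterK : involutive inv_letter.
Proof. by case=> x e; rewrite /inv_letter /= negbK. Qed.

Lemma reduced_behead a w : reduced (a :: w) -> reduced w.
Proof. exact: path_sorted. Qed.

Lemma reduced_cons_red a w : reduced w -> reduced (cons_red a w).
Proof.
case: w => [//|b w] /= rw; case: ifPn => [_|nb]; first exact: path_sorted rw.
by rewrite /= nb.
Qed.

Lemma reduced_mul u v : reduced v -> reduced (mul_words u v).
Proof. by move=> rv; elim: u => //= a u; exact: reduced_cons_red. Qed.

Lemma reduced_inv w : reduced w -> reduced (inv_word w).
Proof.
rewrite /reduced /inv_word rev_sorted sorted_map.
apply: sub_sorted => a b /=; apply: contra => /eqP ->.
by rewrite inv_letterK.
Qed.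

Lemma cons_redK a w : reduced w -> cons_red (inv_letter a) (cons_red a w) = w.
Proof.
case: w => [|b w] /=; first by rewrite inv_letterK eqxx.
move=> rw; case: ifPn => [/eqP ba|_] /=; last by rewrite inv_letterK eqxx.
move: rw; rewrite ba; case: w => [//|c w] /= /andP[nc _].
by rewrite (negPf nc).
Qed.

Lemma cons_redVK a w : reduced w -> cons_red a (cons_red (inv_letter a) w) = w.
Proof. by move=> rw; have := cons_redK (inv_letter a) rw; rewrite inv_letterK. Qed.

Lemma mul_cons_red a u w :
  reduced w -> mul_words (cons_red a u) w = cons_red a (mul_words u w).
Proof.
move=> rw; case: u => [//|b u] /=; case: eqP => [->|_] //.
by rewrite cons_redVK // reduced_mul.
Qed.

Lemma mul_wordsA u v w : reduced w ->
  mul_words u (mul_words v w) = mul_words (mul_words u v) w.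
Proof. by move=> rw; elim: u => //= a u ->; rewrite mul_cons_red. Qed.

Lemma mul_words_nil w : reduced w -> mul_words w [::] = w.
Proof.
elim: w => //= a w IH raw; rewrite IH ?(reduced_behead raw) //.
by case: w raw {IH} => [//|b w] /= /andP[/negPf-> _].
Qed.

Lemma mul_inv_word w v : reduced v -> mul_words (inv_word w) (mul_words w v) = v.
Proof.
move=> rv; elim: w => [//|a w IH].
rewrite /inv_word /= rev_cons /mul_words foldr_rcons.
by rewrite cons_redK ?IH ?reduced_mul.
Qed.

Record freegroup := FreeGroup { word : seq (T * bool) ; _ : reduced word }.

HB.instance Definition _ := [isSub of freegroup for word].
HB.instance Definition _ := [Choice of freegroup by <:].

Implicit Types x y z : freegroup.

Lemma wordP x : reduced (word x). Proof. exact: valP. Qed.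

Definition free_one : freegroup := @FreeGroup [::] isT.
Definition free_mul x y : freegroup := FreeGroup (reduced_mul (word x) (wordP y)).
Definition free_inv x : freegroup := FreeGroup (reduced_inv (wordP x)).

Lemma free_mulA : associative free_mul.
Proof. by move=> x y z; apply/val_inj; rewrite /= mul_wordsA ?wordP. Qed.
Lemma free_mul1g : left_id free_one free_mul.
Proof. by move=> x; exact/val_inj. Qed.
Lemma free_mulg1 : right_id free_one free_mul.
Proof. by move=> x; apply/val_inj; rewrite /= mul_words_nil ?wordP. Qed.
Lemma free_mulVg : left_inverse free_one free_inv free_mul.
Proof.
move=> x; apply/val_inj => /=.
by rewrite -[in X in mul_words _ X](mul_words_nil (wordP x)) mul_inv_word.
Qed.
Lemma free_mulgV : right_inverse free_one free_inv free_mul.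
Proof.
move=> x; rewrite -[RHS](free_mulVg (free_inv x)); congr free_mul.
apply/val_inj; rewrite /= /inv_word map_rev revK -map_comp.
by rewrite (eq_map (g := id)) ?map_id // => a /=; rewrite inv_letterK.
Qed.

HB.instance Definition _ := isGroup.Build freegroup
  free_mulA free_mul1g free_mulg1 free_mulVg free_mulgV.

Definition free_gen (t : T) : freegroup := @FreeGroup [:: (t, true)] isT.

Section Universal.
Variables (H : groupType) (f : T -> H).

Definition eval_letter a : H := if a.2 then f a.1 else (f a.1)^-1.
Definition eval_word w : H := \prod_(a <- w) eval_letter a.

Lemma eval_inv_letter a : eval_letter (inv_letter a) = (eval_letter a)^-1.
Proof. by rewrite /eval_letter; case: a => t [] //=; rewrite invgK. Qed.

Lemma eval_cons_red a w : eval_word (cons_red a w) = eval_letter a * eval_word w.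
Proof.
rewrite /eval_word; case: w => [|b w] /=; first by rewrite big_cons.
case: eqP => [->|_]; last by rewrite big_cons.
by rewrite big_cons eval_inv_letter mulVKg.
Qed.

Lemma eval_mul u v : eval_word (mul_words u v) = eval_word u * eval_word v.
Proof.
elim: u => [|a u IH] /=; first by rewrite /eval_word big_nil mul1g.
by rewrite eval_cons_red IH /eval_word big_cons mulgA.
Qed.

Definition free_lift x : H := eval_word (word x).

Lemma free_lift_mul : {morph free_lift : x y / x * y}.
Proof. by move=> x y; exact: eval_mul. Qed.

HB.instance Definition _ :=
  isMultiplicative.Build freegroup H free_lift free_lift_mul.

Lemma free_lift_gen t : free_lift (free_gen t) = f t.
Proof. by rewrite /free_lift /eval_word /= big_seq1. Qed.

End Universal.

Lemma free_lift_unique (H : groupType) (g h : {multiplicative freegroup -> H}) :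
  (forall t, g (free_gen t) = h (free_gen t)) -> g =1 h.
Proof.
have morph1 (k : {multiplicative freegroup -> H}) : k 1 = 1.
  by apply: (@mulgI _ (k 1)); rewrite -gmulfM !mulg1.
have morphV (k : {multiplicative freegroup -> H}) x : k x^-1 = (k x)^-1.
  by apply: (@mulgI _ (k x)); rewrite -gmulfM !mulgV morph1.
move=> gh [w rw]; elim: w rw => [|a w IH] raw.
  rewrite (_ : FreeGroup raw = 1) ?morph1 //; exact/val_inj.
have rw := reduced_behead raw.
have ra : reduced [:: a] by [].
rewrite (_ : FreeGroup raw = FreeGroup ra * FreeGroup rw); last first.
  by apply/val_inj => /=; case: (w) raw {IH rw} => //= b v /andP[/negPf-> _].
rewrite !gmulfM IH; congr (_ * _).
case: a {raw} ra => t [] ra.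
  by rewrite (_ : FreeGroup ra = free_gen t) ?gh //; exact/val_inj.
rewrite (_ : FreeGroup ra = (free_gen t)^-1) ?morphV ?gh //; exact/val_inj.
Qed.

End FreeGroup.

(* A [groupClosed G] is a subgroup of [G]; this is its carrier as a group. *)
Definition subgroup_of (G : groupType) (H : groupClosed G) : Type := {x : G | x \in H}.

Section Subgroup.
Variables (G : groupType) (H : groupClosed G).

HB.instance Definition _ := SubChoice.on (subgroup_of H).

Lemma subgroup_closed : group_closed (fun x : G => x \in H).
Proof. by split; [exact: gpred1 | move=> x y; exact: gpredF]. Qed.

HB.instance Definition _ :=
  SubChoice_isSubGroup.Build G _ (subgroup_of H) subgroup_closed.

End Subgroup.

Section SetSubgroups.
Variable G : groupType.
Implicit Types (A K : set G) (H : groupClosed G).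

Definition lcoset K (x : G) : set G := [set x * k | k in K].

Definition lcosets K : set (set G) := range (lcoset K).

Definition finite_index H : Prop := finite_set (lcosets [set` H]).

Definition subgroup_index H : nat := #|` fset_set (lcosets [set` H])|.

Definition is_subgroup K : Prop := K 1 /\ forall x y, K x -> K y -> K (x / y).

Definition is_normal_subgroup K : Prop :=
  is_subgroup K /\ forall x y, K x -> K (x ^ y).

Definition normal_closure A : set G := smallest is_normal_subgroup A.

Definition derived_subgroup K : set G :=
  smallest is_subgroup [set z | exists x y, [/\ K x, K y & z = [~ x, y]]].

Definition residually_finite : Prop :=
  forall g : G, g != 1 ->
    exists H, [/\ is_normal_subgroup [set` H], finite_index H & g \notin H].

End SetSubgroups.

Record finpres (G : groupType) := FinPres {
  gens : finType ;
  rels : {fset freegroup gens} ;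
  pres_map : {multiplicative freegroup gens -> G} ;
  pres_surj : forall g, exists w, pres_map w = g ;
  pres_ker : forall w, pres_map w = 1 <-> normal_closure [set` rels] w }.

Definition finitely_presented (G : groupType) : Prop := inhabited (finpres G).

Definition pres_deficiency (G : groupType) (P : finpres G) : int :=
  (#|gens P|%:Z - #|` rels P|%:Z)%R.

(* The maximum exists whenever [G] is finitely presented; the value is
   meaningless (0) otherwise. *)
Definition deficiency (G : groupType) : int :=
  xget 0%R [set d | (exists P : finpres G, pres_deficiency P = d) /\
                    (forall P : finpres G, (pres_deficiency P <= d)%R)].

Definition least (S : set nat) : nat :=
  xget 0%N [set k | S k /\ forall j, S j -> (k <= j)%N].

Section RelationModule.
Variables (H : groupType) (P : finpres H).
Let F : groupType := freegroup (gens P).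
Let N : set F := normal_closure [set` rels P].
Implicit Types (A B : set F) (M : set (set F)).

(* N/[N,N], whose elements are the cosets n[N,N]; the product of two cosets is
   their elementwise product. *)
Definition relmod : set (set F) := lcoset (derived_subgroup N) @` N.

Definition coset_div A B : set F := [set z | exists a b, [/\ A a, B b & z = a / b]].

(* The action of h on N/[N,N]: conjugation by the preimages of h in F.  All of
   these act in the same way, so on a coset of [N,N] this is a single coset. *)
Definition relmod_act (h : H) A : set F :=
  [set z | exists f a, [/\ pres_map P f = h, A a & z = f * a * f^-1]].

(* ZH-submodules of N/[N,N], i.e. the subgroups stable under H. *)
Definition is_submodule M : Prop :=
  [/\ M `<=` relmod, M (derived_subgroup N),
      forall A B, M A -> M B -> M (coset_div A B) &
      forall h A, M A -> M (relmod_act h A)].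

(* d_H(N^ab); attained, since the images of the relators generate. *)
Definition relmod_rank : nat :=
  least [set k | exists m : 'I_k -> set F,
    range m `<=` relmod /\ smallest is_submodule (range m) = relmod].

(* d_F(N); attained, since the relators themselves are such elements. *)
Definition normal_rank : nat :=
  least [set k | exists r : 'I_k -> F,
    range r `<=` N /\ normal_closure (range r) = N].

Definition relation_gap : Prop := relmod_rank <> normal_rank.

End RelationModule.

Local Open Scope ring_scope.

Section Topology.
Variable R : realType.

Definition sqnorm n (v : 'rV[R]_n) : R := \sum_(i < n) v ord0 i ^+ 2.
Definition disc n : set 'rV[R]_n := [set v | sqnorm v <= 1].
Definition open_disc n : set 'rV[R]_n := [set v | sqnorm v < 1].
Definition sphere n : set 'rV[R]_n := [set v | sqnorm v = 1].
Arguments disc n : clear implicits.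
Arguments open_disc n : clear implicits.
Arguments sphere n : clear implicits.

(* [X] carries a finite CW structure all of whose cells have dimension at most
   [d].  There are finitely many cells, so closure-finiteness and the weak
   topology are automatic, and each [Phi i] is automatically a homeomorphism
   from the open disc onto its cell. *)
Definition finite_CW_complex (d : nat) (X : topologicalType) : Prop :=
  hausdorff_space X /\
  exists (I : finType) (dim : I -> nat) (Phi : forall i, 'rV[R]_(dim i) -> X),
    let cell i := Phi i @` open_disc (dim i) in
    [/\ forall i, (dim i <= d)%N,
        forall i, {within disc (dim i), continuous (Phi i)},
        forall i, {in open_disc (dim i) &, injective (Phi i)},
        trivIset setT cell /\ \bigcup_i cell i = setT &
        forall i, Phi i @` sphere (dim i) `<=`
          \bigcup_(j in [set j | (dim j < dim i)%N]) cell j].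

Definition path_connected (X : topologicalType) : Prop :=
  forall x y : X, exists p : R -> X,
    [/\ {within `[0, 1]%classic, continuous p}, p 0 = x & p 1 = y].

Definition cube n : set 'rV[R]_n := [set v | forall i, 0 <= v ord0 i <= 1].
Definition cube_boundary n : set 'rV[R]_n :=
  [set v | cube v /\ exists i, v ord0 i = 0 \/ v ord0 i = 1].
Arguments cube n : clear implicits.
Arguments cube_boundary n : clear implicits.

Section Homotopy.
Variables (X : topologicalType) (x0 : X) (n : nat).

(* Maps (I^n, bd I^n) -> (X, x0): the elements of pi_n(X, x0) are their classes
   modulo [homotopic]. *)
Definition spheroid (f : 'rV[R]_n -> X) : Prop :=
  {within cube n, continuous f} /\ forall v, cube_boundary n v -> f v = x0.

Definition homotopic (f g : 'rV[R]_n -> X) : Prop :=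
  exists h : R * 'rV[R]_n -> X,
    [/\ {within `[0, 1]%classic `*` cube n, continuous h},
        forall v, cube n v -> h (0, v) = f v,
        forall v, cube n v -> h (1, v) = g v &
        forall t v, 0 <= t <= 1 -> cube_boundary n v -> h (t, v) = x0].

Definition trivial_homotopy_group : Prop :=
  forall f, spheroid f -> homotopic f (cst x0).

End Homotopy.

Definition loop_concat (X : topologicalType) (f g : 'rV[R]_1 -> X) : 'rV[R]_1 -> X :=
  fun v => if v ord0 ord0 <= 2^-1 then f (2 *: v) else g (2 *: v - const_mx 1).

(* [phi] is a group isomorphism from pi_1(X, x0) onto [G], given on loops. *)
Definition fundamental_group_iso (X : topologicalType) (x0 : X) (G : groupType) : Prop :=
  exists phi : ('rV[R]_1 -> X) -> G,
    [/\ forall g, exists2 f, spheroid x0 f & phi f = g,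
        forall f g, spheroid x0 f -> spheroid x0 g ->
          (phi f = phi g <-> homotopic x0 f g) &
        forall f g, spheroid x0 f -> spheroid x0 g ->
          phi (loop_concat f g) = (phi f * phi g)%g].

Definition is_KG1 (X : topologicalType) (G : groupType) : Prop :=
  path_connected X /\
  exists x0 : X, fundamental_group_iso x0 G /\
    forall n, (2 <= n)%N -> trivial_homotopy_group x0 n.

Definition has_finite_KG1 (d : nat) (G : groupType) : Prop :=
  exists X : topologicalType, finite_CW_complex d X /\ is_KG1 X G.

End Topology.

(* Main.v *)
(* Fix a presentation of G of maximal deficiency d, with relators R and kernel N, and let
   Z[G]^R -> N^ab be the map that sends the basis to the relators.

   If this map is injective, then H^2 of the universal cover Y of the presentation complex vanishes
   for all coefficients.  With coefficients in pi_2(Y), this says that a null homotopy of the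
   1-skeleton of Y can be corrected on the edges so that it extends over the faces.  So Y is
   contractible and the presentation complex is a finite 2-dimensional K(G,1).

   Otherwise a relation sum c(g,r) [g.r] = 0 holds in N^ab.  By residual finiteness the support of c
   injects into G/H for some normal subgroup H of finite index m.  In the Reidemeister-Schreier
   presentation of H (m|X| generators, m - 1 + m|R| nontrivial relators) the relation becomes a
   nonzero Z-linear relation among the classes of the relators; relation modules are torsion-free,
   so one class is redundant.  Without a relation gap this would give a presentation of H of
   deficiency at least m(d - 1) + 2, whereas by assumption the deficiency of H is m(d - 1) + 1. *)

Require Import Defs.
From HB Require Import structures.
From mathcomp Require Import all_boot all_order all_algebra.
From mathcomp Require Import finmap.
From mathcomp Require Import all_classical all_reals all_analysis.
From mathcomp Require Import ring lra zify.
Set Implicit Arguments.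
Unset Strict Implicit.
Unset Printing Implicit Defensive.
Import Order.TTheory GRing.Theory Num.Theory.
Import numFieldNormedType.Exports.
Local Open Scope classical_set_scope.
Local Open Scope ring_scope.

(** Neither cellular homology nor the theorems of Hurewicz and Whitehead are invoked: the
    contraction of Y is written down cell by cell. Edges are contracted along paths to the base
    vertex, so every obstruction is a spheroid at that vertex. The second homotopy group therefore
    enters only as an abelian group, without action or change of base point. The corrections of the
    edges form a 1-cochain with prescribed values on all relators at all vertices. When the relators
    admit no identities, a function on the faces induces a homomorphism on N; its values on the
    elements [sec g * x * (sec (g x))^-1] are such a cochain, because they telescope along a
    relator. Injectivity is phrased in the free group, by products of conjugated relators that equal
    1. This is the same condition: a product in [N,N] can be cancelled by commutators of such
    products, whose coefficients vanish. The relation found in the other case need not be primitive,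
    so it cannot be solved for one class directly; its content must be divided out, and this is
    where torsion matters. *)

(** * Abelian groups as quotients *)

(* An abelian group whose laws hold up to [pa_eqv] on the elements in [pa_in]. *)
Record preab := PreAb {
  pa_car :> Type;
  pa_in : set pa_car;
  pa_eqv : pa_car -> pa_car -> Prop;
  pa_op : pa_car -> pa_car -> pa_car;
  pa_inv : pa_car -> pa_car;
  pa_one : pa_car;
  pa_one_in : pa_in pa_one;
  pa_op_in : forall x y, pa_in x -> pa_in y -> pa_in (pa_op x y);
  pa_inv_in : forall x, pa_in x -> pa_in (pa_inv x);
  pa_refl : forall x, pa_in x -> pa_eqv x x;
  pa_sym : forall x y, pa_in x -> pa_in y -> pa_eqv x y -> pa_eqv y x;
  pa_trans : forall x y z, pa_in x -> pa_in y -> pa_in z ->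
    pa_eqv x y -> pa_eqv y z -> pa_eqv x z;
  pa_compat : forall x x' y y', pa_in x -> pa_in x' -> pa_in y -> pa_in y' ->
    pa_eqv x x' -> pa_eqv y y' -> pa_eqv (pa_op x y) (pa_op x' y');
  pa_assoc : forall x y z, pa_in x -> pa_in y -> pa_in z ->
    pa_eqv (pa_op x (pa_op y z)) (pa_op (pa_op x y) z);
  pa_comm : forall x y, pa_in x -> pa_in y -> pa_eqv (pa_op x y) (pa_op y x);
  pa_unit : forall x, pa_in x -> pa_eqv (pa_op pa_one x) x;
  pa_invl : forall x, pa_in x -> pa_eqv (pa_op (pa_inv x) x) pa_one }.

Section Quotient.
Variable S : preab.

Definition is_class (c : set S) : Prop :=
  exists2 x, pa_in x & c = [set y | pa_in y /\ pa_eqv x y].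

Definition quot : Type := {c : set S | is_class c}.

HB.instance Definition _ := gen_eqMixin quot.
HB.instance Definition _ := gen_choiceMixin quot.

(** Makes [qcls] total: anything outside [pa_in] is sent to the class of the unit. *)
Let base (x : S) : S := if pselect (pa_in x) then x else pa_one S.

Let base_in x : pa_in (base x).
Proof. by rewrite /base; case: (pselect _) => [|?] //; exact: pa_one_in. Qed.

Let base_id x : pa_in x -> base x = x.
Proof. by rewrite /base; case: pselect. Qed.

Definition qcls (x : S) : quot :=
  exist _ [set y | pa_in y /\ pa_eqv (base x) y] (ex_intro2 _ _ _ (base_in x) erefl).

Lemma qcls_surj c : exists2 x, pa_in x & c = qcls x.
Proof.
case: c => c cc; have [x Px cE] := cc; exists x => //.
by apply: eq_exist; rewrite base_id.
Qed.

Lemma qcls_eq x y : pa_in x -> pa_in y -> (qcls x = qcls y <-> pa_eqv x y).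
Proof.
move=> Px Py; split=> [[]|xy].
  rewrite !base_id // => /seteqP[_ /(_ y)]; case; last by [].
  by split=> //; exact: pa_refl.
apply: eq_exist; rewrite !base_id //; apply/seteqP; split=> z [Pz h]; split=> //.
  by apply: (pa_trans Py Px Pz) => //; exact: pa_sym.
exact: (pa_trans Px Py Pz).
Qed.

Let rep (c : quot) : S := s2val (cid2 (qcls_surj c)).
Let rep_in c : pa_in (rep c). Proof. exact: (s2valP (cid2 (qcls_surj c))). Qed.
Let repK c : qcls (rep c) = c. Proof. exact: esym (s2valP' (cid2 (qcls_surj c))). Qed.

Let rep_eqv x : pa_in x -> pa_eqv (rep (qcls x)) x.
Proof. by move=> Px; apply/qcls_eq => //; rewrite repK. Qed.

Definition qadd (a b : quot) : quot := qcls (pa_op (rep a) (rep b)).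
Definition qopp (a : quot) : quot := qcls (pa_inv (rep a)).
Definition qzero : quot := qcls (pa_one S).

Let qaddE x y : pa_in x -> pa_in y -> qadd (qcls x) (qcls y) = qcls (pa_op x y).
Proof.
by move=> Px Py; apply/qcls_eq; [exact: pa_op_in..|]; apply: pa_compat => //; exact: rep_eqv.
Qed.

Lemma qaddA : associative qadd.
Proof.
move=> a b c; rewrite -(repK a) -(repK b) -(repK c) !qaddE //; try exact: pa_op_in.
by apply/qcls_eq; [by do ?apply: pa_op_in..|]; exact: pa_assoc.
Qed.

Lemma qaddC : commutative qadd.
Proof.
move=> a b; rewrite -(repK a) -(repK b) !qaddE //.
by apply/qcls_eq; [by do ?apply: pa_op_in..|]; exact: pa_comm.
Qed.

Lemma qadd0 : left_id qzero qadd.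
Proof.
move=> a; rewrite -(repK a) qaddE //; last exact: pa_one_in.
by apply/qcls_eq => //; [apply: pa_op_in => //; exact: pa_one_in|exact: pa_unit].
Qed.

Lemma qaddN : left_inverse qzero qopp qadd.
Proof.
move=> a; rewrite -{2}(repK a) /qopp qaddE //; last exact: pa_inv_in.
apply/qcls_eq; [|exact: pa_one_in|exact: pa_invl].
by apply: pa_op_in => //; exact: pa_inv_in.
Qed.

HB.instance Definition _ := GRing.isZmodule.Build quot qaddA qaddC qadd0 qaddN.

Lemma qcls_op x y : pa_in x -> pa_in y -> qcls (pa_op x y) = qcls x + qcls y.
Proof. by move=> Px Py; rewrite -qaddE. Qed.

Lemma qcls_one : qcls (pa_one S) = 0. Proof. by []. Qed.

Lemma qcls_inv x : pa_in x -> qcls (pa_inv x) = - qcls x.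
Proof.
move=> Px; apply/eqP; rewrite -subr_eq0 opprK -qcls_op //; last exact: pa_inv_in.
apply/eqP/qcls_eq; [|exact: pa_one_in|exact: pa_invl].
by apply: pa_op_in => //; exact: pa_inv_in.
Qed.

End Quotient.

Lemma if_ltF (R : realType) (T : Type) (a b : R) (x y : T) : b < a -> (if a <= b then x else y) = y.
Proof. by move=> ba; rewrite leNgt ba. Qed.

(** * Path families and the second homotopy group *)

(* A named conditional, so that the tactic [cts] recognises pasted functions. *)
Definition ifle (R : realType) (T : Type) (a b : R) (x y : T) := if a <= b then x else y.

Section Continuity.
Variable R : realType.
Implicit Types A B C : topologicalType.

Lemma cts_id A : continuous (fun x : A => x).
Proof. by move=> x; exact: cvg_id. Qed.

Lemma cts_cst A B (b : B) : continuous (fun _ : A => b).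
Proof. by move=> x; exact: cvg_cst. Qed.

Lemma cts_comp A B C (f : B -> C) (u : A -> B) :
  continuous f -> continuous u -> continuous (fun x => f (u x)).
Proof. by move=> cf cu x; exact: (continuous_comp (cu x) (cf (u x))). Qed.

Lemma cts_pair A B C (u : A -> B) (v : A -> C) :
  continuous u -> continuous v -> continuous (fun x => (u x, v x)).
Proof. by move=> cu cv x; exact: (cvg_pair (cu x) (cv x)). Qed.

Lemma cts_fst A B C (u : A -> B * C) : continuous u -> continuous (fun x => (u x).1).
Proof. by apply: cts_comp => x; exact: cvg_fst. Qed.

Lemma cts_snd A B C (u : A -> B * C) : continuous u -> continuous (fun x => (u x).2).
Proof. by apply: cts_comp => x; exact: cvg_snd. Qed.

Lemma near_lt_fun A (f g : A -> R) x : continuous f -> continuous g -> f x < g x ->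
  nbhs x [set y | f y < g y].
Proof.
move=> cf cg fg; apply: open_nbhs_nbhs; split=> //.
rewrite (_ : [set _ | _] = (fun x => f x - g x) @^-1` [set r | r < 0]).
  apply: open_comp; last exact: open_lt.
  by move=> y _; apply: cvgB; [exact: cf|exact: cg].
by apply/seteqP; split=> y /=; rewrite subr_lt0.
Qed.

Section RealValued.
Variables (A : topologicalType) (f g : A -> R).
Hypotheses (cf : continuous f) (cg : continuous g).

Lemma cts_add : continuous (fun x => f x + g x).
Proof. by move=> x; apply: cvgD; [exact: cf|exact: cg]. Qed.

Lemma cts_opp : continuous (fun x => - f x).
Proof. by move=> x; apply: cvgN; exact: cf. Qed.

Lemma cts_mul : continuous (fun x => f x * g x).
Proof. by move=> x; apply: cvgM; [exact: cf|exact: cg]. Qed.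

Lemma cts_max : continuous (fun x => Num.max (f x) (g x)).
Proof. by move=> x; apply: continuous_max; [exact: cf|exact: cg]. Qed.

Lemma cts_min : continuous (fun x => Num.min (f x) (g x)).
Proof. by move=> x; apply: continuous_min; [exact: cf|exact: cg]. Qed.

(** A branch has to be continuous at [x] only if [x] lies on its closed side. The lifting theorem
    and [ext_lab_cts] depend on this, since there a branch is continuous on a part of the space
    only. *)
Lemma paste_at B (a b : A -> B) (x : A) :
  (f x <= g x -> {for x, continuous a}) ->
  (g x <= f x -> {for x, continuous b}) ->
  (f x = g x -> a x = b x) ->
  {for x, continuous (fun x => if f x <= g x then a x else b x)}.
Proof.
move=> ca cb ab; have [lt|gt|eq] := ltgtP (f x) (g x).
- have nx : nbhs x [set y | f y < g y] by exact: near_lt_fun.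
  move=> U /=; rewrite (ltW lt) => Ux.
  have ha : nbhs x (a @^-1` U) := ca (ltW lt) U Ux.
  by apply: filterS (filterI nx ha) => y /= [ly]; rewrite (ltW ly).
- have nx : nbhs x [set y | g y < f y] by exact: near_lt_fun.
  move=> U /=; rewrite (lt_geF gt) => Ux.
  have hb : nbhs x (b @^-1` U) := cb (ltW gt) U Ux.
  by apply: filterS (filterI nx hb) => y /= [ly]; rewrite (lt_geF ly).
- move=> U /=; rewrite eq lexx => Ux.
  have fg : f x <= g x by rewrite eq.
  have gf : g x <= f x by rewrite eq.
  have hb := cb gf U; rewrite /= -ab // in hb.
  have ha : nbhs x (a @^-1` U) := ca fg U Ux.
  have {}hb : nbhs x (b @^-1` U) := hb Ux.
  by apply: filterS (filterI ha hb) => y /= [h1 h2]; case: ifP.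
Qed.

Lemma cts_ifle B (a b : A -> B) : continuous a -> continuous b ->
  (forall x, f x = g x -> a x = b x) ->
  continuous (fun x => ifle (f x) (g x) (a x) (b x)).
Proof. by move=> ca cb ab x; exact: (@paste_at B a b x (fun _ => ca x) (fun _ => cb x) (ab x)). Qed.

End RealValued.

(* Functions on cubes are extended to all of R^n by precomposition with [cl], which avoids
   continuity relative to a subset. *)
Definition cl (t : R) : R := Num.max 0 (Num.min 1 t).

Lemma cts_cl A (u : A -> R) : continuous u -> continuous (fun x => cl (u x)).
Proof. by move=> cu; apply: cts_max (@cts_cst _ _ _) _; apply: cts_min => //; exact: cts_cst. Qed.

Lemma cl_ge0 t : 0 <= cl t. Proof. by rewrite /cl le_max lexx. Qed.
Lemma cl_le1 t : cl t <= 1. Proof. by rewrite /cl ge_max ler01 ge_min lexx. Qed.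
Lemma cl_id t : 0 <= t <= 1 -> cl t = t.
Proof. by case/andP=> t0 t1; rewrite /cl min_r // max_r. Qed.
Lemma cl_0 t : t <= 0 -> cl t = 0.
Proof. by move=> t0; rewrite /cl min_r ?max_l // (le_trans t0). Qed.
Lemma cl_1 t : 1 <= t -> cl t = 1.
Proof. by move=> t1; rewrite /cl min_l // max_r. Qed.
Lemma clK t : cl (cl t) = cl t.
Proof. by rewrite cl_id // cl_ge0 cl_le1. Qed.

Variant cl_spec t : R -> Type :=
| ClLow of t <= 0 : cl_spec t 0
| ClMid of 0 < t & t < 1 : cl_spec t t
| ClHigh of 1 <= t : cl_spec t 1.

Lemma clP t : cl_spec t (cl t).
Proof.
have [t0|t0] := lerP t 0; first by rewrite cl_0 //; constructor.
have [t1|t1] := lerP 1 t; first by rewrite cl_1 //; constructor.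
by rewrite cl_id ?ltW //; constructor.
Qed.

End Continuity.

(** The last rule takes any continuity fact from the context; hence the many [have] lines that place
    such facts there before [cts] is called. *)
Ltac cts_step :=
  first [ assumption
  | match goal with
    | |- continuous (fun _ => ?b) => exact: (@cts_cst _ _ b)
    | |- continuous (fun x => x) => exact: cts_id
    | |- continuous (@cl _) => exact: (cts_cl (@cts_id _))
    | |- continuous fst => exact: (cts_fst (@cts_id _))
    | |- continuous snd => exact: (cts_snd (@cts_id _))
    | |- continuous (fun x => @?u x + @?v x) => apply: (@cts_add _ _ u v)
    | |- continuous (fun x => - @?u x) => apply: (@cts_opp _ _ u)
    | |- continuous (fun x => @?u x * @?v x) => apply: (@cts_mul _ _ u v)
    | |- continuous (fun x => Num.max (@?u x) (@?v x)) => apply: (@cts_max _ _ u v)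
    | |- continuous (fun x => Num.min (@?u x) (@?v x)) => apply: (@cts_min _ _ u v)
    | |- continuous (fun x => cl (@?u x)) => apply: (@cts_cl _ _ u)
    | |- continuous (fun x => (@?u x, @?v x)) => apply: (@cts_pair _ _ _ u v)
    | |- continuous (fun x => fst (@?u x)) => apply: (@cts_fst _ _ _ u)
    | |- continuous (fun x => snd (@?u x)) => apply: (@cts_snd _ _ _ u)
    | |- continuous (fun x => ifle (@?f x) (@?g x) (@?a x) (@?b x)) =>
        apply: (@cts_ifle _ _ f g _ _ _ a b)
    | H : continuous ?f |- continuous (fun x => ?f (@?u x)) => apply: (@cts_comp _ _ _ f u H)
    end ].
Ltac cts := repeat (cbv beta; cts_step).

(** Finds the side of the unit square beyond which a point lies, in a disjunction of four; [nra] is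
    for the sheared coordinates of [fhom_sphC]. *)
Ltac on_side := first
  [ exfalso; lra | left; lra | right; left; lra | right; right; left; lra | right; right; right; lra
  | right; right; left; nra | right; right; right; nra ].

Lemma cl00 (R : realType) : cl (0 : R) = 0. Proof. exact: cl_0. Qed.
Lemma cl11 (R : realType) : cl (1 : R) = 1. Proof. exact: cl_1. Qed.

Section Families.
Variables (R : realType) (Y : topologicalType).
Implicit Types (p q : R * R -> Y) (Z : set R).

(* A family of paths [s |-> p (s, z)], stationary outside [0, 1] and constant for [z] in [Z].
   [Z = set0] gives paths (the parameter is then irrelevant), [Z = bdZ] gives spheroids. *)
Definition fam Z p := [/\ continuous p, forall s z, p (s, z) = p (cl s, z) &
  forall s z, Z z -> p (s, z) = p (0, z)].

(* Homotopy relative to the ends and to [Z]. *)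
Definition fhom Z p q := exists K : R * R * R -> Y, [/\ continuous K,
  forall s z, K (s, z, 0) = p (s, z), forall s z, K (s, z, 1) = q (s, z) &
  forall s z u, s <= 0 \/ 1 <= s \/ Z z -> K (s, z, u) = p (s, z)].

Lemma fhom_refl Z p : continuous p -> fhom Z p p.
Proof. by move=> cp; exists (fun x => p (x.1.1, x.1.2)); split=> //; cts. Qed.

Lemma fhom_sym Z p q : fhom Z p q -> fhom Z q p.
Proof.
move=> [K [cK K0 K1 Kb]]; exists (fun x => K (x.1.1, x.1.2, 1 - x.2)); split=> /=.
- by cts.
- by move=> s z; rewrite subr0.
- by move=> s z; rewrite subrr.
- by move=> s z u h; rewrite Kb // -K1 Kb.
Qed.

Lemma fhom_trans Z p q r : fhom Z p q -> fhom Z q r -> fhom Z p r.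
Proof.
move=> [K [cK K0 K1 Kb]] [L [cL L0 L1 Lb]].
exists (fun x => ifle x.2 2^-1 (K (x.1.1, x.1.2, 2 * x.2)) (L (x.1.1, x.1.2, 2 * x.2 - 1))).
split=> /=.
- cts => -[[s z] u] /= ->; rewrite mulfV ?pnatr_eq0 // subrr.
  by rewrite K1 L0.
- by move=> s z; rewrite /ifle invr_ge0 ler0n mulr0.
- move=> s z; rewrite /ifle ifF; last by apply/negbTE; rewrite -ltNge invf_lt1 ?ltr1n.
  by rewrite (_ : 2 * 1 - 1 = 1 :> R) //; lra.
- move=> s z u h; rewrite /ifle; case: ifP => _; first exact: Kb.
  by rewrite Lb // -K1 Kb.
Qed.

Lemma fhom_eq_bd Z p q s z : fhom Z p q -> s <= 0 \/ 1 <= s \/ Z z -> p (s, z) = q (s, z).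
Proof. by move=> [K [_ _ K1 Kb]] h; rewrite -K1 Kb. Qed.

Lemma fam_in Z p s z : fam Z p -> s <= 0 -> p (s, z) = p (0, z).
Proof. by move=> [_ h _] s0; rewrite h cl_0. Qed.

Lemma fam_out Z p s z : fam Z p -> 1 <= s -> p (s, z) = p (1, z).
Proof. by move=> [_ h _] s0; rewrite h cl_1. Qed.

(** Straight-line homotopy of the parameter. It is fixed at the ends because [f] and [g] agree
    there, and over [Z] because the family is constant there. Associativity, units and inverses of
    paths all reduce to it. *)
Lemma fhom_reparam0 Z p (f g : R -> R) : fam Z p -> continuous f -> continuous g ->
  (forall s, s <= 0 \/ 1 <= s -> f s = g s) ->
  fhom Z (fun x => p (f x.1, x.2)) (fun x => p (g x.1, x.2)).
Proof.
move=> [cp _ pZ] cf cg fg.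
exists (fun x => p ((1 - x.2) * f x.1.1 + x.2 * g x.1.1, x.1.2)); split=> /=.
- by cts.
- by move=> s z; congr (p (_, z)); lra.
- by move=> s z; congr (p (_, z)); lra.
- move=> s z u [h|[h|h]]; last by rewrite pZ // [RHS]pZ.
    by rewrite fg; [congr (p (_, z)); lra|left].
  by rewrite fg; [congr (p (_, z)); lra|right].
Qed.

Lemma fhom_reparam Z p (f : R -> R) : fam Z p -> continuous f ->
  (forall s, s <= 0 -> f s <= 0) -> (forall s, 1 <= s -> 1 <= f s) ->
  fhom Z (fun x => p (f x.1, x.2)) p.
Proof.
move=> fp cf f0 f1; have [_ pcl _] := fp.
have := @fhom_reparam0 Z p (fun s => cl (f s)) (@cl R) fp.
rewrite (_ : (fun x => p (cl (f x.1), x.2)) = fun x => p (f x.1, x.2)); last first.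
  by apply/funext => x; rewrite -pcl.
rewrite (_ : (fun x => p (cl x.1, x.2)) = p); last first.
  by apply/funext => -[s z]; rewrite -pcl.
apply; [by cts|by apply: cts_cl; exact: cts_id|].
move=> s [s0|s1]; first by rewrite !cl_0 // f0.
by rewrite !cl_1 // f1.
Qed.

Definition pcat p q : R * R -> Y := fun x =>
  ifle x.1 2^-1 (p (2 * x.1, x.2)) (q (2 * x.1 - 1, x.2)).

Definition prev p : R * R -> Y := fun x => p (1 - x.1, x.2).

Lemma fam_cat Z p q : fam Z p -> fam Z q -> (forall z, p (1, z) = q (0, z)) ->
  fam Z (pcat p q).
Proof.
move=> [cp pcl pZ] [cq qcl qZ] pq; split.
- rewrite /pcat; cts => -[s z] /= ->; rewrite mulfV ?pnatr_eq0 // subrr; exact: pq.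
- move=> s z; rewrite /pcat /ifle /=; case: (clP s) => [s0|s0 s1|s1]; last 1 first.
  + rewrite if_ltF; last by lra.
    rewrite [in RHS]if_ltF; last by lra.
    have qO a : 1 <= a -> q (a, z) = q (1, z) by move=> a1; rewrite qcl cl_1.
    by rewrite qO ?[RHS]qO //; lra.
  + rewrite ifT; last by lra.
    rewrite [in RHS]ifT; last by lra.
    have pO a : a <= 0 -> p (a, z) = p (0, z) by move=> a1; rewrite pcl cl_0.
    by rewrite pO ?[RHS]pO //; lra.
  + by [].
- move=> s z Zz; rewrite /pcat /ifle /=.
  rewrite [in RHS]ifT; last by lra.
  rewrite [RHS]pZ //; case: ifP => _; first by rewrite pZ.
  by rewrite qZ // -pq pZ.
Qed.

Lemma fam_rev Z p : fam Z p -> fam Z (prev p).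
Proof.
move=> [cp pcl pZ]; split.
- by rewrite /prev; cts.
- move=> s z; rewrite /prev /= pcl; case: (clP s) => [s0|s0 s1|s1].
  + by rewrite cl_1 ?subr0 //; lra.
  + by rewrite -pcl.
  + by rewrite cl_0 ?subrr //; lra.
- by move=> s z Zz; rewrite /prev /= pZ // [RHS]pZ.
Qed.

Lemma pcat_0 p q z : pcat p q (0, z) = p (0, z).
Proof. by rewrite /pcat /ifle /= ifT ?mulr0 //; lra. Qed.

Lemma pcat_1 p q z : pcat p q (1, z) = q (1, z).
Proof.
rewrite /pcat /ifle /= if_ltF; last by lra.
by congr (q (_, z)); lra.
Qed.

Lemma fhom_cat Z p p' q q' : fhom Z p p' -> fhom Z q q' ->
  (forall z, p (1, z) = q (0, z)) -> fhom Z (pcat p q) (pcat p' q').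
Proof.
move=> [K [cK K0 K1 Kb]] [L [cL L0 L1 Lb]] pq.
exists (fun x => ifle x.1.1 2^-1 (K (2 * x.1.1, x.1.2, x.2)) (L (2 * x.1.1 - 1, x.1.2, x.2))).
split=> /=.
- cts => -[[s z] u] /= ->; rewrite mulfV ?pnatr_eq0 // subrr.
  by rewrite Kb ?Lb ?pq; [|left|right; left].
- by move=> s z; rewrite K0 L0.
- by move=> s z; rewrite K1 L1.
- move=> s z u h; rewrite /pcat /ifle /=; case: ifPn => hs.
    rewrite Kb //; case: h => [h|[h|h]]; [left; lra|exfalso; lra|by right; right].
  rewrite -ltNge in hs.
  rewrite Lb //; case: h => [h|[h|h]]; [exfalso; lra|right; left; lra|by right; right].
Qed.

Lemma fhom_catA Z p q r : fam Z p -> fam Z q -> fam Z r ->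
  (forall z, p (1, z) = q (0, z)) -> (forall z, q (1, z) = r (0, z)) ->
  fhom Z (pcat (pcat p q) r) (pcat p (pcat q r)).
Proof.
move=> fp fq fr pq qr.
have qr' : fam Z (pcat q r) by apply: fam_cat.
have pqr : fam Z (pcat p (pcat q r)) by apply: fam_cat => // z; rewrite pcat_0.
(* The breakpoints 1/4 and 1/2 of the left bracketing go to 1/2 and 3/4. The slopes 2, 1, 1/2
   decrease, so the function is the minimum of its affine pieces. *)
pose f (s : R) := Num.min (2 * s) (Num.min (s + 4^-1) ((s + 1) / 2)).
suff -> : pcat (pcat p q) r = fun x => pcat p (pcat q r) (f x.1, x.2).
  apply: fhom_reparam => //; first by rewrite /f; cts.
    by move=> s s0; rewrite /f ge_min; apply/orP; left; lra.
  by move=> s s1; rewrite /f !le_min; apply/and3P; split; lra.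
apply/funext => -[s z]; rewrite /pcat /ifle /f /=.
have [h1|h1] := lerP (2 * s) (Num.min (s + 4^-1) ((s + 1) / 2)).
  move: h1; rewrite le_min => /andP[h1 h2].
  rewrite ifT; last by lra.
  rewrite ifT; last by lra.
  by rewrite ifT; last by lra.
move: h1; have [h2|h2] := lerP (s + 4^-1) ((s + 1) / 2) => h1.
  rewrite ifT; last by lra.
  rewrite if_ltF; last by lra.
  rewrite if_ltF; last by lra.
  rewrite ifT; last by lra.
  by congr (q (_, z)); lra.
rewrite if_ltF; last by lra.
rewrite if_ltF; last by lra.
rewrite if_ltF; last by lra.
by congr (r (_, z)); lra.
Qed.

Lemma fam_cst Z p c : fam Z p -> fam Z (fun x => p (c, x.2)).
Proof. by move=> [cp _ _]; split => //; cts. Qed.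

Lemma fhom_cat1 Z p : fam Z p -> fhom Z (pcat (fun x => p (0, x.2)) p) p.
Proof.
move=> fp; have [_ pcl _] := fp.
have -> : pcat (fun x => p (0, x.2)) p = fun x => p (2 * x.1 - 1, x.2).
  apply/funext => -[s z]; rewrite /pcat /ifle /=; case: ifPn => // h.
  by rewrite [RHS]pcl cl_0 //; lra.
by apply: (fhom_reparam (f := fun s => 2 * s - 1) fp); [cts|move=> s h; lra|move=> s h; lra].
Qed.

Lemma fhom_1cat Z p : fam Z p -> fhom Z (pcat p (fun x => p (1, x.2))) p.
Proof.
move=> fp; have [_ pcl _] := fp.
have -> : pcat p (fun x => p (1, x.2)) = fun x => p (2 * x.1, x.2).
  apply/funext => -[s z]; rewrite /pcat /ifle /=; case: ifPn => // h.
  by rewrite [RHS]pcl cl_1 //; lra.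
by apply: (fhom_reparam (f := fun s => 2 * s) fp); [cts|move=> s h; lra|move=> s h; lra].
Qed.

Lemma fhom_catV Z p : fam Z p -> fhom Z (pcat p (prev p)) (fun x => p (0, x.2)).
Proof.
move=> fp; have [_ pcl _] := fp.
(* Going out and back is [p] composed with a tent map, which shrinks linearly to 0. *)
have -> : pcat p (prev p) = fun x => p (cl (Num.min (2 * x.1) (2 - 2 * x.1)), x.2).
  apply/funext => -[s z]; rewrite /pcat /prev /ifle /= -pcl; case: ifPn => h.
    by rewrite min_l //; lra.
  by rewrite min_r; [congr (p (_, z)); lra|lra].
apply: (fhom_reparam0 (f := fun s => cl (Num.min (2 * s) (2 - 2 * s))) (g := fun=> 0)) => //.
- by cts.
- by cts.
- by move=> s [h|h]; rewrite cl_0 // ge_min; apply/orP; [left|right]; lra.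
Qed.

Lemma prevK p : prev (prev p) = p.
Proof. by apply/funext => -[s z]; rewrite /prev /=; congr (p (_, z)); lra. Qed.

Lemma fhom_Vcat Z p : fam Z p -> fhom Z (pcat (prev p) p) (fun x => p (1, x.2)).
Proof.
move=> fp; rewrite -{2}(prevK p); have := fhom_catV (fam_rev fp).
by rewrite [in X in fhom _ _ X]/prev /= subr0.
Qed.

Section Spheroids.
Variable y0 : Y.

Definition bdZ : set R := [set z | z <= 0 \/ 1 <= z].

Definition sph p := continuous p /\
  forall s z, s <= 0 \/ 1 <= s \/ bdZ z -> p (s, z) = y0.

Lemma sph_fam p : sph p -> fam bdZ p.
Proof.
move=> [cp pb]; split => //.
  move=> s z; case: (clP s) => // h; first by rewrite !pb //; left.
  by rewrite !pb //; right; left.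
by move=> s z Zz; rewrite !pb //; right; right.
Qed.

Lemma sph0 p z : sph p -> p (0, z) = y0.
Proof. by move=> [_ ->] //; left. Qed.

Lemma sph1 p z : sph p -> p (1, z) = y0.
Proof. by move=> [_ ->] //; right; left. Qed.

Lemma sph_cat p q : sph p -> sph q -> sph (pcat p q).
Proof.
move=> sp sq; have [] : fam bdZ (pcat p q).
  by apply: fam_cat; [exact: sph_fam..|move=> z; rewrite sph1 ?sph0].
move=> c pcl pZ; split=> // s z [s0|[s1|hz]].
- by rewrite pcl cl_0 // pcat_0 sph0.
- by rewrite pcl cl_1 // pcat_1 sph1.
- by rewrite pZ // pcat_0 sph0.
Qed.

Lemma sph_rev p : sph p -> sph (prev p).
Proof.
move=> [cp pb]; split; first by rewrite /prev; cts.
move=> s z h; rewrite /prev /= pb //.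
by case: h => [h|[h|h]]; [right; left; lra|left; lra|by right; right].
Qed.

Lemma sph_cst : sph (fun=> y0).
Proof. by split=> //; exact: cts_cst. Qed.

(* Eckmann-Hilton: the two boxes are moved around each other. *)
Lemma fhom_sphC p q : sph p -> sph q -> fhom bdZ (pcat p q) (pcat q p).
Proof.
move=> sp sq; have [cp pb] := sp; have [cq qb] := sq.
have spq := sph_cat sp sq; have sqp := sph_cat sq sp.
(* With the second coordinate upwards, [K1] has [p] in the lower left quarter and [q] in the upper
   right one; [K2] has [q] in the upper left and [p] in the lower right. The boxes are halved in
   height, slid past each other and restored. *)
pose K1 x := ifle x.1 2^-1 (p (2 * x.1, 2 * x.2)) (q (2 * x.1 - 1, 2 * x.2 - 1)).
pose K2 x := ifle x.1 2^-1 (q (2 * x.1, 2 * x.2 - 1)) (p (2 * x.1 - 1, 2 * x.2)).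
apply: (@fhom_trans _ _ K1).
  exists (fun x => ifle x.1.1 2^-1 (p (2 * x.1.1, (1 + cl x.2) * x.1.2))
            (q (2 * x.1.1 - 1, (1 + cl x.2) * x.1.2 - cl x.2))); split=> /=.
  - cts => -[[s z] u] /= ->; rewrite pb; last by right; left; lra.
    by rewrite qb //; left; lra.
  - by move=> s z; rewrite cl_0 // addr0 mul1r subr0.
  - move=> s z; rewrite cl_1 // /K1 /=; congr ifle; congr (_ (_, _)); lra.
  - move=> s z u h; rewrite (proj2 spq s z h) /ifle.
    have v1 := cl_le1 u; have v0 := cl_ge0 u; set v := cl u in v0 v1 *.
    case: ifPn => hs.
      by rewrite pb //; case: h => [h|[h|[h|h]]]; on_side.
    by rewrite qb //; case: h => [h|[h|[h|h]]]; on_side.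
apply: (@fhom_trans _ _ K2).
  exists (fun x => ifle x.1.2 2^-1 (p (2 * x.1.1 - cl x.2, 2 * x.1.2))
            (q (2 * x.1.1 - 1 + cl x.2, 2 * x.1.2 - 1))); split=> /=.
  - cts => -[[s z] u] /= ->; rewrite pb; last by right; right; right; lra.
    by rewrite qb //; right; right; left; lra.
  - move=> s z; rewrite cl_0 // /K1 /ifle /= subr0 addr0.
    case: ifPn => hz; case: ifPn => hs //.
      rewrite pb; last by right; left; lra.
      by rewrite qb //; right; right; left; lra.
    rewrite qb; last by left; lra.
    by rewrite pb //; right; right; right; lra.
  - move=> s z; rewrite cl_1 // /K2 /ifle /= subrK.
    case: ifPn => hz; case: ifPn => hs //.
      rewrite pb; last by left; lra.
      by rewrite qb //; right; right; left; lra.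
    rewrite qb; last by right; left; lra.
    by rewrite pb //; right; right; right; lra.
  - move=> s z u h.
    have -> : K1 (s, z) = y0.
      rewrite /K1 /ifle /=; case: ifPn => hs.
        by rewrite pb //; case: h => [h|[h|[h|h]]]; on_side.
      by rewrite qb //; case: h => [h|[h|[h|h]]]; on_side.
    have v1 := cl_le1 u; have v0 := cl_ge0 u; set v := cl u in v0 v1 *.
    rewrite /ifle; case: ifPn => hs.
      by rewrite pb //; case: h => [h|[h|[h|h]]]; on_side.
    by rewrite qb //; case: h => [h|[h|[h|h]]]; on_side.
exists (fun x => ifle x.1.1 2^-1 (q (2 * x.1.1, (2 - cl x.2) * x.1.2 - (1 - cl x.2)))
            (p (2 * x.1.1 - 1, (2 - cl x.2) * x.1.2))); split=> /=.
- cts => -[[s z] u] /= ->; rewrite pb; last by left; lra.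
  by rewrite qb //; right; left; lra.
- by move=> s z; rewrite cl_0 // !subr0.
- move=> s z; rewrite cl_1 // /pcat /=; congr ifle.
    by congr (q (_, _)); lra.
  by congr (p (_, _)); lra.
- move=> s z u h.
  have -> : K2 (s, z) = y0.
    rewrite /K2 /ifle /=; case: ifPn => hs.
      by rewrite qb //; case: h => [h|[h|[h|h]]]; on_side.
    by rewrite pb //; case: h => [h|[h|[h|h]]]; on_side.
  have v1 := cl_le1 u; have v0 := cl_ge0 u; set v := cl u in v0 v1 *.
  rewrite /ifle; case: ifPn => hs.
    by rewrite qb //; case: h => [h|[h|[h|h]]]; on_side.
  by rewrite pb //; case: h => [h|[h|[h|h]]]; on_side.
Qed.

Definition pi2_pre : preab.
Proof.
refine (@PreAb (R * R -> Y) sph (fhom bdZ) pcat prev (fun=> y0)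
  sph_cst sph_cat sph_rev _ _ _ _ _ _ _ _).
- by move=> p [cp _]; exact: fhom_refl.
- by move=> p q _ _; exact: fhom_sym.
- by move=> p q r _ _ _; exact: fhom_trans.
- by move=> p p' q q' sp _ sq _ pp qq; apply: fhom_cat => // z; rewrite sph0 ?sph1.
- move=> p q r sp sq sr; apply: fhom_sym; apply: fhom_catA; try exact: sph_fam.
    by move=> z; rewrite sph0 ?sph1.
  by move=> z; rewrite sph0 ?sph1.
- exact: fhom_sphC.
- move=> p sp; have := fhom_cat1 (sph_fam sp).
  by rewrite (_ : (fun x => p (0, x.2)) = fun=> y0) //; apply/funext => x; rewrite sph0.
- move=> p sp; have := fhom_Vcat (sph_fam sp).
  by rewrite (_ : (fun x => p (1, x.2)) = fun=> y0) //; apply/funext => x; rewrite sph1.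
Defined.

Definition pi2 : zmodType := quot pi2_pre.

End Spheroids.
End Families.

(** * Coverings *)

Section RealInduction.
Variable R : realType.

(** Replaces subdivision by a Lebesgue number: around each [t] it suffices to pass from a point just
    before [t] to a point just after it, with a bound [e] that may depend on [t]. The supremum of
    the points reached is then 1. *)
Lemma real_induction (P : R -> Prop) : P 0 ->
  (forall t, 0 <= t <= 1 -> exists2 e, 0 < e & forall t1 t2, 0 <= t1 -> t - e < t1 ->
     t1 <= t -> t1 <= t2 -> t2 < t + e -> t2 <= 1 -> P t1 -> P t2) ->
  P 1.
Proof.
move=> P0 step; pose E := [set t | 0 <= t <= 1 /\ P t].
have E0 : E 0 by split=> //; rewrite lexx ler01.
have E1 : ubound E 1 by move=> t [/andP[]].
have supE : has_sup E by split; [exists 0|exists 1].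
set s := sup E.
have s0 : 0 <= s by apply: (sup_upper_bound supE).
have s1 : s <= 1 by apply: ge_sup => //; exists 0.
have [e e0 he] := step s (introT andP (conj s0 s1)).
have [t1 [/andP[t10 t11] Pt1] st1] := sup_adherent e0 supE.
have t1s : t1 <= s by apply: (sup_upper_bound supE); split=> //; rewrite t10.
have {}he t2 : t1 <= t2 -> t2 < s + e -> t2 <= 1 -> P t2.
  by move=> h1 h2 h3; apply: (he t1).
have [ltse|] := ltP (s + e / 2) 1; last by move=> h; apply: he; lra.
have h : E (s + e / 2) by split; [apply/andP; split; lra|apply: he; lra].
by have := sup_upper_bound supE h; rewrite -/s; lra.
Qed.

End RealInduction.

Lemma continuous_near_eq (A B : topologicalType) (f g : A -> B) (x : A) :
  (\forall y \near x, f y = g y) -> {for x, continuous g} -> {for x, continuous f}.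
Proof.
move=> fg cg U; rewrite /= (nbhs_singleton fg) => Ux.
have h : nbhs x (g @^-1` U) := cg U Ux.
by apply: filterS (filterI fg h) => y /= [->].
Qed.

Lemma cts_at_comp (A B C : topologicalType) (f : B -> C) (u : A -> B) (x : A) :
  {for u x, continuous f} -> {for x, continuous u} -> {for x, continuous (fun y => f (u y))}.
Proof. by move=> cf cu; exact: (continuous_comp cu cf). Qed.

Lemma nbhs_ball (R : realType) (t : R) (A : set R) : nbhs t A ->
  exists2 e, 0 < e & forall u, t - e < u -> u < t + e -> A u.
Proof.
move=> /nbhs_ballP[e /= e0 he]; exists e => // u h1 h2; apply: he.
by rewrite /ball /= ltr_distlC h1 h2.
Qed.

Section Covering.
Variables (R : realType) (Y X : topologicalType) (G : groupType).
Variables (act : G -> Y -> Y) (p : Y -> X).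

(* A trivialisation of the covering over [p @` W]: the sheet through a point is given by its label. *)
Definition labelled (W : set Y) (lab : Y -> G) : Prop :=
  (forall c, open [set z | W z /\ lab z = c]) /\
  (forall g z, W z -> W (act g z) /\ lab (act g z) = (g * lab z)%g).

Hypotheses (act_one : forall y, act 1%g y = y) (p_act : forall g y, p (act g y) = p y)
  (p_cts : continuous p) (p_open : forall U, open U -> open (p @` U))
  (p_surj : forall x, exists y, p y = x)
  (p_fib : forall y y', p y = p y' -> exists g, y' = act g y)
  (p_triv : forall y, exists W lab, W y /\ labelled W lab).

Lemma label_inj W lab z z' : labelled W lab -> W z -> p z = p z' -> lab z = lab z' -> z = z'.
Proof.
move=> [_ hl] Wz /p_fib[g ->]; have [_ ->] := hl g _ Wz.
by rewrite -{1}[lab z]mul1g => /mulIg <-; rewrite act_one.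
Qed.

Lemma label_sat W lab z z' : labelled W lab -> W z -> p z = p z' -> W z'.
Proof. by move=> [_ hl] Wz /p_fib[g ->]; have [] := hl g _ Wz. Qed.

Lemma label_near W lab (z : Y) : labelled W lab -> W z ->
  nbhs z [set z' | W z' /\ lab z' = lab z].
Proof. by move=> [h _] Wz; apply: open_nbhs_nbhs; split => //; exact: h. Qed.

Lemma label_base_open W lab : labelled W lab -> open (p @` W).
Proof.
move=> [lo _]; apply: p_open; rewrite (_ : W = \bigcup_c [set z | W z /\ lab z = c]).
  by apply: bigcup_open => c _; exact: lo.
by apply/seteqP; split=> [z Wz|z [c _ []]] //; exists (lab z).
Qed.

(** The sheet with label [c]: a point of the fibre is moved into it by [act (c / lab z)]. Continuity
    comes from openness of [p] and its injectivity on the sheet. *)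
Lemma label_section W lab c : labelled W lab -> W !=set0 ->
  exists s : X -> Y, forall x, (p @` W) x ->
    [/\ W (s x), p (s x) = x, lab (s x) = c & {for x, continuous s}].
Proof.
move=> hl [w Ww]; have [lo la] := hl.
have ex x : exists z, (p @` W) x -> [/\ W z, p z = x & lab z = c].
  have [[z Wz pz]|nx] := pselect ((p @` W) x); last by exists w.
  have [Wc lc] := la (c / lab z)%g z Wz.
  by exists (act (c / lab z)%g z) => _; rewrite p_act lc mulgVK.
have [s hs] := choice ex; exists s => x px; have [Ws ps ls] := hs x px; split=> // U.
rewrite nbhsE => -[V [oV Vs] VU].
have oT : open (p @` (V `&` [set z | W z /\ lab z = c])) by apply: p_open; apply: openI.
have Tx : (p @` (V `&` [set z | W z /\ lab z = c])) x by exists (s x).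
apply: filterS (open_nbhs_nbhs (conj oT Tx)) => x' [z [Vz [Wz lz]] pz] /=.
have [Ws' ps' ls'] := hs x' (ex_intro2 _ _ z Wz pz).
by rewrite (label_inj hl Ws' (z' := z)) ?ps' ?ls' //; exact: VU.
Qed.

Lemma lift_unique (a b : R -> Y) : continuous a -> continuous b -> a 0 = b 0 ->
  (forall t, 0 <= t <= 1 -> p (a t) = p (b t)) -> forall t, 0 <= t <= 1 -> a t = b t.
Proof.
move=> ca cb ab0 pab.
suff: forall u, 0 <= u <= 1 -> a u = b u by [].
apply: (@real_induction R (fun t => forall u, 0 <= u <= t -> a u = b u)).
  by move=> u u0; have -> : u = 0 by lra.
move=> t t01; have [W [lab [Wa hl]]] := p_triv (a t).
have Wb : W (b t) by apply: (label_sat hl Wa); exact: pab.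
have na : nbhs t [set u | W (a u) /\ lab (a u) = lab (a t)] := ca t _ (label_near hl Wa).
have nb : nbhs t [set u | W (b u) /\ lab (b u) = lab (b t)] := cb t _ (label_near hl Wb).
have [e e0 he] := nbhs_ball (filterI na nb).
exists e => // t1 t2 t10 ht1 ht1' t12 ht2 t21 IH u /andP[u0 ut2].
have [ut1|ut1] := lerP u t1; first by apply: IH; rewrite u0.
have [] := he t1; [lra|lra|move=> [_ la1] [_ lb1]].
have [] := he u; [lra|lra|move=> [Wau lau] [_ lbu]].
apply: (label_inj hl Wau); first by apply: pab; lra.
by rewrite lau lbu -la1 -lb1 IH //; lra.
Qed.

Section Lifting.
Variables (T : topologicalType) (f : T * R -> X) (f0 : T -> Y).
Hypotheses (cf : continuous f) (cf0 : continuous f0)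
  (pf0 : forall z, p (f0 z) = f (z, 0)).

(** A lift over a neighbourhood of [z0] of the family stopped at time [t]. Stopping keeps all maps
    defined for every time, so no strip has to be treated as a subspace. *)
Let good (z0 : T) (t : R) := exists (N : set T) (g : T * R -> Y), nbhs z0 N /\ forall z : T, N z -> [/\ forall u : R, {for (z, u), continuous g},
  forall u, p (g (z, u)) = f (z, cl (Num.min u t)) & g (z, 0) = f0 z].

Let good0 z0 : good z0 0.
Proof.
exists setT, (fun x => f0 x.1); split; first exact: filterT.
move=> z _; split=> //=.
  move=> u; have h : continuous (fun x : T * R => f0 x.1) by cts.
  exact: h.
by move=> u; rewrite cl_0 // ge_min lexx orbT.
Qed.

Let good_step z0 t : 0 <= t <= 1 -> exists2 e, 0 < e & forall t1 t2, 0 <= t1 -> t - e < t1 ->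
     t1 <= t -> t1 <= t2 -> t2 < t + e -> t2 <= 1 -> good z0 t1 -> good z0 t2.
Proof.
move=> t01; have [y py] := p_surj (f (z0, t)).
have [W [lab [Wy hl]]] := p_triv y.
have opW := label_base_open hl.
have : nbhs (z0, t) (f @^-1` (p @` W)).
  by apply: cf; apply: open_nbhs_nbhs; split => //; exists y.
move=> [[N1 I1] /= [nN1 nI1] hN1]; have [e e0 he] := nbhs_ball nI1.
exists e => // t1 t2 t10 ht1 ht1' t12 ht2 t21 [N [g [nN hg]]].
have inW z u : N1 z -> t1 <= u <= t2 -> (p @` W) (f (z, u)).
  by move=> Nz hu; apply: (hN1 (z, u)); split => //=; apply: he; lra.
have Wg z : N z -> N1 z -> W (g (z, t1)).
  move=> Nz N1z; have [_ pg _] := hg z Nz.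
  have [w Ww pw] := inW z t1 N1z (introT andP (conj (lexx _) t12)).
  apply: (label_sat hl Ww); rewrite pw pg min_l //; congr (f (_, _)).
  by rewrite cl_id //; lra.
have Nz0 := nbhs_singleton nN; have N1z0 := nbhs_singleton nN1.
have Wg0 := Wg z0 Nz0 N1z0.
have [s hs] := label_section (lab (g (z0, t1))) hl (ex_intro _ _ Wy).
(* By continuity of the lift at time [t1], nearby parameters arrive in the same sheet; one section
   then continues all of them. *)
have nN2 : nbhs z0 [set z | W (g (z, t1)) /\ lab (g (z, t1)) = lab (g (z0, t1))].
  have [cg _ _] := hg z0 Nz0.
  have : {for z0, continuous (fun z => g (z, t1))}.
    apply: cts_at_comp; first exact: cg.
    by have h : continuous (fun z : T => (z, t1)); [cts|exact: h].
  by move=> h; apply: (h _ (label_near hl Wg0)).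
exists (N `&` N1 `&` [set z | W (g (z, t1)) /\ lab (g (z, t1)) = lab (g (z0, t1))]).
exists (fun x => if x.2 <= t1 then g x else s (f (x.1, cl (Num.min x.2 t2)))).
split; first by apply: filterI => //; apply: filterI.
move=> z [[Nz N1z] [Wz lz]]; have [cg pg g0] := hg z Nz.
have clu u : t1 <= u -> t1 <= cl (Num.min u t2) <= t2.
  move=> h; rewrite cl_id; first by rewrite le_min h t12 ge_min lexx orbT.
  by rewrite le_min ge_min t21 orbT andbT; apply/andP; split; lra.
split.
- move=> u; apply: (@paste_at R (T * R)%type (fun x => x.2) (fun=> t1)).
  + by cts.
  + by cts.
  + by move=> _; exact: cg.
  + move=> /= h; apply: cts_at_comp.
      by have [] := hs _ (inW z _ N1z (clu u h)).
    have h' : continuous (fun x : T * R => f (x.1, cl (Num.min x.2 t2))) by cts.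
    exact: h'.
  + move=> /= ->; rewrite min_l // cl_id; last by lra.
    have [Ws ps ls _] := hs _ (inW z t1 N1z (introT andP (conj (lexx _) t12))).
    apply: (label_inj hl Wz); last by rewrite ls.
    by rewrite ps pg min_l // cl_id //; lra.
- move=> u /=; case: ifPn => hu.
    by rewrite pg !min_l //; lra.
  rewrite -ltNge in hu.
  by have [_ -> _ _] := hs _ (inW z _ N1z (clu u (ltW hu))).
- by rewrite /= t10 g0.
Qed.

Lemma lifting : exists F : T * R -> Y, [/\ continuous F,
  forall z t, p (F (z, t)) = f (z, cl t) & forall z, F (z, 0) = f0 z].
Proof.
have gd z0 : good z0 1 by apply: (real_induction (good0 z0)) => t; exact: good_step.
have [N hN] := choice gd; have [H hH] := choice hN.
(* Uniqueness of path lifting makes the local lifts agree on overlaps, which gives continuity of the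
   lift assembled from them. *)
have cF z0 z (t : R) : N z0 z -> H z (z, cl t) = H z0 (z, cl t).
  move=> Nz; have [nz /(_ z (nbhs_singleton nz))[ca pa a0]] := hH z.
  have [_ /(_ z Nz)[cb pb b0]] := hH z0.
  have cc (K : T * R -> Y) : (forall u : R, {for (z, u), continuous K}) ->
      continuous (fun u => K (z, u)).
    move=> cK u; apply: (@cts_at_comp _ _ _ K (fun u => (z, u))); first exact: cK.
    by have h : continuous (fun u : R => (z, u)); [cts|exact: h].
  apply: (@lift_unique (fun u => H z (z, u)) (fun u => H z0 (z, u))).
  - exact: cc.
  - exact: cc.
  - by rewrite a0 b0.
  - by move=> u _; rewrite pa pb.
  - by rewrite cl_ge0 cl_le1.
exists (fun x => H x.1 (x.1, cl x.2)); split.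
- move=> [z0 t0]; have [nz hz] := hH z0.
  apply: (@continuous_near_eq _ _ _ (fun x => H z0 (x.1, cl x.2))).
    by exists (N z0, setT); [split=> //; exact: filterT|move=> [z t] [/= Nz _]; exact: cF].
  apply: cts_at_comp; first by have [ch _ _] := hz z0 (nbhs_singleton nz); exact: ch.
  by have h : continuous (fun x : T * R => (x.1, cl x.2)); [cts|exact: h].
- move=> z t /=; have [nz /(_ z (nbhs_singleton nz))[_ -> _]] := hH z.
  by rewrite min_l ?clK // cl_le1.
- move=> z /=; have [nz /(_ z (nbhs_singleton nz))[_ _ h]] := hH z.
  by rewrite cl_0.
Qed.

End Lifting.
End Covering.

(** * Continuity for row vectors and cubes *)

Section RowVectors.
Variable R : realType.

Lemma cts_row (T : topologicalType) n (u : T -> 'I_n -> R) :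
  (forall i, continuous (fun x => u x i)) -> continuous (fun x => \row_i u x i).
Proof.
move=> cu x; apply/cvg_ballP => e e0.
have h : nbhs x [set y | forall i, ball (u x i) e (u y i)].
  apply: (@filter_forall T _ (fun i y => ball (u x i) e (u y i)) (nbhs x)) => i.
  have h : nbhs x ((fun y => u y i) @^-1` (ball (u x i) e)) := cu i x _ (nbhsx_ballx _ _ e0).
  exact: h.
apply: filterS h => y hy; split=> // i j; rewrite !mxE; exact: hy.
Qed.

Lemma cts_coord (T : topologicalType) n (u : T -> 'rV[R]_n) i :
  continuous u -> continuous (fun x => u x ord0 i).
Proof. exact: (cts_comp (f := fun M : 'rV[R]_n => M ord0 i) (@coord_continuous R _ _ ord0 i)). Qed.

Lemma cts_const_mx (T : topologicalType) n (u : T -> R) :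
  continuous u -> continuous (fun x => const_mx (u x) : 'rV[R]_n).
Proof.
move=> cu; rewrite (_ : (fun x => _) = fun x => \row_i (fun x (_ : 'I_n) => u x) x i); last first.
  by apply/funext => x; apply/matrixP => i j; rewrite !mxE.
exact: cts_row.
Qed.

Lemma cts_scale (T : topologicalType) n (u : T -> R) (v : T -> 'rV[R]_n) :
  continuous u -> continuous v -> continuous (fun x => u x *: v x).
Proof.
move=> cu cv; rewrite (_ : (fun x => _) = fun x => \row_i (fun x i => u x * v x ord0 i) x i).
  by apply: cts_row => i; apply: cts_mul => //; exact: cts_coord.
by apply/funext => x; apply/matrixP => i j; rewrite !mxE ord1.
Qed.

Lemma cts_addv (T : topologicalType) n (u v : T -> 'rV[R]_n) :
  continuous u -> continuous v -> continuous (fun x => u x + v x).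
Proof.
move=> cu cv; rewrite (_ : (fun x => _) = fun x => \row_i (fun x i => u x ord0 i + v x ord0 i) x i).
  by apply: cts_row => i; apply: cts_add => //; exact: cts_coord.
by apply/funext => x; apply/matrixP => i j; rewrite !mxE ord1.
Qed.

Definition clv n (v : 'rV[R]_n) : 'rV[R]_n := \row_i cl (v ord0 i).

Lemma cts_clv n : continuous (@clv n).
Proof. by apply: cts_row => i; apply: cts_cl; apply: cts_coord; exact: cts_id. Qed.

Lemma clv_cube n (v : 'rV[R]_n) : cube (clv v).
Proof. by move=> i; rewrite mxE cl_ge0 cl_le1. Qed.

Lemma clv_id n (v : 'rV[R]_n) : cube v -> clv v = v.
Proof. by move=> cv; apply/rowP => i; rewrite mxE cl_id //; exact: cv. Qed.

Lemma within_comp (A B C : topologicalType) (D : set B) (f : B -> C) (u : A -> B) :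
  {within D, continuous f} -> continuous u -> (forall x, D (u x)) ->
  continuous (fun x => f (u x)).
Proof.
move=> /subspace_continuousP cf cu Du x U Ux.
have h : nbhs (u x) [set y | D y -> f y \in U].
  have := cf (u x) (Du x) U Ux; rewrite /= /nbhs /= /within /=.
  by apply: filterS => y h Dy; rewrite inE; exact: h.
have h' : nbhs x (u @^-1` [set y | D y -> f y \in U]) := cu x _ h.
by apply: filterS h' => y /= /(_ (Du y)); rewrite inE.
Qed.

Lemma const_mx_eta (v : 'rV[R]_1) : v = const_mx (v ord0 ord0).
Proof. by apply/rowP => i; rewrite mxE ord1. Qed.

End RowVectors.

(** * A contractible covering space with group G makes its base a K(G,1) *)

Section CoveringKG1.
Variables (R : realType) (Y X : topologicalType) (G : groupType).
Variables (act : G -> Y -> Y) (p : Y -> X).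
Hypotheses (act_one : forall y, act 1%g y = y)
  (act_mul : forall g h y, act (g * h)%g y = act g (act h y))
  (act_cts : forall g, continuous (act g))
  (p_act : forall g y, p (act g y) = p y)
  (p_cts : continuous p) (p_open : forall U, open U -> open (p @` U))
  (p_surj : forall x, exists y, p y = x)
  (p_fib : forall y y', p y = p y' -> exists g, y' = act g y)
  (p_triv : forall y, exists W lab, W y /\ labelled act W lab).
Variables (y0 : Y) (H : Y * R -> Y).
Hypotheses (cH : continuous H) (H0 : forall y, H (y, 0) = y)
  (H1 : forall y, H (y, 1) = y0) (Hb : forall t, H (y0, t) = y0).

Let x0 := p y0.

Let uniq := @lift_unique R Y X G act p act_one p_fib p_triv.

Lemma act_free g h : act g y0 = act h y0 -> g = h.
Proof.
have [W [lab [Wy [_ hl]]]] := p_triv y0; move=> e.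
have [_ e1] := hl g _ Wy; have [_ e2] := hl h _ Wy.
by move: e1; rewrite e e2 => /mulIg.
Qed.

Lemma path_lift (c : R -> X) : continuous c -> c 0 = x0 ->
  exists a : R -> Y, [/\ continuous a, a 0 = y0 & forall t, p (a t) = c (cl t)].
Proof.
move=> cc c0.
have [F [cF pF F0]] := @lifting R Y X G act p act_one p_act p_open p_surj p_fib p_triv
  R (fun x => c x.2) (fun=> y0) (cts_comp cc (cts_snd (@cts_id _))) (@cts_cst _ _ _)
  (fun _ => esym c0).
exists (fun t => F (0, t)); split=> //; first by cts.
Qed.

(** Lifting along the rays [t *: v] from the origin treats a map on R^n as a family of paths
    parametrised by [v]. *)
Lemma rV_lift n (f : 'rV[R]_n -> X) : continuous f -> f 0 = x0 ->
  exists a : 'rV[R]_n -> Y, [/\ continuous a, a 0 = y0 & forall v, p (a v) = f v].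
Proof.
move=> cf f0.
have cF : continuous (fun x : 'rV[R]_n * R => f (x.2 *: x.1)).
  by apply: (cts_comp cf); apply: cts_scale; cts.
have [F [cF' pF F0]] := @lifting R Y X G act p act_one p_act p_open p_surj p_fib p_triv
  'rV[R]_n (fun x => f (x.2 *: x.1)) (fun=> y0) cF (@cts_cst _ _ _)
  (fun v => etrans (esym f0) (congr1 f (esym (scale0r v)))).
exists (fun v => F (v, 1)); split=> /=.
- by cts.
- rewrite -[RHS](F0 0); apply: (uniq (a := fun t => F (0, t)) (b := fun=> F (0, 0))).
  + by cts.
  + by cts.
  + by [].
  + by move=> t _; rewrite !pF /= !scaler0.
  + by rewrite ler01 lexx.
- by move=> v; rewrite pF /= cl_1 // scale1r.
Qed.

Lemma lift_segment n (f : 'rV[R]_n -> X) (a : 'rV[R]_n -> Y) v w : continuous a ->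
  (forall v, p (a v) = f v) -> (forall t, 0 <= t <= 1 -> f (v + t *: (w - v)) = f v) ->
  a w = a v.
Proof.
move=> ca pa fvw.
have -> : a w = a (v + 1 *: (w - v)) by rewrite scale1r addrC subrK.
apply: (uniq (a := fun t => a (v + t *: (w - v))) (b := fun=> a v)).
- by apply: (cts_comp ca); apply: cts_addv; cts; apply: cts_scale; cts.
- by cts.
- by rewrite scale0r addr0.
- by move=> t ht; rewrite !pa; exact: fvw.
- by rewrite ler01 lexx.
Qed.

(** The lift of a spheroid is contracted upstairs by [H] and projected. The dimension is used to see
    that the lift is constant on the boundary: a face [v_i = 1] is joined to the origin through a
    face [v_j = 0] with [j != i]. *)
Lemma covering_pi_trivial n : (2 <= n)%N -> trivial_homotopy_group R x0 n.
Proof.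
move=> n2 f [cf fb].
pose f' v := f (clv v).
have cf' : continuous f' by apply: (within_comp cf); [exact: cts_clv|exact: clv_cube].
have cube0 : cube (0 : 'rV[R]_n) by move=> i; rewrite mxE lexx ler01.
have f'b v : cube_boundary v -> f' v = x0.
  by move=> vb; rewrite /f' clv_id; [exact: fb|case: vb].
pose i0 : 'I_n := Ordinal (ltnW n2).
have f0 : f' 0 = x0 by apply: f'b; split=> //; exists i0; left; rewrite mxE.
have [a [ca a0 pa]] := rV_lift cf' f0.
have abz v i : cube v -> v ord0 i = 0 -> a v = y0.
  move=> cv vi; rewrite -a0; apply: (lift_segment ca pa) => t t01.
  rewrite f0 add0r subr0; apply: f'b; split.
    move=> j; rewrite mxE; have /andP[h1 h2] := cv j; case/andP: t01 => t0 t1.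
    by rewrite mulr_ge0 //= mulr_ile1.
  by exists i; left; rewrite mxE vi mulr0.
have ab v : cube_boundary v -> a v = y0.
  move=> [cv [i [vi|vi]]]; first exact: abz vi.
  have [j ji] : exists j, j != i.
    exists (if i == i0 then Ordinal n2 else i0).
    by case: ifPn => [/eqP -> //|]; rewrite eq_sym.
  pose w : 'rV[R]_n := \row_k if k == j then 0 else v ord0 k.
  have cw : cube w by move=> k; rewrite mxE; case: ifP => _; [rewrite lexx ler01|exact: cv].
  have wj : w ord0 j = 0 by rewrite mxE eqxx.
  rewrite -(abz w j cw wj); apply: (lift_segment ca pa) => t /andP[t0 t1].
  have wi : w ord0 i = 1 by rewrite mxE eq_sym (negbTE ji) vi.
  rewrite (f'b w); last by split=> //; exists i; right.
  apply: f'b; split; last by exists i; right; rewrite !mxE eq_sym (negbTE ji) vi; lra.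
  move=> k; rewrite !mxE; have /andP[h1 h2] := cv k.
  by case: ifP => _; apply/andP; split; nra.
exists (fun x => p (H (a x.2, cl x.1))); split.
- by apply: continuous_subspaceT; cts.
- by move=> v cv; rewrite /= cl_0 // H0 pa /f' clv_id.
- by move=> v cv; rewrite /= cl_1 // H1.
- by move=> t v _ vb /=; rewrite ab // Hb.
Qed.

Lemma covering_path_connected : path_connected R X.
Proof.
move=> x x'; have [y <-] := p_surj x; have [y' <-] := p_surj x'.
exists (fun t => ifle t 2^-1 (p (H (y, 2 * t))) (p (H (y', 2 - 2 * t)))); split.
- apply: continuous_subspaceT; cts => t /= ->.
  by rewrite mulfV ?pnatr_eq0 // H1 (_ : 2 - 1 = 1 :> R) ?H1 //; lra.
- by rewrite /ifle ifT ?mulr0 ?H0 //; lra.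
- rewrite /ifle if_ltF; last by lra.
  by rewrite mulr1 subrr H0.
Qed.

(* [g] is the class of the loop [f] under pi_1(X) = G: the lift of [f] at [y0] ends at [act g y0]. *)
Definition ends (f : 'rV[R]_1 -> X) (g : G) : Prop :=
  exists a : R -> Y, [/\ continuous a, a 0 = y0, a 1 = act g y0 &
    forall t, 0 <= t <= 1 -> p (a t) = f (const_mx t)].

Lemma ends_unique f g h : ends f g -> ends f h -> g = h.
Proof.
move=> [a [ca a0 a1 pa]] [b [cb b0 b1 pb]]; apply: act_free; rewrite -a1 -b1.
apply: uniq => //; first by rewrite a0.
  by move=> t t01; rewrite pa // pb.
by rewrite ler01 lexx.
Qed.

Lemma cube_const t : 0 <= t <= 1 -> cube (const_mx t : 'rV[R]_1).
Proof. by move=> h i; rewrite mxE. Qed.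

Lemma cube_bd0 : cube_boundary (const_mx 0 : 'rV[R]_1).
Proof. by split; [apply: cube_const; rewrite lexx ler01|exists ord0; left; rewrite mxE]. Qed.

Lemma cube_bd1 : cube_boundary (const_mx 1 : 'rV[R]_1).
Proof. by split; [apply: cube_const; rewrite lexx ler01|exists ord0; right; rewrite mxE]. Qed.

Lemma spheroid_path f : spheroid (R := R) x0 f ->
  [/\ continuous (fun t => f (const_mx (cl t) : 'rV[R]_1)), f (const_mx 0) = x0 & f (const_mx 1) = x0].
Proof.
move=> [cf fb]; split.
- apply: (within_comp cf); first by apply: cts_const_mx; cts.
  by move=> t; apply: cube_const; rewrite cl_ge0 cl_le1.
- by apply: fb; exact: cube_bd0.
- by apply: fb; exact: cube_bd1.
Qed.

Lemma ends_exists f : spheroid (R := R) x0 f -> exists g, ends f g.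
Proof.
move=> /spheroid_path[cf f0 f1].
have [|a [ca a0 pa]] := path_lift cf; first by rewrite cl_0.
have [|g ag] := @p_fib y0 (a 1); first by rewrite pa !cl_1.
exists g, a; split=> // t t01; rewrite pa clK cl_id //.
Qed.

(** The track of [act g y0] under the contraction, run backwards, leads from [y0] to [act g y0]. *)
Lemma ends_surj g : exists2 f, spheroid (R := R) x0 f & ends f g.
Proof.
exists (fun v => p (H (act g y0, 1 - cl (v ord0 ord0)))).
  split.
    apply: continuous_subspaceT.
    have h : continuous (fun v : 'rV[R]_1 => v ord0 ord0) by apply: cts_coord; exact: cts_id.
    by cts.
  move=> v [cv [i]]; rewrite (ord1 i) => -[->|->].
    by rewrite cl_0 // subr0 H1.
  by rewrite cl_1 // subrr H0 p_act.
exists (fun t => H (act g y0, 1 - cl t)); split.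
- by cts.
- by rewrite cl_0 // subr0 H1.
- by rewrite cl_1 // subrr H0.
- by move=> t _; rewrite mxE.
Qed.

Lemma ends_homotopic f f' g : spheroid (R := R) x0 f -> spheroid (R := R) x0 f' ->
  homotopic x0 f f' -> ends f g -> ends f' g.
Proof.
move=> sf sf' [h [ch h0 h1 hb]] efg.
have ch' : continuous (fun x : R * R => h (cl x.1, const_mx (cl x.2))).
  apply: (within_comp ch); first by cts; apply: cts_const_mx; cts.
  move=> x; split=> /=; first by rewrite in_itv /= cl_ge0 cl_le1.
  by apply: cube_const; rewrite cl_ge0 cl_le1.
have b0 t : 0 <= t <= 1 -> h (t, const_mx 0) = x0 by move=> ht; apply: hb => //; exact: cube_bd0.
have b1 t : 0 <= t <= 1 -> h (t, const_mx 1) = x0 by move=> ht; apply: hb => //; exact: cube_bd1.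
have cl01 (t : R) : 0 <= cl t <= 1 by rewrite cl_ge0 cl_le1.
have [F [cF pF F0]] := @lifting R Y X G act p act_one p_act p_open p_surj p_fib p_triv
  R _ (fun=> y0) ch' (@cts_cst _ _ _) (fun t => esym (etrans (congr1 (fun s => h (cl t, const_mx s)) (cl_0 (lexx 0))) (b0 _ (cl01 t)))).
have eF : F (0, 1) = F (1, 1).
  apply: esym; apply: (uniq (a := fun t => F (t, 1)) (b := fun=> F (0, 1))).
  - by cts.
  - by cts.
  - by [].
  - by move=> t _; rewrite !pF /= clK (cl_1 (lexx 1)) !b1.
  - by rewrite ler01 lexx.
have e0 : F (0, 1) = act g y0.
  have [a [ca a0 a1 pa]] := efg; rewrite -a1.
  apply: (uniq (a := fun t => F (0, t)) (b := a)) => //.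
  - by cts.
  - by rewrite F0.
  - move=> t t01; rewrite pF pa //= clK cl_0 // h0 ?cl_id //; exact: cube_const.
  - by rewrite ler01 lexx.
exists (fun t => F (1, t)); split.
- by cts.
- by rewrite F0.
- by rewrite -eF.
- by move=> t t01; rewrite pF /= clK cl_1 // cl_id // h1 //; exact: cube_const.
Qed.

Lemma null_loop (d : R * R -> Y) : fam set0 d -> (forall z, d (0, z) = y0) ->
  (forall z, d (1, z) = y0) -> fhom set0 d (fun=> y0).
Proof.
move=> fd d0 d1; have [cd dcl _] := fd.
exists (fun x => H (d x.1, x.2)); split=> /=.
- by cts.
- by move=> s z; rewrite H0.
- by move=> s z; rewrite H1.
- move=> s z u [s0|[s1|[]]]; first by rewrite (fam_in z fd s0) d0 Hb.
  by rewrite (fam_out z fd s1) d1 Hb.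
Qed.

Lemma same_ends_homotopic f f' g : spheroid (R := R) x0 f -> spheroid (R := R) x0 f' ->
  ends f g -> ends f' g -> homotopic x0 f f'.
Proof.
move=> sf sf' [a [ca a0 a1 pa]] [b [cb b0 b1 pb]].
pose a' (x : R * R) := a (cl x.1); pose b' (x : R * R) := b (cl x.1).
have fa : fam set0 a' by split=> //; [rewrite /a'; cts|move=> s z; rewrite /a' /= clK].
have fb : fam set0 b' by split=> //; [rewrite /b'; cts|move=> s z; rewrite /b' /= clK].
have a'0 z : a' (0, z) = y0 by rewrite /a' /= cl_0.
have b'0 z : b' (0, z) = y0 by rewrite /b' /= cl_0.
have a'1 z : a' (1, z) = act g y0 by rewrite /a' /= cl_1.
have b'1 z : b' (1, z) = act g y0 by rewrite /b' /= cl_1.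
have rb0 z : prev b' (0, z) = act g y0 by rewrite /prev /= subr0.
have rb1 z : prev b' (1, z) = y0 by rewrite /prev /= subrr.
have frb := fam_rev fb.
have ab z : a' (1, z) = prev b' (0, z) by rewrite a'1 rb0.
have fab : fam set0 (pcat a' (prev b')) by exact: fam_cat.
(* The chain is a ~ a (b^-1 b) ~ (a b^-1) b ~ b, where a b^-1 is a loop at [y0] and null by
   [null_loop]. *)
have [K [cK K0 K1 Kb]] : fhom set0 a' b'.
  have s1 : fhom set0 (pcat a' (pcat (prev b') b')) (pcat (pcat a' (prev b')) b').
    by apply: fhom_sym; apply: fhom_catA => // z; rewrite rb1.
  have s2 : fhom set0 (pcat (pcat a' (prev b')) b') (pcat (fun=> y0) b').
    apply: fhom_cat; [|by apply: fhom_refl; case: fb|by move=> z; rewrite pcat_1 rb1].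
    by apply: null_loop => // z; [rewrite pcat_0|rewrite pcat_1].
  have s3 := fhom_cat1 fb.
  rewrite (_ : (fun x => b' (0, x.2)) = fun=> y0) in s3; last by apply/funext => x; rewrite b'0.
  have s4 := fhom_Vcat fb.
  rewrite (_ : (fun x => b' (1, x.2)) = fun x => a' (1, x.2)) in s4; last first.
    by apply/funext => x; rewrite b'1 a'1.
  have s5 : fhom set0 (pcat a' (pcat (prev b') b')) (pcat a' (fun x => a' (1, x.2))).
    by apply: fhom_cat; [apply: fhom_refl; case: fa|exact: s4|move=> z; rewrite pcat_0].
  apply: fhom_trans (fhom_sym (fhom_1cat fa)) _.
  apply: fhom_trans (fhom_sym s5) _.
  by apply: fhom_trans s1 _; apply: fhom_trans s2 _.
exists (fun x : R * 'rV[R]_1 => p (K (x.2 ord0 ord0, 0, x.1))); split.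
- apply: continuous_subspaceT.
  have h : continuous (fun x : R * 'rV[R]_1 => x.2 ord0 ord0) by apply: cts_coord; cts.
  by cts.
- by move=> v cv; rewrite /= K0 /a' /= cl_id ?pa -?const_mx_eta //; exact: cv.
- by move=> v cv; rewrite /= K1 /b' /= cl_id ?pb -?const_mx_eta //; exact: cv.
- move=> t v _ [cv [i]]; rewrite (ord1 i) /= => -[->|->].
    by rewrite Kb ?a'0 //; left.
  by rewrite Kb ?a'1 ?p_act //; right; left.
Qed.

(** The lift of the second loop is translated by [act g]. As the action is from the left, end points
    multiply in the order of the loops. *)
Lemma ends_concat f f' g g' : ends f g -> ends f' g' -> ends (loop_concat f f') (g * g')%g.
Proof.
move=> [a [ca a0 a1 pa]] [b [cb b0 b1 pb]].
have cg : continuous (act g) by exact: act_cts.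
exists (fun t => ifle t 2^-1 (a (2 * t)) (act g (b (2 * t - 1)))); split.
- by cts => t /= ->; rewrite mulfV ?pnatr_eq0 // subrr a1 b0.
- by rewrite /ifle ifT ?mulr0 ?a0 //; lra.
- rewrite /ifle if_ltF; last by lra.
  by rewrite (_ : 2 * 1 - 1 = 1 :> R) ?b1 ?act_mul //; lra.
- move=> t /andP[t0 t1]; rewrite /ifle /loop_concat mxE; case: ifPn => ht.
    by rewrite pa; [congr f; apply/rowP => i; rewrite !mxE|lra].
  rewrite p_act pb; last by lra.
  by congr f'; apply/rowP => i; rewrite !mxE.
Qed.

Theorem covering_KG1 : is_KG1 R X G.
Proof.
split; first exact: covering_path_connected.
exists x0; split; last exact: covering_pi_trivial.
pose phi f := xget 1%g [set g | ends f g].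
have phiE f g : ends f g -> phi f = g.
  by move=> efg; apply: (ends_unique _ efg); apply: (xgetPex 1%g); exists g.
exists phi; split.
- by move=> g; have [f sf efg] := ends_surj g; exists f => //; exact: phiE.
- move=> f f' sf sf'; have [g efg] := ends_exists sf; have [g' efg'] := ends_exists sf'.
  rewrite (phiE _ _ efg) (phiE _ _ efg'); split=> [e|hff].
    by apply: (same_ends_homotopic sf sf' efg); rewrite e.
  exact: (ends_unique (ends_homotopic sf sf' hff efg)).
- move=> f f' sf sf'; have [g efg] := ends_exists sf; have [g' efg'] := ends_exists sf'.
  by rewrite (phiE _ _ efg) (phiE _ _ efg'); apply: phiE; exact: ends_concat.
Qed.

End CoveringKG1.

(** * The presentation complex and its universal cover *)

(* The only neighbourhood of [None] is everything, so a continuous map to [olab M] is a locally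
   constant map to [M] on an open set. *)
Definition olab (M : Type) : Type := option M.

Section Labels.
Variable M : Type.

HB.instance Definition _ := gen_eqMixin (olab M).
HB.instance Definition _ := gen_choiceMixin (olab M).

Let op (U : set (olab M)) : Prop := U None -> U = setT.

Let opT : op setT. Proof. by []. Qed.

Let opI : setI_closed op.
Proof. by move=> U V hU hV [/hU -> /hV ->]; rewrite setIT. Qed.

Let op_bigU (I : Type) (f : I -> set (olab M)) : (forall i, op (f i)) -> op (\bigcup_i f i).
Proof.
move=> hf [i _ /(hf i) fi]; apply/seteqP; split=> // x _.
by exists i; rewrite ?fi.
Qed.

HB.instance Definition _ := isOpenTopological.Build (olab M) opT opI op_bigU.

Lemma open_some (c : M) : open [set x : olab M | x = Some c].
Proof. by []. Qed.

Lemma olab_cts_at (T : topologicalType) (l : T -> olab M) (x : T) :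
  (forall c, l x = Some c -> \forall y \near x, l y = Some c) -> {for x, continuous l}.
Proof.
move=> h U; rewrite /= nbhsE => -[V [oV Vx] VU].
case E: (l x) Vx => [c|] Vx.
  by apply: filterS (h c E) => y /= ->; exact: VU.
have VT : V = setT by exact: oV.
by apply: filterS filterT => y _; apply: VU; rewrite VT.
Qed.

End Labels.

(* A set [cM] of vertices on which the letters act and the words [w f] act trivially.  The complex
   [cpx] has an edge from [m] to [m x] for each generator [x] and a face at [m] for each [f]: for
   the one-point set it is the presentation complex, for [cM = G] its universal cover. *)
Record cdata (X : choiceType) (F : Type) (w : F -> seq (X * bool)) := CData {
  cM : Type;
  cmv : cM -> X * bool -> cM;
  cmvK : forall m a, cmv (cmv m a) (inv_letter a) = m;
  cloop : forall m f, foldl cmv m (w f) = m }.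

Section Complex.
Variables (R : realType) (X : choiceType) (F : Type) (w : F -> seq (X * bool)).

Section Points.
Variable D : cdata w.
Local Notation M := (cM D).
Local Notation mv := (@cmv _ _ _ D).

(** Every point lies in exactly one open cell, so the complex is a set of normal forms and not a
    quotient of a union of closed cells; equality of points can be read off. *)
Inductive pre := PV of M | PE of M & X & R | PF of M & F & R & R.

Definition valid (z : pre) : bool :=
  match z with
  | PV _ => true
  | PE _ _ t => 0 < t < 1
  | PF _ _ s t => (0 < s < 1) && (0 < t < 1)
  end.

Definition cpx : Type := {z : pre | valid z}.

HB.instance Definition _ := gen_eqMixin cpx.
HB.instance Definition _ := gen_choiceMixin cpx.

Definition vert (m : M) : cpx := exist _ (PV m) isT.

Definition ins (d : cpx) (z : pre) : cpx :=
  match pselect (valid z) with left h => exist _ z h | right _ => d end.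

(** For [1 <= t] the point [PE m x t] is not valid, and the default of [ins] supplies the end
    vertex. *)
Definition edge (m : M) (x : X) (t : R) : cpx :=
  if t <= 0 then vert m else ins (vert (mv m (x, true))) (PE m x t).

Definition ledge (m : M) (a : X * bool) (t : R) : cpx :=
  if a.2 then edge m a.1 t else edge (mv m a) a.1 (1 - t).

Fixpoint wpath (m : M) (u : seq (X * bool)) : R -> cpx :=
  if u is a :: u' then
    fun s => ifle s 2^-1 (ledge m a (2 * s)) (wpath (mv m a) u' (2 * s - 1))
  else fun=> vert m.

(* A square whose top side runs along the path [w f]; the other sides are collapsed to [m]. *)
Definition face (m : M) (f : F) (x : R * R) : cpx :=
  if 1 <= x.2 then wpath m (w f) x.1 else ins (vert m) (PF m f x.1 x.2).

(* The final topology for the edges and faces. *)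
Let op (U : set cpx) : Prop :=
  (forall m x, open (edge m x @^-1` U)) /\ (forall m f, open (face m f @^-1` U)).

Let opT : op setT. Proof. by split=> *; exact: openT. Qed.

Let opI : setI_closed op.
Proof.
move=> U V [U1 U2] [V1 V2]; split=> m x; rewrite preimage_setI; apply: openI => //.
Qed.

Let op_bigU (I : Type) (f : I -> set cpx) : (forall i, op (f i)) -> op (\bigcup_i f i).
Proof.
by move=> hf; split=> m x; rewrite preimage_bigcup; apply: bigcup_open => i _; case: (hf i).
Qed.

HB.instance Definition _ := isOpenTopological.Build cpx opT opI op_bigU.

Lemma edge_cts m x : continuous (edge m x).
Proof. by apply/continuousP => U [h _]; exact: h. Qed.

Lemma face_cts m f : continuous (face m f).
Proof. by apply/continuousP => U [_ h]; exact: h. Qed.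

Lemma cpx_open (U : set cpx) : (forall m x, open (edge m x @^-1` U)) ->
  (forall m f, open (face m f @^-1` U)) -> open U.
Proof. by []. Qed.

Lemma cpx_cts (Z : topologicalType) (g : cpx -> Z) :
  (forall m x, continuous (fun t => g (edge m x t))) ->
  (forall m f, continuous (fun y => g (face m f y))) -> continuous g.
Proof.
move=> he hf; apply/continuousP => U oU; split=> m x.
  by have /continuousP/(_ U oU) := he m x.
by have /continuousP/(_ U oU) := hf m x.
Qed.

Lemma edge0 m x t : t <= 0 -> edge m x t = vert m.
Proof. by rewrite /edge => ->. Qed.

Lemma edge1 m x t : 1 <= t -> edge m x t = vert (mv m (x, true)).
Proof.
move=> t1; rewrite /edge if_ltF; last by lra.
by rewrite /ins; case: pselect => // h; exfalso; have /= := h; lra.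
Qed.

Lemma edge_in m x t : 0 < t < 1 -> sval (edge m x t) = PE m x t.
Proof.
move=> h; rewrite /edge if_ltF; last by lra.
by rewrite /ins; case: pselect.
Qed.

Lemma edge_cl m x t : edge m x (cl t) = edge m x t.
Proof. by case: (clP t) => // h; [rewrite !edge0|rewrite !edge1]. Qed.

Lemma ledge0 m a t : t <= 0 -> ledge m a t = vert m.
Proof.
rewrite /ledge => t0; case: ifPn => ha; first exact: edge0.
rewrite edge1; last by lra.
rewrite -{2}(cmvK m a); congr (vert (mv _ _)).
by case: a ha => x b /=; rewrite /inv_letter /= => /negbTE ->.
Qed.

Lemma ledge1 m a t : 1 <= t -> ledge m a t = vert (mv m a).
Proof.
rewrite /ledge => t0; case: ifPn => ha; last by rewrite edge0 //; lra.
by rewrite edge1 //; case: a ha => x [].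
Qed.

Lemma ledge_cts m a : continuous (ledge m a).
Proof.
rewrite /ledge; case: (a.2); first exact: edge_cts.
have ce := edge_cts (m := mv m a) (x := a.1).
by cts.
Qed.

Lemma wpath0 m u s : s <= 0 -> wpath m u s = vert m.
Proof.
case: u => [//|a u] s0 /=; rewrite /ifle ifT; last by lra.
by apply: ledge0; lra.
Qed.

Lemma wpath1 m u s : 1 <= s -> wpath m u s = vert (foldl mv m u).
Proof.
elim: u m s => [//|a u IH] m s s1 /=; rewrite /ifle if_ltF; last by lra.
by apply: IH; lra.
Qed.

Lemma wpath_cts m u : continuous (wpath m u).
Proof.
elim: u m => [|a u IH] m /=; first by cts.
have ce := @ledge_cts m a; have := IH (mv m a); move: (wpath _ _) (@wpath0 (mv m a) u) => g g0 cg.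
cts => s ->; rewrite ledge1 ?g0 //; lra.
Qed.

Lemma face_top m f s t : 1 <= t -> face m f (s, t) = wpath m (w f) s.
Proof. by rewrite /face /= => ->. Qed.

Lemma face_side m f s t : s <= 0 \/ 1 <= s \/ t <= 0 -> face m f (s, t) = vert m.
Proof.
move=> h; rewrite /face /=; case: ifPn => ht.
  case: h => [s0|[s1|t0]]; [exact: wpath0|by rewrite wpath1 // cloop|exfalso; lra].
by rewrite /ins; case: pselect => // hv; exfalso; have /= := hv; lra.
Qed.

Lemma face_in m f s t : 0 < s < 1 -> 0 < t < 1 -> sval (face m f (s, t)) = PF m f s t.
Proof.
move=> hs ht; rewrite /face /= if_ltF; last by lra.
by rewrite /ins; case: pselect => //=; rewrite hs ht.
Qed.

Lemma face_cl m f s t : face m f (cl s, cl t) = face m f (s, t).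
Proof.
have [t1|t1] := lerP 1 t.
  rewrite (cl_1 t1) !face_top //; case: (clP s) => // h; first by rewrite !wpath0.
  by rewrite !wpath1.
case: (clP s) => [s0|s0 s1|s1].
- by rewrite !face_side //; left.
- case: (clP t) t1 => [t0 _|//|h h']; last by exfalso; lra.
  by rewrite !face_side //; right; right.
- by rewrite !face_side //; right; left.
Qed.

Lemma cpx_inj (z z' : cpx) : sval z = sval z' -> z = z'.
Proof. by case: z z' => [z hz] [z' hz'] /= e; apply: eq_exist. Qed.

Lemma cpx_case (P : cpx -> Prop) : (forall m, P (vert m)) ->
  (forall m x t, 0 < t < 1 -> P (edge m x t)) ->
  (forall m f s t, 0 < s < 1 -> 0 < t < 1 -> P (face m f (s, t))) -> forall z, P z.
Proof.
move=> hV hE hF [[m|m x t|m f s t] hz].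
- by rewrite (_ : exist _ _ _ = vert m) //; exact: cpx_inj.
- rewrite (_ : exist _ _ _ = edge m x t); first exact: hE.
  by apply: cpx_inj; rewrite edge_in.
- have /andP[hs ht] := hz.
  rewrite (_ : exist _ _ _ = face m f (s, t)); first exact: hF.
  by apply: cpx_inj; rewrite face_in.
Qed.

Section Elim.
Variables (Z : Type) (v : M -> Z) (e : M -> X -> R -> Z) (f : M -> F -> R * R -> Z).

Definition cpx_elim (z : cpx) : Z :=
  match sval z with
  | PV m => v m
  | PE m x t => e m x t
  | PF m k s t => f m k (s, t)
  end.

Lemma elim_edge m x t : (t <= 0 -> e m x t = v m) ->
  (1 <= t -> e m x t = v (mv m (x, true))) -> cpx_elim (edge m x t) = e m x t.
Proof.
move=> h0 h1; have [t0|t0] := lerP t 0; first by rewrite edge0 // h0.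
have [t1|t1] := lerP 1 t; first by rewrite edge1 // h1.
by rewrite /cpx_elim edge_in // t0.
Qed.

Lemma elim_face m k s t : (1 <= t -> f m k (s, t) = cpx_elim (wpath m (w k) s)) ->
  (t < 1 -> s <= 0 \/ 1 <= s \/ t <= 0 -> f m k (s, t) = v m) ->
  cpx_elim (face m k (s, t)) = f m k (s, t).
Proof.
move=> h1 h0; have [t1|t1] := lerP 1 t; first by rewrite face_top // h1.
have [s0|s0] := lerP s 0; first by rewrite face_side ?h0 //; left.
have [s1|s1] := lerP 1 s; first by rewrite face_side ?h0 //; right; left.
have [t0|t0] := lerP t 0; first by rewrite face_side ?h0 //; right; right.
by rewrite /cpx_elim face_in // ?s0 ?t0.
Qed.

End Elim.

Lemma wpath_fun_cts (Z : topologicalType) (g : cpx -> Z) m u :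
  (forall m x, continuous (fun t => g (edge m x t))) -> continuous (fun s => g (wpath m u s)).
Proof.
move=> he; elim: u m => [|a u IH] m /=; first by cts.
have cl_a : continuous (fun t => g (ledge m a t)).
  rewrite /ledge; case: (a.2); first exact: he.
  by apply: (cts_comp (u := fun t : R => 1 - t) (he (mv m a) a.1)); cts.
have cw := IH (mv m a).
rewrite (_ : (fun s => _) = fun s => ifle s 2^-1 (g (ledge m a (2 * s)))
  (g (wpath (mv m a) u (2 * s - 1)))); last first.
  by apply/funext => s; rewrite /ifle; case: ifP.
apply: cts_ifle; [by cts|by cts| | |].
- by apply: (cts_comp (u := fun s : R => 2 * s) cl_a); cts.
- by apply: (cts_comp (u := fun s : R => 2 * s - 1) cw); cts.
- by move=> s ->; rewrite ledge1 ?wpath0 //; lra.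
Qed.

End Points.

Section Morphism.
Variables (D D' : cdata w) (g : cM D -> cM D').
Hypothesis hg : forall m a, g (cmv m a) = cmv (g m) a.

Definition cmap : cpx D -> cpx D' :=
  cpx_elim (fun m => vert (g m)) (fun m x t => edge (g m) x t) (fun m f y => face (g m) f y).

Lemma cmap_vert m : cmap (vert m) = vert (g m).
Proof. by []. Qed.

Lemma cmap_edge m x t : cmap (edge m x t) = edge (g m) x t.
Proof.
by apply: elim_edge => [|h]; [exact: edge0|rewrite edge1 // hg].
Qed.

Lemma cmap_ledge m a t : cmap (ledge m a t) = ledge (g m) a t.
Proof. by rewrite /ledge; case: ifP; rewrite cmap_edge ?hg. Qed.

Lemma cmap_wpath m u s : cmap (wpath m u s) = wpath (g m) u s.
Proof.
elim: u m s => [//|a u IH] m s /=; rewrite /ifle; case: ifP => _.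
  exact: cmap_ledge.
by rewrite IH hg.
Qed.

Lemma cmap_face m f y : cmap (face m f y) = face (g m) f y.
Proof.
case: y => s t; apply: elim_face => [h|_ h]; last exact: face_side.
by rewrite face_top // -cmap_wpath.
Qed.

Lemma cmap_cts : continuous cmap.
Proof.
apply: cpx_cts => [m x|m f].
  rewrite (_ : (fun t => _) = edge (g m) x); first exact: edge_cts.
  by apply/funext => t; exact: cmap_edge.
rewrite (_ : (fun t => _) = face (g m) f); first exact: face_cts.
by apply/funext => t; exact: cmap_face.
Qed.

End Morphism.
End Complex.

(** * Locally constant labels and evenly covered sets *)

Section Labelling.
Variables (R : realType) (X : choiceType) (F : Type) (w : F -> seq (X * bool)).
Variable D : cdata w.
Local Notation M := (cM D).
Local Notation mv := (@cmv _ _ _ D).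
Local Notation Y := (cpx R D).

Section Extension.
Variables (v : M -> olab M) (e : M -> X -> R -> olab M) (d : M -> R * R -> olab M).

Definition skel_lab : Y -> olab M := cpx_elim v e (fun _ _ _ => None : olab M).

(* A label of the 1-skeleton extends to the faces off their centre, along the
   rays from the centre (1/2, 1/2) to the top side; rays that miss the top side
   end on a side that is collapsed to the vertex [m]. *)
Definition ext_lab (m : M) (f : F) (y : R * R) : olab M :=
  if y.2 <= 2^-1 then d m y else
  skel_lab (wpath m (w f) (2^-1 + (y.1 - 2^-1) / (2 * Num.min 1 y.2 - 1))).

Definition lab : Y -> olab M := cpx_elim v e ext_lab.

(** [d_mid] is the gluing condition on the middle line of a face: a horizontal ray from the centre
    ends on a collapsed side, so a label there must be that of the vertex. *)
Hypotheses (e_0 : forall m x t, t <= 0 -> e m x t = v m)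
  (e_1 : forall m x t, 1 <= t -> e m x t = v (mv m (x, true)))
  (e_cts : forall m x, continuous (e m x))
  (d_side : forall m s t, s <= 0 \/ 1 <= s \/ t <= 0 -> d m (s, t) = v m)
  (d_cts : forall m (y : R * R), y.2 < 2^-1 -> {for y, continuous (d m)})
  (d_mid : forall m (y : R * R), y.2 = 2^-1 -> d m y = None \/
     [/\ y.1 != 2^-1, v m = d m y & forall z : R * R, z.1 != 2^-1 -> d m z = d m y]).

Lemma skel_lab_edge m x t : skel_lab (edge m x t) = e m x t.
Proof. by apply: elim_edge => h; [rewrite e_0|rewrite e_1]. Qed.

Lemma lab_edge m x t : lab (edge m x t) = e m x t.
Proof. by apply: elim_edge => h; [rewrite e_0|rewrite e_1]. Qed.

Lemma lab_wpath m u s : lab (wpath m u s) = skel_lab (wpath m u s).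
Proof.
elim: u m s => [//|a u IH] m s /=; rewrite /ifle; case: ifP => _ //.
by rewrite /ledge; case: ifP; rewrite lab_edge skel_lab_edge.
Qed.

Lemma lab_face m f s t : lab (face m f (s, t)) = ext_lab m f (s, t).
Proof.
apply: elim_face => [h|h1 h].
  rewrite -/lab lab_wpath /ext_lab /= if_ltF; last by lra.
  rewrite min_l // (_ : 2 * 1 - 1 = 1 :> R); last by lra.
  by rewrite divr1 addrC subrK.
rewrite /ext_lab /=; case: ifPn => ht; first exact: d_side.
rewrite -ltNge in ht; rewrite min_r; last by lra.
have t0 : 0 < 2 * t - 1 by lra.
case: h => [s0|[s1|t1]]; last by exfalso; lra.
  by rewrite wpath0 // -lerBrDl sub0r ler_pdivrMr //; lra.
by rewrite wpath1 ?cloop // -lerBlDl ler_pdivlMr //; lra.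
Qed.

Lemma skel_lab_cts m u : continuous (fun s => skel_lab (wpath m u s)).
Proof.
apply: wpath_fun_cts => m' x; rewrite (_ : (fun t => _) = e m' x); first exact: e_cts.
by apply/funext => t; exact: skel_lab_edge.
Qed.

Lemma ext_lab_cts m f : continuous (ext_lab m f).
Proof.
move=> y.
have cs : continuous (fun y : R * R => y.1) by cts.
have ct : continuous (fun y : R * R => y.2) by cts.
have ch : continuous (fun _ : R * R => 2^-1 : R) by cts.
have [lt|gt|eq] := ltgtP y.2 2^-1.
- apply: (paste_at ct ch) => [_|h|h]; [exact: d_cts|exfalso; lra|exfalso; lra].
- apply: (paste_at ct ch) => [h|_|h]; [exfalso; lra| |exfalso; lra].
  apply: (@cts_at_comp _ _ _ (fun s => skel_lab (wpath m (w f) s))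
    (fun y : R * R => 2^-1 + (y.1 - 2^-1) / (2 * Num.min 1 y.2 - 1)) y); first exact: skel_lab_cts.
  have ny : 2 * Num.min 1 y.2 - 1 != 0.
    by apply/eqP; case: (lerP 1 y.2) => h'; lra.
  apply: cvgD; first exact: cvg_cst.
  apply: cvgM; first by have h : continuous (fun y : R * R => y.1 - 2^-1); [cts|exact: h].
  apply: cvgV => //.
  by have h : continuous (fun y : R * R => 2 * Num.min 1 y.2 - 1); [cts|exact: h].
- have [dN|[ny lE dE]] := d_mid m eq.
    by apply: olab_cts_at => c'; rewrite /ext_lab eq lexx dN.
  apply: (@continuous_near_eq _ _ _ (fun=> d m y)); last exact: cvg_cst.
  have npos : 0 < `|y.1 - 2^-1| by rewrite normr_gt0 subr_eq0.
  have cn : continuous (fun z : R * R => `|z.1 - 2^-1|).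
    by move=> z; apply: cvg_norm; have h : continuous (fun y : R * R => y.1 - 2^-1); [cts|exact: h].
  (* In this neighbourhood a ray above the middle line meets the line of height 1 at distance more
     than 1/2 from its midpoint, hence outside the top side, where [wpath] is already the vertex. *)
  have n1 : nbhs y [set z : R * R | `|y.1 - 2^-1| / 2 < `|z.1 - 2^-1| ].
    by apply: near_lt_fun => //=; [cts|lra].
  have n2 : nbhs y [set z : R * R | 2 * z.2 - 1 < `|y.1 - 2^-1| ].
    by apply: (near_lt_fun (f := fun z : R * R => 2 * z.2 - 1)); [cts|cts|rewrite /= eq; lra].
  have n3 : nbhs y [set z : R * R | z.2 < 1].
    by apply: near_lt_fun => //; [cts|rewrite eq; lra].
  apply: filterS (filterI n1 (filterI n2 n3)) => z /= [h1 [h2 h3]].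
  rewrite /ext_lab; case: ifPn => hz.
    by apply: dE; apply/eqP => z1; move: h1; rewrite z1 subrr normr0; lra.
  rewrite -ltNge in hz; rewrite min_r; last by lra.
  have t0 : 0 < 2 * z.2 - 1 by lra.
  rewrite -lE; move: h1; case: (ger0P (z.1 - 2^-1)) => hs h1.
    rewrite wpath1 ?cloop // -lerBlDl ler_pdivlMr //; lra.
  rewrite wpath0 // -lerBrDl sub0r ler_pdivrMr //; lra.
Qed.

Lemma lab_cts : continuous lab.
Proof.
apply: cpx_cts => [m x|m f].
  rewrite (_ : (fun t => _) = e m x); first exact: e_cts.
  by apply/funext => t; exact: lab_edge.
rewrite (_ : (fun y => _) = ext_lab m f); first exact: ext_lab_cts.
by apply/funext => -[s t]; exact: lab_face.
Qed.

End Extension.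

(** Three labellings whose domains cover the complex. [labV] takes the nearest vertex; it is
    undefined at midpoints of edges, at centres of faces and on the rays from a centre to such a
    midpoint. [labE] is defined on the open edges and on the rays above them in the upper halves of
    the faces, [labF] on the open faces. *)
Definition vertV (m : M) : olab M := Some m.
Definition edgeV (m : M) (x : X) (t : R) : olab M :=
  if t < 2^-1 then Some m else if 2^-1 < t then Some (mv m (x, true)) else None.
Definition centreV (m : M) (y : R * R) : olab M :=
  if (y.1 == 2^-1) && (y.2 == 2^-1) then None else Some m.

Definition labV : Y -> olab M := lab vertV edgeV centreV.

Definition vertE (m : M) : olab M := None.
Definition edgeE (m : M) (x : X) (t : R) : olab M := if 0 < t < 1 then Some m else None.
Definition centreE (m : M) (y : R * R) : olab M := None.

Definition labE : Y -> olab M := lab vertE edgeE centreE.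

Definition labF : Y -> olab M := cpx_elim (fun m => None : olab M) (fun _ _ _ => None)
  (fun m f y => if (0 < y.1 < 1) && (0 < y.2 < 1) then Some m : olab M else None).

Lemma edgeV_0 m x t : t <= 0 -> edgeV m x t = vertV m.
Proof. by move=> h; rewrite /edgeV ifT //; lra. Qed.

Lemma edgeV_1 m x t : 1 <= t -> edgeV m x t = vertV (mv m (x, true)).
Proof. by move=> h; rewrite /edgeV ltNge (_ : 2^-1 <= t) 1?(_ : 2^-1 < t) //; lra. Qed.

Lemma edgeE_0 m x t : t <= 0 -> edgeE m x t = vertE m.
Proof. by move=> h; rewrite /edgeE ifF //; apply/negbTE/negP => /= h'; lra. Qed.

Lemma edgeE_1 m x t : 1 <= t -> edgeE m x t = vertE (mv m (x, true)).
Proof. by move=> h; rewrite /edgeE ifF //; apply/negbTE/negP => /= h'; lra. Qed.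

Lemma centreV_side m s t : s <= 0 \/ 1 <= s \/ t <= 0 -> centreV m (s, t) = vertV m.
Proof.
move=> h; rewrite /centreV ifF //=; apply/negbTE/negP => /andP[/eqP h1 /eqP h2].
by case: h => [|[]]; lra.
Qed.

Lemma labV_cts : continuous labV.
Proof.
have cN (m : M) (z : R * R) : z.1 != 2^-1 -> centreV m z = Some m.
  by rewrite /centreV => /negbTE ->.
apply: lab_cts; [exact: edgeV_0|exact: edgeV_1| |exact: centreV_side| |].
- move=> m x t; apply: olab_cts_at => c; rewrite /edgeV; case: ifPn => [h [<-]|_].
    have n : nbhs t [set t | t < 2^-1] by apply: near_lt_fun => //; cts.
    by apply: filterS n => t' /= ->.
  case: ifPn => [h [<-]|//].
  have n : nbhs t [set t | 2^-1 < t] by apply: near_lt_fun => //; cts.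
  by apply: filterS n => t' /= h'; rewrite h' ltNge ltW.
- move=> m y hy; apply: (@continuous_near_eq _ _ _ (fun=> Some m : olab M)); last exact: cvg_cst.
  have n : nbhs y [set z : R * R | z.2 < 2^-1] by apply: near_lt_fun => //; cts.
  apply: filterS n => z /= hz; rewrite /centreV ifF //.
  by apply/negbTE/negP => /andP[_ /eqP]; lra.
- move=> m y hy; have [hy1|hy1] := eqVneq y.1 2^-1; first by left; rewrite /centreV hy hy1 !eqxx.
  by right; split=> //; [rewrite cN|move=> z hz; rewrite !cN].
Qed.

Lemma labE_cts : continuous labE.
Proof.
apply: lab_cts => //; [exact: edgeE_0|exact: edgeE_1| | |by left].
- move=> m x t; apply: olab_cts_at => c; rewrite /edgeE; case: ifPn => [/andP[h1 h2] [<-]|//].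
  have n1 : nbhs t [set t | t < 1] by apply: near_lt_fun => //; cts.
  have n2 : nbhs t [set t | 0 < t] by apply: near_lt_fun => //; cts.
  by apply: filterS (filterI n1 n2) => t' /= [-> ->].
- by move=> m y _; exact: cvg_cst.
Qed.

Lemma labF_edge m x t : labF (edge m x t) = None.
Proof. by apply: elim_edge. Qed.

Lemma labF_face m f s t : labF (face m f (s, t)) =
  if (0 < s < 1) && (0 < t < 1) then Some m else None.
Proof.
apply: elim_face => [h|_ h].
  rewrite ifF; last by apply/negbTE/negP => /= h'; lra.
  elim: (w f) m s => [//|a u IH] m' s' /=; rewrite /ifle; case: ifP => _ //.
  by rewrite /ledge; case: ifP => _; rewrite -/labF labF_edge.
by rewrite ifF //; apply/negbTE/negP => /= h'; case: h => [|[]]; lra.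
Qed.

Lemma labF_cts : continuous labF.
Proof.
apply: cpx_cts => [m x|m f].
  rewrite (_ : (fun t => _) = fun=> None : olab M); first exact: cts_cst.
  by apply/funext => t; exact: labF_edge.
move=> [s t]; apply: olab_cts_at => c; rewrite labF_face.
case: ifPn => [/andP[/andP[h1 h2] /andP[h3 h4]] [<-]|//].
have n1 : nbhs (s, t) [set z : R * R | 0 < z.1] by apply: near_lt_fun => //; cts.
have n2 : nbhs (s, t) [set z : R * R | z.1 < 1] by apply: near_lt_fun => //; cts.
have n3 : nbhs (s, t) [set z : R * R | 0 < z.2] by apply: near_lt_fun => //; cts.
have n4 : nbhs (s, t) [set z : R * R | z.2 < 1] by apply: near_lt_fun => //; cts.
apply: filterS (filterI (filterI n1 n2) (filterI n3 n4)) => -[s' t'] /= [[k1 k2] [k3 k4]].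
by rewrite labF_face k1 k2 k3 k4.
Qed.

Lemma lab_cover z : labV z <> None \/ labE z <> None \/ labF z <> None.
Proof.
elim/cpx_case: z => [m|m x t ht|m f s t hs ht]; first by left.
  by right; left; rewrite /labE lab_edge /edgeE ?ht //; [exact: edgeE_0|exact: edgeE_1].
by right; right; rewrite labF_face hs ht.
Qed.

End Labelling.

Section LabelMorphism.
Variables (R : realType) (X : choiceType) (F : Type) (w : F -> seq (X * bool)).
Variables (D D' : cdata w) (g : cM D -> cM D').
Hypothesis hg : forall m a, g (cmv m a) = cmv (g m) a.

Lemma cmap_lab (v : cM D -> olab (cM D)) e d (v' : cM D' -> olab (cM D')) e' d' (z : cpx R D) :
  (forall m, v' (g m) = omap g (v m)) -> (forall m x t, e' (g m) x t = omap g (e m x t)) ->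
  (forall m y, d' (g m) y = omap g (d m y)) ->
  lab v' e' d' (cmap g z) = omap g (lab v e d z).
Proof.
move=> vg eg dg.
have skelE (y : cpx R D) : skel_lab v' e' (cmap g y) = omap g (skel_lab v e y).
  elim/cpx_case: y => [m|m x t ht|m f s t hs ht]; first exact: vg.
    by rewrite cmap_edge // /skel_lab /cpx_elim !edge_in.
  by rewrite cmap_face // /skel_lab /cpx_elim !face_in.
elim/cpx_case: z => [m|m x t ht|m f s t hs ht]; first exact: vg.
  by rewrite cmap_edge // /lab /cpx_elim !edge_in.
rewrite cmap_face // /lab /cpx_elim !face_in // /ext_lab; case: ifP => _; first exact: dg.
by rewrite -cmap_wpath.
Qed.

Lemma cmap_labV (z : cpx R D) : labV (cmap g z) = omap g (labV z).
Proof.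
apply: cmap_lab => // m *; last by rewrite /centreV; case: ifP.
by rewrite /edgeV -hg; do 2?case: ifP.
Qed.

Lemma cmap_labE (z : cpx R D) : labE (cmap g z) = omap g (labE z).
Proof. by apply: cmap_lab => // m *; rewrite /edgeE; case: ifP. Qed.

Lemma cmap_labF (z : cpx R D) : labF (cmap g z) = omap g (labF z).
Proof.
elim/cpx_case: z => [m|m x t ht|m f s t hs ht] //.
  by rewrite cmap_edge // !labF_edge.
by rewrite cmap_face // !labF_face hs ht.
Qed.

End LabelMorphism.

(** * The covering of the presentation complex by the Cayley complex *)

Section UnitComplex.
Variables (R : realType) (X : choiceType) (F : Type) (w : F -> seq (X * bool)).

Lemma unit_eq (a b : unit) : a = b. Proof. by case: a; case: b. Qed.

Definition udata : cdata w := @CData X F w unit (fun m _ => m)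
  (fun _ _ => erefl) (fun m f => unit_eq _ m).

Local Notation C := (cpx R udata).
Local Notation uedg := (edge (R := R) (D := udata)).
Local Notation ufc := (face (R := R) (D := udata)).
Local Notation uwp := (wpath (R := R) (D := udata)).

Section CayleyComplex.
Variables (G : groupType) (rho : X -> G).
Hypothesis rel : forall f, eval_word rho (w f) = 1%g.

Let mv (m : G) (a : X * bool) : G := (m * eval_letter rho a)%g.

Lemma foldl_eval m u : foldl mv m u = (m * eval_word rho u)%g.
Proof.
elim: u m => [|a u IH] m /=; first by rewrite /eval_word big_nil mulg1.
by rewrite IH /eval_word big_cons mulgA.
Qed.

Lemma gdata_mvK m a : mv (mv m a) (inv_letter a) = m.
Proof. by rewrite /mv eval_inv_letter mulgK. Qed.

Lemma gdata_loop m f : foldl mv m (w f) = m.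
Proof. by rewrite foldl_eval rel mulg1. Qed.

Definition gdata : cdata w := @CData X F w G mv gdata_mvK gdata_loop.

Local Notation Y := (cpx R gdata).
Local Notation vt := (vert R (D := gdata)).
Local Notation edg := (edge (R := R) (D := gdata)).
Local Notation fc := (face (R := R) (D := gdata)).

Definition deck (g : G) : Y -> Y :=
  cmap (D := gdata) (D' := gdata) (fun m : G => (g * m)%g).

Definition proj : Y -> C :=
  cmap (D := gdata) (D' := udata) (fun _ => tt).

Lemma deck_equiv g m a : (g * @cmv _ _ _ gdata m a)%g = @cmv _ _ _ gdata (g * m)%g a.
Proof. by rewrite /= /mv mulgA. Qed.

Lemma deck_edge g m x t : deck g (edg m x t) = edg (g * m)%g x t.
Proof. by rewrite /deck cmap_edge //; exact: deck_equiv. Qed.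

Lemma deck_face g m f y : deck g (fc m f y) = fc (g * m)%g f y.
Proof. by rewrite /deck cmap_face //; exact: deck_equiv. Qed.

Lemma deck_cts g : continuous (deck g).
Proof. by apply: cmap_cts; exact: deck_equiv. Qed.

Lemma deck_one y : deck 1%g y = y.
Proof.
elim/cpx_case: y => [m|m x t ht|m f s t hs ht].
- by rewrite /deck cmap_vert mul1g.
- by rewrite deck_edge mul1g.
- by rewrite deck_face mul1g.
Qed.

Lemma deck_mul g h y : deck (g * h)%g y = deck g (deck h y).
Proof.
elim/cpx_case: y => [m|m x t ht|m f s t hs ht].
- by rewrite /deck !cmap_vert mulgA.
- by rewrite !deck_edge mulgA.
- by rewrite !deck_face mulgA.
Qed.

Lemma proj_edge m x t : proj (edg m x t) = uedg tt x t.
Proof. exact: cmap_edge. Qed.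

Lemma proj_face m f y : proj (fc m f y) = ufc tt f y.
Proof. exact: cmap_face. Qed.

Lemma proj_cts : continuous proj.
Proof. exact: cmap_cts. Qed.

Lemma proj_deck g y : proj (deck g y) = proj y.
Proof.
elim/cpx_case: y => [m|m x t ht|m f s t hs ht] //.
- by rewrite deck_edge !proj_edge.
- by rewrite deck_face !proj_face.
Qed.

Lemma proj_surj x : exists y, proj y = x.
Proof.
elim/cpx_case: x => [[]|[] x t ht|[] f s t hs ht].
- by exists (vt 1%g).
- by exists (edg 1%g x t); rewrite proj_edge.
- by exists (fc 1%g f (s, t)); rewrite proj_face.
Qed.

Lemma proj_fib y y' : proj y = proj y' -> exists g, y' = deck g y.
Proof.
elim/cpx_case: y => [m|m x t ht|m f s t hs ht];
elim/cpx_case: y' => [m'|m' x' t' ht'|m' f' s' t' hs' ht'];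
rewrite ?proj_edge ?proj_face => /(congr1 sval); rewrite ?edge_in ?face_in //.
- by move=> _; exists (m' / m)%g; rewrite /deck cmap_vert mulgVK.
- by move=> [-> ->]; exists (m' / m)%g; rewrite deck_edge mulgVK.
- by move=> [-> -> ->]; exists (m' / m)%g; rewrite deck_face mulgVK.
Qed.

Lemma proj_open U : open U -> open (proj @` U).
Proof.
move=> oU; apply: cpx_open => [[] x|[] f].
- rewrite (_ : _ @^-1` _ = \bigcup_m (edg m x @^-1` U)).
    by apply: bigcup_open => m _; apply: open_comp => // t _; exact: edge_cts.
  apply/seteqP; split=> t /=; last first.
    by move=> [m _ /= Um]; exists (edg m x t) => //; rewrite proj_edge.
  move=> [y Uy]; rewrite -(proj_edge 1%g) => /esym/proj_fib[g yE].
  by exists (g * 1)%g => //=; rewrite -deck_edge -yE.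
- rewrite (_ : _ @^-1` _ = \bigcup_m (fc m f @^-1` U)).
    by apply: bigcup_open => m _; apply: open_comp => // t _; exact: face_cts.
  apply/seteqP; split=> t /=; last first.
    by move=> [m _ /= Um]; exists (fc m f t) => //; rewrite proj_face.
  move=> [y Uy]; rewrite -(proj_face 1%g) => /esym/proj_fib[g yE].
  by exists (g * 1)%g => //=; rewrite -deck_face -yE.
Qed.

Definition lab_dom (l : Y -> olab G) : set (Y) := [set y | l y <> None].
Definition lab_val (l : Y -> olab G) (y : Y) : G := odflt 1%g (l y : option G).

Lemma labelled_lab (l : Y -> olab G) : continuous l ->
  (forall g y, l (deck g y) = omap (fun h => g * h)%g (l y)) ->
  labelled deck (lab_dom l) (lab_val l).
Proof.
move=> l_cts le; split=> [c|g y /=].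
  have <- : l @^-1` [set x : olab G | x = Some c] = [set z | lab_dom l z /\ lab_val l z = c].
    apply/seteqP; rewrite /lab_dom /lab_val; split=> y /=; first by move=> ->.
    by case: (l y) => [g' [_ /= ->]|[]].
  by have /continuousP h := l_cts; exact: (h _ (@open_some _ c)).
by rewrite /lab_dom /lab_val /= le; case: (l y).
Qed.

Lemma proj_triv y : exists W lab, W y /\ labelled deck W lab.
Proof.
have [h|[h|h]] := lab_cover y.
- exists (lab_dom (@labV R X F w gdata)), (lab_val (@labV R X F w gdata)); split=> //.
  apply: labelled_lab => [|g z]; first exact: labV_cts.
  exact: (@cmap_labV R X F w gdata gdata _ (deck_equiv g)).
- exists (lab_dom (@labE R X F w gdata)), (lab_val (@labE R X F w gdata)); split=> //.
  apply: labelled_lab => [|g z]; first exact: labE_cts.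
  exact: (@cmap_labE R X F w gdata gdata _ (deck_equiv g)).
- exists (lab_dom (@labF R X F w gdata)), (lab_val (@labF R X F w gdata)); split=> //.
  apply: labelled_lab => [|g z]; first exact: labF_cts.
  exact: (@cmap_labF R X F w gdata gdata _ (deck_equiv g)).
Qed.

Theorem cayley_KG1 (H : Y * R -> Y) : continuous H ->
  (forall y, H (y, 0) = y) -> (forall y, H (y, 1) = vt 1%g) ->
  (forall t, H (vt 1%g, t) = vt 1%g) ->
  is_KG1 R (C) G.
Proof.
move=> cH H0 H1 Hb.
exact: (covering_KG1 deck_one deck_mul deck_cts proj_deck proj_cts proj_open proj_surj proj_fib
  proj_triv cH H0 H1 Hb).
Qed.

End CayleyComplex.

(** * The Hausdorff property *)

Section Hausdorff.

Variables (c : X -> R -> R) (d : F -> R * R -> R).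
Hypotheses (c_cts : forall x, continuous (c x)) (d_cts : forall f, continuous (d f))
  (c0 : forall x t, t <= 0 \/ 1 <= t -> c x t = 0)
  (d0 : forall f s t, s <= 0 \/ 1 <= s \/ t <= 0 \/ 1 <= t -> d f (s, t) = 0).

Let l1 : C -> R := cpx_elim (fun _ => 0) (fun _ x t => c x t) (fun _ _ _ => 0).

(* Real functions on the complex that separate its points. *)
Definition sepfun : C -> R := cpx_elim (fun _ => 0) (fun _ x t => c x t)
  (fun m f y => cl y.2 * l1 (uwp m (w f) y.1) + d f y).

Let l1_edge m x t : l1 (uedg m x t) = c x t.
Proof. by apply: elim_edge => h; rewrite c0 //; [left|right]. Qed.

Lemma sepfun_edge m x t : sepfun (uedg m x t) = c x t.
Proof. by apply: elim_edge => h; rewrite c0 //; [left|right]. Qed.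

Let sepfun_wpath m u s : sepfun (uwp m u s) = l1 (uwp m u s).
Proof.
elim: u m s => [//|a u IH] m s /=; rewrite /ifle; case: ifP => _ //.
by rewrite /ledge; case: ifP => _; rewrite sepfun_edge l1_edge.
Qed.

Lemma sepfun_face m f s t : sepfun (ufc m f (s, t)) =
  cl t * l1 (uwp m (w f) s) + d f (s, t).
Proof.
apply: elim_face => /= [h|h1 h].
  by rewrite cl_1 // mul1r d0 ?addr0 -?sepfun_wpath //; do 3 right.
rewrite d0 ?addr0; last by case: h => [|[|]] h; [left|right; left|right; right; left].
case: h => [h|[h|h]]; [|by rewrite wpath1 // mulr0|by rewrite cl_0 // mul0r].
by rewrite wpath0 // mulr0.
Qed.

Lemma sepfun_cts : continuous sepfun.
Proof.
apply: cpx_cts => m.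
  move=> x; rewrite (_ : (fun t => _) = c x); first exact: c_cts.
  by apply/funext => t; exact: sepfun_edge.
move=> f; rewrite (_ : (fun y => _) = fun y => cl y.2 * l1 (uwp m (w f) y.1) + d f y).
  have cw : continuous (fun s => l1 (uwp m (w f) s)).
    apply: wpath_fun_cts => m' x; rewrite (_ : (fun t => _) = c x); first exact: c_cts.
    by apply/funext => t; exact: l1_edge.
  have cw' := cts_comp (u := fun y : R * R => y.1) cw (cts_fst (@cts_id _)).
  have cd := @d_cts f.
  by cts.
by apply/funext => -[s t]; exact: sepfun_face.
Qed.

End Hausdorff.

Definition bump (t : R) : R := cl t * (1 - cl t).

Lemma bump_cts (T : topologicalType) (u : T -> R) : continuous u -> continuous (fun x => bump (u x)).
Proof. by move=> cu; rewrite /bump; cts. Qed.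

Lemma bump0 t : t <= 0 \/ 1 <= t -> bump t = 0.
Proof. by rewrite /bump => -[h|h]; [rewrite cl_0 // mul0r|rewrite cl_1 // subrr mulr0]. Qed.

Lemma bump2_0 s t : s <= 0 \/ 1 <= s \/ t <= 0 \/ 1 <= t -> bump s * bump t = 0.
Proof.
move=> [h|[h|h]]; [by rewrite bump0 ?mul0r //; left|by rewrite bump0 ?mul0r //; right|].
by rewrite [bump t]bump0 ?mulr0.
Qed.

Lemma bump_gt0 t : 0 < t < 1 -> bump t != 0.
Proof.
move=> h; rewrite /bump cl_id; last by lra.
by rewrite mulf_neq0 //; apply/eqP; lra.
Qed.

Lemma separating_hausdorff (T : topologicalType) :
  (forall x y : T, x != y -> exists2 f : T -> R, continuous f & f x != f y) -> hausdorff_space T.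
Proof.
move=> h; rewrite open_hausdorff => x y /h[f cf nf].
have := @Rhausdorff R; rewrite open_hausdorff => /(_ _ _ nf)[[A B] /= [fxA fyB] [oA oB AB]].
exists (f @^-1` A, f @^-1` B); first by rewrite /= !inE in fxA fyB *.
split=> /=; [by apply: open_comp => // z _; exact: cf..|].
by rewrite -preimage_setI (eqP AB) preimage_set0.
Qed.

Lemma ucpx_hausdorff : hausdorff_space (cpx R udata).
Proof.
apply: separating_hausdorff => z z' nz; apply: contrapT => nsep.
have sep (c : X -> R -> R) (d : F -> R * R -> R) : (forall x, continuous (c x)) -> (forall f, continuous (d f)) ->
    (forall x t, t <= 0 \/ 1 <= t -> c x t = 0) ->
    (forall f s t, s <= 0 \/ 1 <= s \/ t <= 0 \/ 1 <= t -> d f (s, t) = 0) ->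
    sepfun c d z = sepfun c d z'.
  move=> h1 h2 h3 h4; apply/eqP/negPn/negP => h; apply: nsep.
  by exists (sepfun c d) => //; exact: sepfun_cts.
(* A bump supported on one cell, times a function [k] of the coordinates: [k = 1] recognises the
   cell, and the coordinate functions then recognise the point. Functions built from [df] vanish on
   the 1-skeleton. *)
pose ce (x0 : X) (k : R -> R) x t := if x == x0 then bump t * k (cl t) else 0.
pose df (f0 : F) (k : R * R -> R) f y :=
  if pselect (f = f0) then bump y.1 * bump y.2 * k (cl y.1, cl y.2) else 0.
have sepe x0 k : continuous k -> sepfun (ce x0 k) (fun _ _ => 0) z = sepfun (ce x0 k) (fun _ _ => 0) z'.
  move=> ck; apply: sep => //.
  - move=> x; rewrite /ce; case: (x == x0); last exact: cts_cst.
    have cb := @bump_cts R id (@cts_id _).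
    by cts.
  - by move=> f; exact: cts_cst.
  - by move=> x t h; rewrite /ce; case: ifP => // _; rewrite bump0 // mul0r.
have sepf f0 k : continuous k -> sepfun (fun _ _ => 0) (df f0 k) z = sepfun (fun _ _ => 0) (df f0 k) z'.
  move=> ck; apply: sep => //.
  - by move=> x; exact: cts_cst.
  - move=> f; rewrite /df; case: (pselect _) => [ff|nf] /=; last exact: cts_cst.
    have cb1 := @bump_cts (R * R)%type (fun y => y.1) (cts_fst (@cts_id _)).
    have cb2 := @bump_cts (R * R)%type (fun y => y.2) (cts_snd (@cts_id _)).
    by cts.
  - move=> f s t h; rewrite /df; case: (pselect _) => [ff|//] /=.
    by rewrite bump2_0 ?mul0r.
have l0 (y : cpx R udata) : cpx_elim (fun _ => 0 : R) (fun _ _ _ => 0) (fun _ _ _ => 0) y = 0.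
  by rewrite /cpx_elim; case: (sval y).
have fF f0 k f s t : sepfun (fun _ _ => 0) (df f0 k) (ufc tt f (s, t)) = df f0 k f (s, t).
  rewrite sepfun_face //; first by rewrite l0 mulr0 add0r.
  move=> {}f {}s {}t h; rewrite /df; case: (pselect _) => [ff|//] /=.
  by rewrite bump2_0 ?mul0r.
have fE f0 k x t : sepfun (fun _ _ => 0) (df f0 k) (uedg tt x t) = 0.
  exact: sepfun_edge.
have eE x0 k x t : sepfun (ce x0 k) (fun _ _ => 0) (uedg tt x t) = ce x0 k x t.
  apply: sepfun_edge => {}x {}t h; rewrite /ce; case: ifP => // _; by rewrite bump0 // mul0r.
have c1 (T : topologicalType) : continuous (fun _ : T => 1 : R) by cts.
have dfE f0 k s t : df f0 k f0 (s, t) = bump s * bump t * k (cl s, cl t).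
  by rewrite /df; case: pselect.
have ceE x0 k t : ce x0 k x0 t = bump t * k (cl t) by rewrite /ce eqxx.
have bF s t : 0 < s < 1 -> 0 < t < 1 -> bump s * bump t * 1 != 0 :> R.
  by move=> hs ht; rewrite mulr1 mulf_neq0 ?bump_gt0.
have bE t : 0 < t < 1 -> bump t * 1 != 0 :> R by move=> ht; rewrite mulr1 bump_gt0.
move: nz sepe sepf; clear nsep sep.
elim/cpx_case: z => [[]|[] x t ht|[] f s t hs ht]; elim/cpx_case: z' => [[]|[] x' t' ht'|[] f' s' t' hs' ht'] nz sepe sepf.
- by rewrite eqxx in nz.
- by have := sepe x' _ (c1 _); rewrite eE ceE => /esym/eqP; rewrite (negbTE (bE _ ht')).
- by have := sepf f' _ (c1 _); rewrite fF dfE => /esym/eqP; rewrite (negbTE (bF _ _ hs' ht')).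
- by have := sepe x _ (c1 _); rewrite eE ceE => /eqP; rewrite (negbTE (bE _ ht)).
- have := sepe x _ (c1 _); rewrite !eE ceE /ce; case: (x' =P x) => [xx|_] /eqP; last by rewrite (negbTE (bE _ ht)).
  move=> /eqP; rewrite !mulr1 => e1; have := sepe x id (@cts_id _).
  rewrite !eE ceE /ce xx eqxx -e1 !cl_id; [|lra|lra].
  by move=> /(mulfI (bump_gt0 ht)) tt'; rewrite xx tt' eqxx in nz.
- by have := sepf f' _ (c1 _); rewrite fF fE dfE => /esym/eqP; rewrite (negbTE (bF _ _ hs' ht')).
- by have := sepf f _ (c1 _); rewrite fF dfE => /eqP; rewrite (negbTE (bF _ _ hs ht)).
- by have := sepf f _ (c1 _); rewrite fF fE dfE => /eqP; rewrite (negbTE (bF _ _ hs ht)).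
- have := sepf f _ (c1 _); rewrite !fF dfE /df.
  case: (pselect _) => [ff|nf] /= /eqP; last by rewrite (negbTE (bF _ _ hs ht)).
  move=> /eqP /=; rewrite !mulr1 => e1; subst f'.
  have b0 : bump s * bump t != 0 :> R by rewrite mulf_neq0 ?bump_gt0.
  have := sepf f _ (cts_fst (@cts_id _)); rewrite !fF !dfE -e1 /= => /(mulfI b0).
  have := sepf f _ (cts_snd (@cts_id _)); rewrite !fF !dfE -e1 /= => /(mulfI b0).
  rewrite !cl_id; [|lra..] => tt' ss'.
  by rewrite tt' ss' eqxx in nz.
Qed.

End UnitComplex.

(** * From the round disc to the square *)

Section DiscToSquare.
Variable R : realType.
Implicit Types v : 'rV[R]_2.

Let i1 : 'I_2 := ord_max.

(** Chosen so that on the circle, where [y ^ 2 = 1 - x ^ 2], the product [y * lens x] has absolute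
    value [1 - |x|]. *)
Definition lens (x : R) : R := Num.sqrt ((1 - `|x|) / (1 + `|x|)).

(* [(x, y)] is first moved to [(x, y * lens x)], which maps the disc onto the
   rhombus [|x| + |y| <= 1]. *)
Definition height v : R := v ord0 i1 * lens (v ord0 ord0).

(** The rhombus is carried onto the unit square by an affine change of coordinates. *)
Definition to_square v : R * R :=
  ((v ord0 ord0 + height v + 1) / 2, (height v - v ord0 ord0 + 1) / 2).

Lemma lens_cts (T : topologicalType) (u : T -> R) : continuous u -> continuous (fun x => lens (u x)).
Proof.
move=> cu; rewrite /lens; apply: (cts_comp (f := Num.sqrt)); first exact: sqrt_continuous.
have cn : continuous (fun x => `|u x|) by move=> x; apply: cvg_norm; exact: cu.
apply: cts_mul; first by cts.
move=> x; apply: cvgV; first by apply/eqP; have := normr_ge0 (u x); lra.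
by have h : continuous (fun x => 1 + `|u x|); [cts|exact: h].
Qed.

Lemma to_square_cts : continuous to_square.
Proof.
have c0 : continuous (fun v : 'rV[R]_2 => v ord0 ord0) by apply: cts_coord; exact: cts_id.
have c1 : continuous (fun v : 'rV[R]_2 => v ord0 i1) by apply: cts_coord; exact: cts_id.
have cl := lens_cts c0.
by rewrite /to_square /height /=; cts.
Qed.

Lemma sqnorm2 v : sqnorm v = v ord0 ord0 ^+ 2 + v ord0 i1 ^+ 2.
Proof.
by rewrite /sqnorm big_ord_recl big_ord1; congr (_ + v ord0 _ ^+ 2); apply: val_inj.
Qed.

Lemma lens_sqr x : `|x| <= 1 -> lens x ^+ 2 * (1 + `|x|) = 1 - `|x|.
Proof.
move=> x1; have x0 := normr_ge0 x; rewrite /lens sqr_sqrtr; last by rewrite divr_ge0 //; lra.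
by rewrite mulfVK //; apply/eqP; lra.
Qed.

Lemma lens_gt0 x : `|x| < 1 -> 0 < lens x.
Proof. by move=> x1; have x0 := normr_ge0 x; rewrite sqrtr_gt0 divr_gt0 //; lra. Qed.

Lemma disc_coord v : sqnorm v <= 1 -> `|v ord0 ord0| <= 1.
Proof.
rewrite sqnorm2 => h; have := sqr_ge0 (v ord0 i1).
by rewrite ler_norml => h'; apply/andP; split; nra.
Qed.

Lemma height_sqr v : `|v ord0 ord0| <= 1 ->
  `|height v| ^+ 2 * (1 + `|v ord0 ord0|) = v ord0 i1 ^+ 2 * (1 - `|v ord0 ord0|).
Proof. by move=> h; rewrite real_normK ?num_real // exprMn -mulrA lens_sqr. Qed.

Lemma height_cmp v : `|v ord0 ord0| < 1 ->
  (sqnorm v < 1) = (`|v ord0 ord0| + `|height v| < 1).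
Proof.
move=> x1; have e := height_sqr (ltW x1); rewrite sqnorm2 -(real_normK (num_real (v ord0 ord0))).
move: x1 e (normr_ge0 (v ord0 ord0)) (normr_ge0 (height v)) (sqr_ge0 (v ord0 i1)).
move: (`|v ord0 ord0|) (`|height v|) (v ord0 i1 ^+ 2) => a b c a1 e a0 b0 c0.
have -> : (a + b < 1) = (b < 1 - a) by rewrite [a + b]addrC ltrBrDr.
have a1' : 1 - a \is Num.nneg by rewrite nnegrE; lra.
(* After squaring and multiplying by [1 + a], the equation [e] turns the left side into
   [c * (1 - a)], and the positive factor [1 - a] cancels. *)
rewrite -[RHS](@ltr_pXn2r _ 2) //.
rewrite -[RHS](@ltr_pM2r _ (1 + a)); last by lra.
rewrite e (_ : (1 - a) ^+ 2 * (1 + a) = (1 - a ^+ 2) * (1 - a)); last by rewrite !expr2; ring.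
rewrite [RHS]ltr_pM2r; last by lra.
by rewrite ltrBrDl.
Qed.

Lemma height_sphere v : sqnorm v = 1 -> `|v ord0 ord0| + `|height v| = 1.
Proof.
move=> h; have x1 : `|v ord0 ord0| <= 1 by apply: disc_coord; rewrite h.
have e := height_sqr x1; move: h; rewrite sqnorm2 -(real_normK (num_real (v ord0 ord0))).
move: x1 e (normr_ge0 (v ord0 ord0)) (normr_ge0 (height v)) (sqr_ge0 (v ord0 i1)).
move: (`|v ord0 ord0|) (`|height v|) (v ord0 i1 ^+ 2) => a b c a1 e a0 b0 c0 h.
suff -> : b = 1 - a by rewrite subrKC.
have cE : c = 1 - a ^+ 2 by rewrite -h addrC addKr.
have /eqP : b ^+ 2 = (1 - a) ^+ 2.
  apply: (@mulIf _ (1 + a)); first by apply/eqP; lra.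
  by rewrite e cE !expr2; ring.
by rewrite eqrXn2 //; [move/eqP|lra].
Qed.

Lemma to_square_in v : sqnorm v < 1 -> 0 < (to_square v).1 < 1 /\ 0 < (to_square v).2 < 1.
Proof.
move=> h; have x1 : `|v ord0 ord0| < 1.
  move: h; rewrite sqnorm2 => h; have := sqr_ge0 (v ord0 i1).
  by rewrite ltr_norml => h'; apply/andP; split; nra.
move: h; rewrite (height_cmp x1) /to_square /=.
have := ler_norm (v ord0 ord0); have := ler_norm (- v ord0 ord0); rewrite normrN.
have := ler_norm (height v); have := ler_norm (- height v); rewrite normrN.
by move=> *; split; apply/andP; split; lra.
Qed.

Lemma to_square_inj v v' : sqnorm v < 1 -> sqnorm v' < 1 -> to_square v = to_square v' -> v = v'.
Proof.
move=> h h' [e1 e2].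
have ex : v ord0 ord0 = v' ord0 ord0 by lra.
have ey : height v = height v' by lra.
have x1 : `|v ord0 ord0| < 1.
  move: h; rewrite sqnorm2 => h; have := sqr_ge0 (v ord0 i1).
  by rewrite ltr_norml => h2; apply/andP; split; nra.
apply/rowP => i; have [->|ni] := eqVneq i ord0; first exact: ex.
have -> : i = i1 by apply: val_inj; case: i ni => -[|[|]].
by move: ey; rewrite /height -ex => /mulIf; apply; rewrite gt_eqF ?lens_gt0.
Qed.

Lemma to_square_surj s t : 0 < s < 1 -> 0 < t < 1 -> exists2 v, sqnorm v < 1 & to_square v = (s, t).
Proof.
move=> hs ht; have x1 : `|s - t| < 1 by rewrite ltr_norml; apply/andP; split; lra.
have l0 := lens_gt0 x1.
pose v : 'rV[R]_2 := \row_i (if i == ord0 then s - t else (s + t - 1) / lens (s - t)).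
have v0 : v ord0 ord0 = s - t by rewrite mxE.
have hv : height v = s + t - 1 by rewrite /height v0 mxE /= mulfVK // gt_eqF.
exists v; last by rewrite /to_square v0 hv; congr (_, _); lra.
rewrite height_cmp ?v0 // hv.
by case: (ger0P (s - t)) => h1; case: (ger0P (s + t - 1)) => h2; lra.
Qed.

Lemma to_square_sphere v : sqnorm v = 1 ->
  let s := (to_square v).1 in let t := (to_square v).2 in
  s <= 0 \/ 1 <= s \/ t <= 0 \/ 1 <= t.
Proof.
move=> /height_sphere; rewrite /to_square /=.
case: (ger0P (v ord0 ord0)) => h1; case: (ger0P (height v)) => h2 h.
- by right; left; lra.
- by right; right; left; lra.
- by right; right; right; lra.
- by left; lra.
Qed.

End DiscToSquare.

(** * The CW structure of the presentation complex *)

Section CW.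
Variables (R : realType) (X F : finType) (w : F -> seq (X * bool)).
Local Notation C := (cpx R (udata w)).

Definition cw_dim (i : option (X + F)) : nat :=
  match i with None => 0 | Some (inl _) => 1 | Some (inr _) => 2 end.

Definition cw_map (i : option (X + F)) : 'rV[R]_(cw_dim i) -> C :=
  match i with
  | None => fun _ => vert R (D := udata w) tt
  | Some (inl x) => fun v => edge (D := udata w) tt x ((v ord0 ord0 + 1) / 2)
  | Some (inr f) => fun v => face (D := udata w) tt f (to_square v)
  end.

Let cell i := @cw_map i @` @open_disc R (cw_dim i).

Let cellV : cell None = [set vert R (D := udata w) tt].
Proof.
apply/seteqP; split=> [_ [v _ <-]//|_ ->].
by exists 0 => //; rewrite /open_disc /= /sqnorm big_ord0 ltr01.
Qed.

Let sqnorm1 (v : 'rV[R]_1) : sqnorm v = v ord0 ord0 ^+ 2.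
Proof. by rewrite /sqnorm big_ord1. Qed.

Let cellE x : cell (Some (inl x)) = [set z | exists2 t, 0 < t < 1 & z = edge (D := udata w) tt x t].
Proof.
apply/seteqP; split=> [_ [v hv <-]|_ [t ht ->]].
  exists ((v ord0 ord0 + 1) / 2) => //; move: hv; rewrite /open_disc /= sqnorm1 => hv.
  by apply/andP; split; nra.
exists (const_mx (2 * t - 1)); first by rewrite /open_disc /= sqnorm1 mxE; nra.
by rewrite /= mxE; congr edge; lra.
Qed.

Let cellF f : cell (Some (inr f)) =
  [set z | exists s t, [/\ 0 < s < 1, 0 < t < 1 & z = face (D := udata w) tt f (s, t)]].
Proof.
apply/seteqP; split=> [_ [v hv <-]|_ [s [t [hs ht ->]]]].
  have [h1 h2] := to_square_in hv.
  by exists (to_square v).1, (to_square v).2; rewrite -surjective_pairing.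
by have [v hv e] := to_square_surj hs ht; exists v => //=; rewrite e.
Qed.

Let wpath_skel m u (s : R) : exists2 i, (cw_dim i < 2)%N & cell i (wpath (D := udata w) m u s).
Proof.
have sk x t : exists2 i, (cw_dim i < 2)%N & cell i (edge (D := udata w) tt x t).
  have [t0|t0] := lerP t 0; first by exists None => //; rewrite cellV edge0.
  have [t1|t1] := lerP 1 t; first by exists None => //; rewrite cellV edge1.
  by exists (Some (inl x)) => //; rewrite cellE; exists t => //; rewrite t0.
elim: u m s => [|a u IH] [] s /=; first by exists None => //; rewrite cellV.
by rewrite /ifle; case: ifP => _; [rewrite /ledge; case: ifP|].
Qed.

Lemma ucpx_CW : finite_CW_complex R 2 C.
Proof.
split; first exact: ucpx_hausdorff.
exists (option (X + F)), cw_dim, (@cw_map); split.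
- by case=> [[]|].
- move=> i; apply: continuous_subspaceT.
  have c0 n (j : 'I_n) : continuous (fun v : 'rV[R]_n => v ord0 j).
    by apply: cts_coord; exact: cts_id.
  case: i => [[x|f]|] /=; last exact: cts_cst.
    by apply: (cts_comp (f := edge (D := udata w) tt x)); [exact: edge_cts|have c0' := c0 1%N ord0; cts].
  by apply: (cts_comp (f := face (D := udata w) tt f)); [exact: face_cts|exact: to_square_cts].
- case=> [[x|f]|] v v'; rewrite !inE /open_disc /= => hv hv'.
  + move: hv hv'; rewrite !sqnorm1 => hv hv' /(congr1 sval); rewrite !edge_in.
    * by move=> [e]; apply/rowP => i; rewrite !ord1; lra.
    * by apply/andP; split; nra.
    * by apply/andP; split; nra.
  + have [h1 h2] := to_square_in hv; have [h3 h4] := to_square_in hv'.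
    move=> /(congr1 sval); rewrite (surjective_pairing (to_square v)) (surjective_pairing (to_square v')).
    rewrite !face_in // => -[e1 e2]; apply: (to_square_inj hv hv').
    exact: (f_equal2 pair e1 e2).
  + by move=> _; apply/rowP => -[].
- rewrite -/cell; split.
    apply/trivIsetP => i j _ _ ij; apply: contrapT => /eqP/set0P[z [zi zj]].
    move: zi zj; rewrite -/(cell i) -/(cell j); case: i ij => [[x|f]|] ij; case: j ij => [[x'|f']|] ij;
    rewrite ?cellV ?cellE ?cellF //=.
    * move=> [t ht ->] [t' ht' /(congr1 sval)]; rewrite !edge_in // => -[xx _].
      by rewrite xx eqxx in ij.
    * by move=> [t ht ->] [s' [t' [hs' ht' /(congr1 sval)]]]; rewrite edge_in // face_in.
    * by move=> [t ht ->] /(congr1 sval); rewrite edge_in.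
    * by move=> [s' [t' [hs' ht' ->]]] [t ht /(congr1 sval)]; rewrite edge_in // face_in.
    * move=> [s [t [hs ht ->]]] [s' [t' [hs' ht' /(congr1 sval)]]]; rewrite !face_in // => -[ff _ _].
      by rewrite ff eqxx in ij.
    * by move=> [s' [t' [hs' ht' ->]]] /(congr1 sval); rewrite face_in.
    * by move=> -> [t ht /(congr1 sval)]; rewrite edge_in.
    * by move=> -> [s [t [hs ht /(congr1 sval)]]]; rewrite face_in.
  apply/seteqP; split=> // z _; elim/cpx_case: z => [[]|[] x t ht|[] f s t hs ht].
  + by exists None => //; rewrite -/(cell None) cellV.
  + by exists (Some (inl x)) => //; rewrite -/(cell (Some (inl x))) cellE; exists t.
  + by exists (Some (inr f)) => //; rewrite -/(cell (Some (inr f))) cellF; exists s, t.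
- move=> i _ [v hv <-]; move: i v hv => [[x|f]|] v; rewrite /sphere /=.
  + rewrite sqnorm1 => hv; exists None => //; rewrite -/(cell None) cellV /=.
    have : (v ord0 ord0 - 1) * (v ord0 ord0 + 1) == 0 by apply/eqP; rewrite expr2 in hv; lra.
    rewrite mulf_eq0 => /orP[/eqP h|/eqP h]; first by rewrite edge1 //; lra.
    by rewrite edge0 //; lra.
  + move=> /to_square_sphere; case: (to_square v) => s t /= h.
    have [t1|t1] := lerP 1 t.
      have [i di ci] := wpath_skel tt (w f) s; exists i => //.
      by rewrite face_top.
    exists None => //; rewrite -/(cell None) cellV face_side //.
    by case: h => [|[|[|]]] h; [left|right; left|right; right|exfalso; lra].
  + by rewrite /sqnorm big_ord0 => /esym/eqP; rewrite oner_eq0.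
Qed.

End CW.

Lemma multiplicative1 (A B : groupType) (k : {multiplicative A -> B}) : k 1%g = 1%g.
Proof. by apply: (@mulgI _ (k 1%g)); rewrite -gmulfM !mulg1. Qed.

Lemma multiplicativeV (A B : groupType) (k : {multiplicative A -> B}) x : k (x^-1)%g = ((k x)^-1)%g.
Proof. by apply: (@mulgI _ (k x)); rewrite -gmulfM !mulgV multiplicative1. Qed.

(** * Contracting the universal cover *)

Section Homotopies.
Variables (R : realType) (X : choiceType) (F : Type) (w : F -> seq (X * bool)) (D : cdata w).
Local Notation Y := (cpx R D).
Local Notation vt := (vert R (D := D)).
Local Notation edg := (edge (R := R) (D := D)).
Local Notation fc := (face (R := R) (D := D)).
Local Notation wp := (wpath (R := R) (D := D)).
Variables (v : cM D -> R -> Y) (e : cM D -> X -> R * R -> Y) (k : cM D -> F -> R * R * R -> Y).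
Hypotheses (v_cts : forall m, continuous (v m)) (e_cts : forall m x, continuous (e m x))
  (k_cts : forall m f, continuous (k m f)).
Hypotheses (e_0 : forall m x s t, s <= 0 -> e m x (s, t) = v m t)
  (e_1 : forall m x s t, 1 <= s -> e m x (s, t) = v (cmv m (x, true)) t)
  (k_side : forall m f s t u, s <= 0 \/ 1 <= s \/ t <= 0 -> t < 1 -> k m f (s, t, u) = v m u).

Definition cell_map : Y -> R -> Y := cpx_elim (fun m => v m) (fun m x s t => e m x (s, t))
  (fun m f z t => k m f (z, t)).

Hypothesis k_top : forall m f s t u, 1 <= t -> k m f (s, t, u) = cell_map (wp m (w f) s) u.

Lemma cell_map_edge m x s : cell_map (edg m x s) = fun t => e m x (s, t).
Proof. by apply: elim_edge => h; apply/funext => t; [exact: e_0|exact: e_1]. Qed.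

Lemma cell_map_face m f z : cell_map (fc m f z) = fun t => k m f (z, t).
Proof.
case: z => s t; apply: elim_face => h; first by apply/funext => u; exact: k_top.
by move=> h'; apply/funext => u; exact: k_side.
Qed.

Import ArrowAsCompactOpen.

(** Continuity on the complex can be tested on cells, but the product with R does not come with such
    a test. Currying turns the homotopy into a map from the complex to a space of functions with the
    compact-open topology, where the test applies; local compactness of R permits the return. *)
Lemma cell_map_cts : continuous (fun z : Y * R => cell_map z.1 z.2).
Proof.
have h : continuous (uncurry cell_map).
  apply: continuous_uncurry.
  - exact: locally_compactR.
  - exact: Rhausdorff.
  - apply: cpx_cts => m.
      move=> x; rewrite (_ : (fun s => _) = curry (e m x)); last first.
        by apply/funext => s; exact: cell_map_edge.
      by apply: continuous_curry_fun; exact: e_cts.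
    move=> f; rewrite (_ : (fun z => _) = curry (k m f)); last first.
      by apply/funext => s; exact: cell_map_face.
    by apply: continuous_curry_fun; exact: k_cts.
  - elim/cpx_case => [m|m x s hs|m f s t hs ht].
    + exact: v_cts.
    + by rewrite cell_map_edge; have ce := @e_cts m x; cts.
    + by rewrite cell_map_face; have ce := @k_cts m f; cts.
by rewrite (_ : (fun z => _) = uncurry cell_map) //; apply/funext => -[].
Qed.

End Homotopies.

Section CayleyContraction.
Variables (R : realType) (X : choiceType) (F : Type) (rr : F -> freegroup X).
Variables (G : groupType) (rho : X -> G).
Hypothesis ker : forall x, free_lift rho x = 1%g <-> normal_closure (range rr) x.

Let w (f : F) : seq (X * bool) := word (rr f).

Lemma rel_trivial f : eval_word rho (w f) = 1%g.
Proof. by apply/ker => N [_ RN]; apply: RN; exists f. Qed.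

Local Notation D := (gdata rel_trivial).
Local Notation Y := (cpx R D).
Local Notation vt g := (vert R (D := D) g).
Local Notation edg := (edge (R := R) (D := D)).
Local Notation fc := (face (R := R) (D := D)).
Local Notation wp := (wpath (R := R) (D := D)).
Local Notation act m u := (m * eval_word rho u)%g.
Local Notation "m @* a" := (m * eval_letter rho a)%g (at level 40).

Definition pth (m : G) (u : seq (X * bool)) : R * R -> Y := fun z => wp m u z.1.

Lemma pth_fam m u : fam set0 (pth m u).
Proof.
split=> [|s z|//]; first by have cw := @wpath_cts R X F w D m u; rewrite /pth; cts.
rewrite /pth /=; case: (clP s) => // h; first by rewrite !wpath0.
by rewrite !wpath1.
Qed.

Lemma pth0 m u z : pth m u (0, z) = vt m.
Proof. by rewrite /pth /= wpath0. Qed.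

Lemma pth1 m u z : pth m u (1, z) = vt (act m u).
Proof. by rewrite /pth /= wpath1 // -(foldl_eval rho m u). Qed.

Lemma pth_refl m u : fhom set0 (pth m u) (pth m u).
Proof. by apply: fhom_refl; have [] := pth_fam m u. Qed.

Definition lpth (m : G) (a : X * bool) : R * R -> Y := fun z => ledge (D := D) m a z.1.

Lemma lpth_fam m a : fam set0 (lpth m a).
Proof.
split=> [|s z|//]; first by have cw := @ledge_cts R X F w D m a; rewrite /lpth; cts.
rewrite /lpth /=; case: (clP s) => // h; first by rewrite !ledge0.
by rewrite !ledge1.
Qed.

Lemma pth_cons m a u : pth m (a :: u) = pcat (lpth m a) (pth (m @* a) u).
Proof. by []. Qed.

Lemma act_cons m a u : act m (a :: u) = act (m @* a) u.
Proof. by rewrite /eval_word big_cons mulgA. Qed.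

Lemma act_nil m : act m [::] = m.
Proof. by rewrite /eval_word big_nil mulg1. Qed.

Lemma lpth_inv m a : lpth (m @* a) (inv_letter a) = prev (lpth m a).
Proof.
apply/funext => -[s z]; rewrite /lpth /prev /ledge /=.
case: a => x b /=; case: b => /=.
  by congr (edge _ _ _); rewrite -[RHS](gdata_mvK rho m (x, true)).
by rewrite (_ : 1 - (1 - s) = s) //; lra.
Qed.

Lemma lpth0 m a z : lpth m a (0, z) = vt m.
Proof. by rewrite /lpth /= ledge0. Qed.

Lemma lpth1 m a z : lpth m a (1, z) = vt (m @* a).
Proof. by rewrite /lpth /= ledge1. Qed.

Lemma pth_cons_red m a u :
  fhom set0 (pth m (cons_red a u)) (pth m (a :: u)).
Proof.
case: u => [|b u] /=; first exact: pth_refl.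
case: eqP => [->|_]; last exact: pth_refl.
rewrite !pth_cons lpth_inv.
have m'b : (m * eval_letter rho a * eval_letter rho (inv_letter a))%g = m by exact: gdata_mvK.
rewrite m'b; apply: fhom_sym.
have e1 z : lpth m a (1, z) = prev (lpth m a) (0, z) by rewrite /prev /= subr0.
have e2 z : prev (lpth m a) (1, z) = pth m u (0, z) by rewrite /prev /= subrr lpth0 pth0.
have fa := lpth_fam m a; have fr := fam_rev fa; have fu := pth_fam m u.
apply: fhom_trans (fhom_sym (fhom_catA fa fr fu e1 e2)) _.
have e3 z : pcat (lpth m a) (prev (lpth m a)) (1, z) = pth m u (0, z) by rewrite pcat_1.
apply: fhom_trans (fhom_cat (fhom_catV fa) (pth_refl m u) e3) _.
rewrite (_ : (fun x => lpth m a (0, x.2)) = fun x => pth m u (0, x.2)).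
  exact: fhom_cat1.
by apply/funext => x; rewrite lpth0 pth0.
Qed.

Lemma pth_mul_words m u v :
  fhom set0 (pth m (mul_words u v)) (pcat (pth m u) (pth (act m u) v)).
Proof.
elim: u m => [|a u IH] m /=.
  rewrite act_nil; apply: fhom_sym.
  rewrite (_ : pth m [::] = fun x => pth m v (0, x.2)); first exact: fhom_cat1 (pth_fam _ _).
  by apply/funext => x; rewrite pth0.
apply: fhom_trans (pth_cons_red _ _ _) _; rewrite !pth_cons act_cons.
set m' := (m * _)%g.
have e1 z : lpth m a (1, z) = pth m' (mul_words u v) (0, z) by rewrite lpth1 pth0.
have ra : fhom set0 (lpth m a) (lpth m a) by apply: fhom_refl; have [] := lpth_fam m a.
apply: fhom_trans (fhom_cat ra (IH m') e1) _.
apply: fhom_sym; apply: fhom_catA; try exact: pth_fam.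
- exact: lpth_fam.
- by move=> z; rewrite lpth1 pth0.
- by move=> z; rewrite pth1 pth0.
Qed.

Definition fpth (m : G) (x : freegroup X) := pth m (word x).

Lemma fpth_mul m x y :
  fhom set0 (fpth m (x * y)%g) (pcat (fpth m x) (fpth (m * free_lift rho x)%g y)).
Proof. exact: pth_mul_words. Qed.

Lemma vert_inj m m' : vt m = vt m' -> m = m'.
Proof. by move=> /(congr1 sval) []. Qed.

(* The elements that act trivially on paths up to homotopy; they contain the relators. *)
Definition nullw (x : freegroup X) : Prop :=
  forall m, fhom set0 (fpth m x) (fun=> vt m).

Lemma nullw_act x m : nullw x -> (m * free_lift rho x)%g = m.
Proof.
move=> /(_ m) /fhom_eq_bd h; apply: vert_inj.
by rewrite -(h 1 0) ?[LHS](esym (pth1 _ _ 0)) //; right; left.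
Qed.

Lemma nullw_1 : nullw 1%g.
Proof. by move=> m; apply: fhom_refl; exact: cts_cst. Qed.

Lemma cat_cst (m : G) (p : R * R -> Y) : fam set0 p -> (forall z, p (0, z) = vt m) ->
  fhom set0 (pcat (fun=> vt m) p) p.
Proof.
move=> fp p0; rewrite (_ : (fun=> _) = fun x => p (0, x.2)); first exact: fhom_cat1.
by apply/funext => x; rewrite p0.
Qed.

Lemma nullw_mulL x y m : nullw x -> fhom set0 (fpth m (x * y)%g) (fpth m y).
Proof.
move=> nx; apply: fhom_trans (fpth_mul _ _ _) _; rewrite nullw_act //.
apply: fhom_trans (fhom_cat (nx m) (pth_refl _ _) _) _.
  by move=> z; rewrite /fpth pth0 pth1; congr vert; exact: nullw_act.
by apply: cat_cst; [exact: pth_fam|move=> z; rewrite pth0].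
Qed.

Lemma nullw_mul x y : nullw x -> nullw y -> nullw (x * y)%g.
Proof. by move=> nx ny m; apply: fhom_trans (nullw_mulL _ _ nx) (ny m). Qed.

Lemma nullw_hom x y : (forall m, fhom set0 (fpth m x) (fpth m y)) -> nullw x -> nullw y.
Proof. by move=> h nx m; apply: fhom_trans (fhom_sym (h m)) (nx m). Qed.

Lemma nullw_inv x : nullw x -> nullw x^-1%g.
Proof.
move=> nx; apply: (nullw_hom (x := (x * x^-1)%g)) => [m|]; first exact: nullw_mulL.
by rewrite mulgV; exact: nullw_1.
Qed.

Lemma nullw_conj x y : nullw x -> nullw (x ^ y)%g.
Proof.
move=> nx; rewrite conjgE; apply: (nullw_hom (x := (y^-1 * y)%g)); last first.
  by rewrite mulVg; exact: nullw_1.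
move=> m; apply: fhom_trans (fpth_mul _ _ _) _; apply: fhom_sym.
apply: fhom_trans (fpth_mul _ _ _) _; apply: fhom_cat; [exact: pth_refl|exact: nullw_mulL|].
by move=> z; rewrite /fpth pth0 pth1.
Qed.

Lemma nullw_rel f : nullw (rr f).
Proof.
move=> m.
exists (fun x => fc m f (x.1.1, 1 - cl x.2)); split=> /=.
- have cf := @face_cts R X F w D m f; cts.
- by move=> s z; rewrite cl_0 // subr0 face_top.
- by move=> s z; rewrite cl_1 // subrr face_side //; right; right.
- move=> s z u h; rewrite face_side; first by rewrite /fpth /pth /=; case: h => [h|[h|[]]];
    [rewrite wpath0|rewrite wpath1 // cloop].
  by case: h => [h|[h|[]]]; [left|right; left].
Qed.

Lemma nullw_ker x : free_lift rho x = 1%g -> nullw x.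
Proof.
move=> /ker; apply; split; last by move=> _ [f _ <-]; exact: nullw_rel.
split; last by move=> a b; exact: nullw_conj.
split; first exact: nullw_1.
by move=> a b na nb; apply: nullw_mul => //; exact: nullw_inv.
Qed.

Variable sec : G -> freegroup X.
Hypotheses (secK : forall g, free_lift rho (sec g) = g) (sec1 : sec 1%g = 1%g).

(** These paths play the part of a maximal tree without forming one: [sec] is any section. Its value
    1 at 1 keeps the base vertex fixed during the contraction. *)
Definition lam (g : G) : R -> Y := wp 1%g (word (sec g)).

Lemma lam_cts g : continuous (lam g).
Proof. exact: wpath_cts. Qed.

Lemma lam0 g t : t <= 0 -> lam g t = vt 1%g.
Proof. exact: wpath0. Qed.

Lemma lam1 g t : 1 <= t -> lam g t = vt g.
Proof. by move=> t1; rewrite /lam wpath1 // foldl_eval [eval_word _ _]secK mul1g. Qed.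

Lemma lam_one t : lam 1%g t = vt 1%g.
Proof. by rewrite /lam sec1. Qed.

Lemma tree_edge_null g x :
  fhom set0 (pcat (fun z => lam g z.1) (fun z => edg g x z.1)) (fun z => lam (g * rho x)%g z.1).
Proof.
set g' := (g * rho x)%g.
pose n := (sec g * free_gen x * (sec g')^-1)%g.
have nn : nullw n.
  apply: nullw_ker; rewrite /n !gmulfM multiplicativeV /= free_lift_gen !secK; exact: mulgV.
have e1 : fhom set0 (fpth 1%g (sec g * free_gen x)%g) (fpth 1%g (sec g')).
  rewrite (_ : (sec g * free_gen x)%g = (n * sec g')%g); first exact: nullw_mulL.
  by rewrite /n mulgVK.
apply: fhom_trans e1; apply: fhom_sym; apply: fhom_trans (fpth_mul _ _ _) _.
rewrite secK mul1g; apply: fhom_cat; [exact: pth_refl| |by move=> z; rewrite /fpth pth1 pth0 [eval_word _ _]secK mul1g].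
have fe : fam set0 (fun z : R * R => edg g x z.1) := lpth_fam g (x, true).
have h := fhom_1cat fe; apply: fhom_trans h.
rewrite (_ : fpth g (free_gen x) = pcat (fun z => edg g x z.1)
  (fun=> edg g x 1)); first by apply: fhom_refl; have [] := fam_cat fe (fam_cst 1 fe) (fun=> erefl).
apply/funext => z; rewrite /fpth /pth /pcat /= /ifle; case: ifP => // _.
by rewrite edge1.
Qed.

(* A null homotopy of the edge from [g] to [g x] that moves its ends along the tree paths [lam]. *)
Lemma edge_square g x : exists h : R * R -> Y, [/\ continuous h,
  forall s t, t <= 0 -> h (s, t) = vt 1%g,
  forall s t, 1 <= t -> h (s, t) = edg g x s,
  forall s t, s <= 0 -> h (s, t) = lam g (2 * t) &
  forall s t, 1 <= s -> h (s, t) = lam (g * rho x)%g (2 * t)].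
Proof.
have [K [cK K0 K1 Kb]] := tree_edge_null g x.
pose p := pcat (fun z : R * R => lam g z.1) (fun z => edg g x z.1).
have cl_ := @lam_cts g; have ce := @edge_cts R X F w D g x.
have pt (t : R) : p (t, 0) = ifle t 2^-1 (lam g (2 * t)) (edg g x (2 * t - 1)) by [].
have cp : continuous p.
  by rewrite /p /pcat; cts => z /= ->; rewrite lam1 ?edge0 //; lra.
(* For [s <= 1/2] the path [p] is stopped at a time that grows from 1/2, the end of [lam g], to 1;
   for larger [s] the homotopy [K] deforms the whole of [p] into [lam (g * rho x)]. *)
pose h0 (z : R * R) := ifle z.1 2^-1 (p (cl z.2 * (1 + 2 * cl z.1) / 2, 0)) (K (cl z.2, 0, cl (2 * z.1 - 1))).
have ch0 : continuous h0.
  rewrite /h0; cts => z /= ->; rewrite (_ : cl (2 * 2^-1 - 1) = 0); last by rewrite cl_0 //; lra.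
  rewrite K0 -/p (@cl_id _ 2^-1); last by lra.
  by congr (p (_, _)); lra.
have h0_0 s t : t <= 0 -> h0 (s, t) = vt 1%g.
  move=> t0; rewrite /h0 /ifle /= cl_0 //; case: ifP => _.
    by rewrite !mul0r pt /ifle ifT ?lam0 //; lra.
  rewrite Kb; last by left.
  rewrite /pcat /ifle /= ifT; last by lra.
  by rewrite lam0 //; lra.
have h0_1 s t : 1 <= t -> h0 (s, t) = edg g x (2 * s).
  move=> t1; rewrite /h0 /ifle /= cl_1 //; case: ifPn => hs.
    rewrite mul1r pt /ifle; have c0 := cl_ge0 s; case: ifPn => hc.
      rewrite lam1; last by lra.
      by rewrite edge0 //; case: (clP s) c0 hc => *; lra.
    by rewrite -[RHS]edge_cl -[LHS]edge_cl; congr edge; case: (clP s) hc => *;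
      case: (clP (2 * s)) => *; rewrite ?cl_id; lra.
  rewrite Kb; last by right; left.
  rewrite /pcat /= /ifle if_ltF; last by lra.
  by rewrite !edge1 //; lra.
have h0_l s t : s <= 0 -> h0 (s, t) = lam g t.
  move=> s0; rewrite /h0 /ifle /= ifT; last by lra.
  rewrite (cl_0 s0) pt /ifle ifT; last by have := cl_le1 t; lra.
  case: (clP t) => [ht|ht ht'|ht].
  - by rewrite !lam0 //; lra.
  - by congr (lam g _); lra.
  - by rewrite !lam1 //; lra.
have h0_r s t : 1 <= s -> h0 (s, t) = lam (g * rho x)%g t.
  move=> s1; rewrite /h0 /ifle /= if_ltF; last by lra.
  rewrite (@cl_1 _ (2 * s - 1)); last by lra.
  by rewrite K1 /=; case: (clP t) => [ht|//|ht]; [rewrite !lam0|rewrite !lam1].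
(* At time 1 [h0] runs through the edge at double speed. The upper half of the square restores the
   speed, which is why the sides are [lam] at [2 * t]. *)
exists (fun z => ifle z.2 2^-1 (h0 (z.1, 2 * z.2))
  (edg g x ((2 - 2 * cl z.2) * (2 * z.1) + (2 * cl z.2 - 1) * z.1))); split=> /=.
- cts => z ->; rewrite h0_1; last by lra.
  by congr edge; rewrite cl_id; lra.
- by move=> s t t0; rewrite /ifle ifT ?h0_0 //; lra.
- move=> s t t1; rewrite /ifle if_ltF; last by lra.
  by rewrite cl_1 //; congr edge; lra.
- move=> s t s0; rewrite /ifle; case: ifPn => ht; first exact: h0_l.
  rewrite edge0; last by have := cl_ge0 t; have := cl_le1 t; case: (clP t) ht => *; nra.
  by rewrite lam1 //; lra.
- move=> s t s1; rewrite /ifle; case: ifPn => ht; first exact: h0_r.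
  rewrite edge1; last by have := cl_ge0 t; have := cl_le1 t; case: (clP t) ht => *; nra.
  by rewrite lam1 //; lra.
Qed.


(** The path arrives at time 1/2 and waits; during the wait [S] below inserts the face. *)
Definition mu (g : G) (t : R) : Y := lam g (2 * t).

Lemma mu_cts g : continuous (mu g).
Proof. have cl_ := @lam_cts g; rewrite /mu; cts. Qed.

Lemma mu_0 g t : t <= 0 -> mu g t = vt 1%g.
Proof. by move=> h; rewrite /mu lam0 //; lra. Qed.

Lemma mu_1 g t : 2^-1 <= t -> mu g t = vt g.
Proof. by move=> h; rewrite /mu lam1 //; lra. Qed.

Lemma mu_one t : mu 1%g t = vt 1%g.
Proof. by rewrite /mu lam_one. Qed.

Definition edge_fill (g : G) (x : X) : R * R -> Y := sval (cid (edge_square g x)).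

Lemma edge_fillP g x : [/\ continuous (edge_fill g x),
  forall s t, t <= 0 -> edge_fill g x (s, t) = vt 1%g,
  forall s t, 1 <= t -> edge_fill g x (s, t) = edg g x s,
  forall s t, s <= 0 -> edge_fill g x (s, t) = mu g t &
  forall s t, 1 <= s -> edge_fill g x (s, t) = mu (g * rho x)%g t].
Proof. exact: (svalP (cid (edge_square g x))). Qed.

Definition letter_fill (m : G) (a : X * bool) : R * R -> Y :=
  if a.2 then edge_fill m a.1 else fun z => edge_fill (m @* a) a.1 (1 - z.1, z.2).

Lemma letter_fillP m a : [/\ continuous (letter_fill m a),
  forall s t, t <= 0 -> letter_fill m a (s, t) = vt 1%g,
  forall s t, 1 <= t -> letter_fill m a (s, t) = ledge (D := D) m a s,
  forall s t, s <= 0 -> letter_fill m a (s, t) = mu m t &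
  forall s t, 1 <= s -> letter_fill m a (s, t) = mu (m @* a) t].
Proof.
rewrite /letter_fill /ledge; case: a => x [] /=; first exact: edge_fillP.
have [c h0 h1 hl hr] := edge_fillP (m @* (x, false)) x.
have mx : (m @* (x, false) * rho x)%g = m by rewrite /eval_letter /= mulgVK.
split=> /=.
- by cts.
- by move=> s t t0; rewrite h0.
- by move=> s t t0; rewrite h1.
- by move=> s t t0; rewrite hr ?mx //; lra.
- by move=> s t t0; rewrite hl //; lra.
Qed.

Fixpoint word_fill (m : G) (u : seq (X * bool)) : R * R -> Y :=
  if u is a :: u' then
    fun z => ifle z.1 2^-1 (letter_fill m a (2 * z.1, z.2)) (word_fill (m @* a) u' (2 * z.1 - 1, z.2))
  else fun z => mu m z.2.

Lemma word_fillP m u : [/\ continuous (word_fill m u),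
  forall s t, t <= 0 -> word_fill m u (s, t) = vt 1%g,
  forall s t, 1 <= t -> word_fill m u (s, t) = wp m u s,
  forall s t, s <= 0 -> word_fill m u (s, t) = mu m t &
  forall s t, 1 <= s -> word_fill m u (s, t) = mu (foldl (@cmv _ _ _ D) m u) t].
Proof.
elim: u m => [|a u IH] m /=.
  have cm := @mu_cts m; split=> //=.
  - by cts.
  - by move=> s t t0; rewrite mu_0.
  - by move=> s t t1; rewrite mu_1 //; lra.
have [c h0 h1 hl hr] := letter_fillP m a.
have [c' h0' h1' hl' hr'] := IH (m @* a).
split=> /=.
- by cts => z /= ->; rewrite hr ?hl' //; lra.
- by move=> s t t0; rewrite h0 // h0' // /ifle; case: ifP.
- by move=> s t t1; rewrite h1 // h1' // /ifle; case: ifP.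
- by move=> s t s0; rewrite /ifle ifT ?hl //; lra.
- move=> s t s1; rewrite /ifle if_ltF; last by lra.
  by rewrite hr' //; lra.
Qed.

(** * Extending the contraction over the faces *)

Section Layers.
(* The corrections in pi_2 of the null homotopies of the edges. *)
Variable layer : G -> X -> R * R -> Y.
Hypothesis layer_sph : forall g x, sph (vt 1%g) (layer g x).

Definition letter_layer (m : G) (a : X * bool) : R * R -> Y :=
  if a.2 then layer m a.1 else prev (layer (m @* a) a.1).

Fixpoint word_layer (m : G) (u : seq (X * bool)) : R * R -> Y :=
  if u is a :: u' then pcat (letter_layer m a) (word_layer (m @* a) u') else fun=> vt 1%g.

Lemma letter_layer_sph m a : sph (vt 1%g) (letter_layer m a).
Proof. by rewrite /letter_layer; case: (a.2) => //; exact: sph_rev. Qed.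

Lemma word_layer_sph m u : sph (vt 1%g) (word_layer m u).
Proof.
elim: u m => [|a u IH] m /=; first exact: sph_cst.
by apply: sph_cat => //; exact: letter_layer_sph.
Qed.

(* The edge square [h] placed on top of the layer [l]. *)
Definition stack (l h : R * R -> Y) (z : R * R) : Y :=
  ifle (3 * cl z.2) 2 (l (z.1, 3 * cl z.2 / 2)) (h (z.1, 3 * cl z.2 - 2)).

(** The side of a stacked square: at the base vertex as long as the layer lasts, then [mu g]. *)
Definition nu (g : G) (t : R) : Y := mu g (3 * cl t - 2).

Lemma nu_cts g : continuous (nu g).
Proof. have cm := @mu_cts g; rewrite /nu; cts. Qed.

Lemma stack_cts l h : sph (vt 1%g) l -> continuous h ->
  (forall s, h (s, 0) = vt 1%g) -> continuous (stack l h).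
Proof.
move=> [cl_ lb] ch h0; rewrite /stack; cts => z /= e; rewrite e lb.
  by rewrite (_ : 2 - 2 = 0 :> R) ?h0 //; lra.
by right; right; right; lra.
Qed.

Lemma stack_side l h g s t : sph (vt 1%g) l -> s <= 0 \/ 1 <= s ->
  (forall t, h (s, t) = mu g t) -> stack l h (s, t) = nu g t.
Proof.
move=> [_ lb] hs hm; rewrite /stack /nu /ifle /= hm; case: ifPn => // ht.
rewrite lb; last by case: hs; [left|right; left].
by rewrite mu_0 //; lra.
Qed.

Lemma stack_0 l h s t : sph (vt 1%g) l -> t <= 0 -> stack l h (s, t) = vt 1%g.
Proof.
move=> [_ lb] t0; rewrite /stack /ifle /= cl_0 // ifT; last by lra.
by rewrite lb //; right; right; left; lra.
Qed.

Lemma stack_1 l h s t : 1 <= t -> stack l h (s, t) = h (s, 1).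
Proof.
move=> t1; rewrite /stack /ifle /= cl_1 // if_ltF; last by lra.
by congr (h (s, _)); lra.
Qed.

Definition edge_contr (g : G) (x : X) : R * R -> Y := stack (layer g x) (edge_fill g x).

Definition word_contr (m : G) (u : seq (X * bool)) := stack (word_layer m u) (word_fill m u).

Lemma edge_contr_cts g x : continuous (edge_contr g x).
Proof.
by have [c h0 _ _ _] := edge_fillP g x; apply: stack_cts => // s; rewrite h0.
Qed.

Lemma word_contr_cons m a u s t : word_contr m (a :: u) (s, t) =
  ifle s 2^-1 (if a.2 then edge_contr m a.1 (2 * s, t) else edge_contr (m @* a) a.1 (1 - 2 * s, t))
    (word_contr (m @* a) u (2 * s - 1, t)).
Proof.
case: a => x []; rewrite /word_contr /edge_contr /stack /ifle /= /pcat /letter_layer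
  /letter_fill /prev /ifle /=; by case: ifP => _; case: ifP.
Qed.

Section Face.
Variables (g : G) (f : F).

Let B := word_fill g (w f).
Let S (z : R * R) : Y := ifle z.2 2^-1 (mu g z.2) (fc g f (z.1, 2 * z.2 - 1)).
(** [sb] runs around the loop in the middle third. [sg] is 1 there and falls to 0 at both ends, so
    that over the outer thirds the common side [mu g] is drawn back to the base vertex, as a
    spheroid requires. *)
Let sg (s : R) : R := cl (Num.min (3 * s) (3 - 3 * s)).
Let sb (s : R) : R := cl (3 * s - 1).

(* The difference of the two fillings [S] and [B] of the loop [wpath g (w f)],
   cut along the path [mu g]. *)
Definition face_diff (z : R * R) : Y :=
  ifle z.2 2^-1 (S (sb z.1, 2 * sg z.1 * z.2)) (B (sb z.1, sg z.1 * (2 - 2 * z.2))).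

Let B_cts : continuous B. Proof. by have [] := word_fillP g (w f). Qed.
Let B_0 s t : t <= 0 -> B (s, t) = vt 1%g.
Proof. by have [_ + _ _ _] := word_fillP g (w f); apply. Qed.
Let B_1 s t : 1 <= t -> B (s, t) = wp g (w f) s.
Proof. by have [_ _ + _ _] := word_fillP g (w f); apply. Qed.
Let B_s s t : s <= 0 \/ 1 <= s -> B (s, t) = mu g t.
Proof.
have [_ _ _ hl hr] := word_fillP g (w f); move=> [h|h]; first by rewrite /B hl.
by rewrite /B hr // cloop.
Qed.

Let S_cts : continuous S.
Proof.
have cm := @mu_cts g; have cf := @face_cts R X F w D g f.
by rewrite /S; cts => z /= ->; rewrite mu_1 ?face_side //; right; right; lra.
Qed.

Let S_0 s t : t <= 0 -> S (s, t) = vt 1%g.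
Proof. by move=> h; rewrite /S /ifle /= ifT ?mu_0 //; lra. Qed.

Let S_1 s t : 1 <= t -> S (s, t) = wp g (w f) s.
Proof.
move=> h; rewrite /S /ifle /= if_ltF; last by lra.
by rewrite face_top //; lra.
Qed.

Let S_s s t : s <= 0 \/ 1 <= s -> S (s, t) = mu g t.
Proof.
move=> h; rewrite /S /ifle /=; case: ifPn => // ht.
rewrite mu_1 ?face_side //; last by lra.
by case: h; [left|right; left].
Qed.

Let sb_cts : continuous sb. Proof. by rewrite /sb; cts. Qed.
Let sg_cts : continuous sg. Proof. by rewrite /sg; cts. Qed.

Let sg_0 s : s <= 0 \/ 1 <= s -> sg s = 0.
Proof. by move=> h; rewrite /sg cl_0 // ge_min; apply/orP; case: h => h; [left|right]; lra. Qed.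

Let sb_l s : s <= 0 -> sb s = 0. Proof. by move=> h; rewrite /sb cl_0 //; lra. Qed.
Let sb_r s : 1 <= s -> sb s = 1. Proof. by move=> h; rewrite /sb cl_1 //; lra. Qed.
Let sb_s s : s <= 0 \/ 1 <= s -> sb s <= 0 \/ 1 <= sb s.
Proof. by move=> [h|h]; [rewrite sb_l //; left|rewrite sb_r //; right]. Qed.
Let sg_ge0 s : 0 <= sg s. Proof. exact: cl_ge0. Qed.
Let sg_le1 s : sg s <= 1. Proof. exact: cl_le1. Qed.

(** Where [sg s < 1], the point [sb s] is an end of the loop and both fillings are [mu g]; where
    [sg s = 1], the height [x] is at the common top. *)
Let SB s x : sg s <= x -> B (sb s, x) = S (sb s, x).
Proof.
have [h|h] : sg s = 1 \/ (sb s <= 0 \/ 1 <= sb s).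
- rewrite /sg /sb; have [h1|h1] := lerP (3 * s) 1; first by right; left; rewrite cl_0 //; lra.
  have [h2|h2] := lerP 2 (3 * s); first by right; right; rewrite cl_1 //; lra.
  by left; rewrite cl_1 // le_min; apply/andP; split; lra.
- by rewrite h => x1; rewrite B_1 // S_1.
- by move=> _; rewrite B_s // S_s.
Qed.

Lemma face_diff_sph : sph (vt 1%g) face_diff.
Proof.
split.
  rewrite /face_diff; cts => z /= ->.
  rewrite (_ : sg z.1 * (2 - 2 * 2^-1) = sg z.1) ?SB //; last by lra.
  by congr S; congr (_, _); lra.
move=> s z h; rewrite /face_diff /ifle /=; case: ifPn => hz.
  case: h => [h|[h|[h|h]]]; [by rewrite sg_0 ?S_0 //; [lra|left]|by rewrite sg_0 ?S_0 //; [lra|right]| |exfalso; lra].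
  by rewrite S_0 //; have := sg_ge0 s; nra.
case: h => [h|[h|[h|h]]]; [by rewrite sg_0 ?B_0 //; [lra|left]|by rewrite sg_0 ?B_0 //; [lra|right]|exfalso; lra|].
by rewrite B_0 //; have := sg_ge0 s; nra.
Qed.

(* Squares over the face: the third parameter moves the top side across the
   face along [ph], the other sides are fixed. *)
Definition slide (V V' : R * R -> Y) (al be : R -> R * R) : Prop :=
  exists (K : R * R * R -> Y) (ph : R * R -> R * R), [/\ continuous K, continuous ph,
    forall s t, K (s, t, 0) = V (s, t) /\ K (s, t, 1) = V' (s, t),
    forall s, ph (s, 0) = al s /\ ph (s, 1) = be s &
    [/\ forall s t u, s <= 0 \/ 1 <= s -> K (s, t, u) = nu g t,
        forall s t u, t <= 0 -> K (s, t, u) = vt 1%g,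
        forall s t u, 1 <= t -> K (s, t, u) = fc g f (ph (s, u)) &
        forall s u, (s <= 0 -> (ph (s, u)).1 <= 0) /\ (1 <= s -> 1 <= (ph (s, u)).1)]].

Lemma slide_trans V V' V'' al be ga : slide V V' al be -> slide V' V'' be ga -> slide V V'' al ga.
Proof.
move=> [K [ph [cK cp Ke pe [Ks K0 K1 pb]]]] [L [ps [cL cq Le qe [Ls L0 L1 qb]]]].
have e1 : 2 * 2^-1 = 1 :> R by lra.
have e2 : 1 - 1 = 0 :> R by lra.
exists (fun x => ifle x.2 2^-1 (K (x.1.1, x.1.2, 2 * x.2)) (L (x.1.1, x.1.2, 2 * x.2 - 1))).
exists (fun x => ifle x.2 2^-1 (ph (x.1, 2 * x.2)) (ps (x.1, 2 * x.2 - 1))).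
split=> /=.
- cts => -[[s t] u] /= ->; rewrite e1 e2; have [_ ->] := Ke s t; by have [-> _] := Le s t.
- cts => -[s u] /= ->; rewrite e1 e2; have [_ ->] := pe s; by have [-> _] := qe s.
- move=> s t; rewrite /ifle ifT; last by lra.
  rewrite if_ltF; last by lra.
  rewrite mulr0 (_ : 2 * 1 - 1 = 1 :> R); last by lra.
  by have [-> _] := Ke s t; have [_ ->] := Le s t.
- move=> s; rewrite /ifle ifT; last by lra.
  rewrite if_ltF; last by lra.
  rewrite mulr0 (_ : 2 * 1 - 1 = 1 :> R); last by lra.
  by have [-> _] := pe s; have [_ ->] := qe s.
- split=> [s t u h|s t u h|s t u h|s u]; rewrite /ifle; case: ifP => _.
  + exact: Ks. + exact: Ls. + exact: K0. + exact: L0. + exact: K1. + exact: L1.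
  + exact: pb. + exact: qb.
Qed.

Let V1 := stack face_diff B.
Let V2 := stack face_diff (fun z => B (sb z.1, z.2)).
(** The height in [S] that remains after cancellation: it rises to [sg s] in the first third, rests,
    and follows the last third of the stack once that is higher. *)
Let th (s t : R) : R := Num.max (Num.min (sg s * (3 * cl t)) (sg s)) (3 * cl t - 2).
Let V3 (z : R * R) : Y := S (sb z.1, th z.1 z.2).

Let nuE t : nu g t = mu g (3 * cl t - 2). Proof. by []. Qed.

(** Only here is it used that the layers along the relator add up to [face_diff]. *)
Let slide1 : fhom (@bdZ R) (word_layer g (w f)) face_diff ->
  slide (word_contr g (w f)) V1 (fun s => (s, 1)) (fun s => (s, 1)).
Proof.
move=> [K [cK K0 K1 Kb]]; have [_ lb] := word_layer_sph g (w f).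
exists (fun x => ifle (3 * cl x.1.2) 2 (K (x.1.1, 3 * cl x.1.2 / 2, x.2)) (B (x.1.1, 3 * cl x.1.2 - 2))).
exists (fun x => (x.1, 1)); split=> /=.
- cts => -[[s t] u] /= ->; have b1 : @bdZ R (2 / 2) by right; lra.
  rewrite Kb; last by do 2 right.
  rewrite lb; last by do 2 right.
  by rewrite B_0 //; lra.
- by cts.
- by move=> s t; rewrite K0 K1.
- by [].
- split=> [s t u h|s t u h|s t u h|s u].
  + rewrite /ifle; case: ifPn => ht; last by rewrite B_s.
    have h' : s <= 0 \/ 1 <= s \/ bdZ (3 * cl t / 2) by case: h => h; [left|right; left].
    rewrite Kb // lb //.
    by rewrite nuE mu_0 //; lra.
  + rewrite cl_0 // /ifle ifT; last by lra.
    have b0 : @bdZ R (3 * 0 / 2) by left; lra.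
    rewrite Kb; last by do 2 right.
    by rewrite lb //; do 2 right.
  + rewrite cl_1 // /ifle if_ltF; last by lra.
    by rewrite B_1 ?face_top //; lra.
  + by split.
Qed.

Let slide2 : slide V1 V2 (fun s => (s, 1)) (fun s => (sb s, 1)).
Proof.
have [cd db] := face_diff_sph.
pose k (s u : R) := (1 - cl u) * s + cl u * sb s.
have kl s u : s <= 0 -> k s u <= 0.
  by move=> h; rewrite /k sb_l //; have := cl_ge0 u; have := cl_le1 u; nra.
have kr s u : 1 <= s -> 1 <= k s u.
  by move=> h; rewrite /k sb_r //; have := cl_ge0 u; have := cl_le1 u; nra.
have k0 s : k s 0 = s by rewrite /k cl00; lra.
have k1 s : k s 1 = sb s by rewrite /k cl11; lra.
exists (fun x => ifle (3 * cl x.1.2) 2 (face_diff (x.1.1, 3 * cl x.1.2 / 2)) (B (k x.1.1 x.2, 3 * cl x.1.2 - 2))).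
exists (fun x => (k x.1 x.2, 1)); split=> /=.
- rewrite /k; cts => -[[s t] u] /= ->; rewrite db; last by right; right; right; lra.
  by rewrite B_0 //; lra.
- by rewrite /k; cts.
- by move=> s t; rewrite k0 k1.
- by move=> s; rewrite k0 k1.
- split=> [s t u h|s t u h|s t u h|s u].
  + rewrite /ifle; case: ifPn => ht.
      rewrite db; last by case: h => h; [left|right; left].
      by rewrite nuE mu_0 //; lra.
    by rewrite B_s //; case: h => h; [left; exact: kl|right; exact: kr].
  + rewrite cl_0 // /ifle ifT; last by lra.
    by rewrite db //; right; right; left; lra.
  + rewrite cl_1 // /ifle if_ltF; last by lra.
    by rewrite B_1 ?face_top //; lra.
  + by split=> h; [exact: kl|exact: kr].
Qed.

(** In thirds from the bottom, [V2] climbs [S] to height [sg s], descends [B] and climbs [B] again.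
    Stopping the descent at height [cl u * sg s] removes it, and from [sg s] on the fillings agree
    by [SB], so only [S] is left. *)
Let slide3 : slide V2 V3 (fun s => (sb s, 1)) (fun s => (sb s, 1)).
Proof.
have m0 x y : 0 <= y -> Num.max (0 * x) y = y :> R by move=> h; rewrite mul0r max_r.
exists (fun x => ifle (3 * cl x.1.2) 1 (S (sb x.1.1, sg x.1.1 * (3 * cl x.1.2)))
  (ifle (3 * cl x.1.2) 2
    (B (sb x.1.1, Num.max (cl x.2 * sg x.1.1) (sg x.1.1 * (2 - 3 * cl x.1.2))))
    (B (sb x.1.1, Num.max (cl x.2 * sg x.1.1) (3 * cl x.1.2 - 2))))).
exists (fun x => (sb x.1, 1)); split=> /=.
- cts => -[[s t] u] /= ->.
    by rewrite (_ : 2 - 2 = 0 :> R) ?mulr0 //; lra.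
  rewrite /ifle ifT; last by lra.
  rewrite (_ : 2 - 1 = 1 :> R) ?mulr1; last by lra.
  rewrite max_r ?SB //; have := cl_ge0 u; have := cl_le1 u; have := sg_ge0 s; nra.
- by cts.
- move=> s t; split.
    rewrite /V2 /stack /face_diff cl00 /ifle /=; case: ifPn => h1.
      rewrite ifT; last by lra.
      rewrite ifT; last by lra.
      by congr (S (_, _)); lra.
    case: ifPn => h2; last by rewrite m0 //; lra.
    rewrite if_ltF; last by lra.
    rewrite m0; first by congr (B (_, _)); lra.
    by have := sg_ge0 s; nra.
  rewrite cl11 mul1r /V3 /th /ifle /=; have s0 := sg_ge0 s; have s1 := sg_le1 s; have c0 := cl_ge0 t.
  case: ifPn => h1.
    by rewrite min_l ?max_l //; nra.
  case: ifPn => h2; rewrite min_r; [|nra| |nra].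
    by rewrite max_l ?SB // ?max_l //; nra.
  by rewrite SB // le_max lexx.
- by [].
- have s01 (s t u : R) : s <= 0 \/ 1 <= s -> (sb s <= 0 \/ 1 <= sb s) /\ sg s = 0.
    by move=> h; split; [exact: sb_s|exact: sg_0].
  split=> [s t u h|s t u h|s t u h|s u].
  + have [h1 ->] := s01 s t u h; rewrite nuE !mul0r mulr0 /ifle; case: ifPn => h2.
      by rewrite S_0 // mu_0 //; lra.
    case: ifPn => h3; rewrite B_s //; last by rewrite max_r //; lra.
    by rewrite max_l // !mu_0 //; lra.
  + rewrite cl_0 // /ifle ifT; last by lra.
    by rewrite !mulr0 S_0.
  + rewrite cl_1 // /ifle if_ltF; last by lra.
    rewrite if_ltF; last by lra.
    by rewrite B_1 ?face_top // le_max; apply/orP; right; lra.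
  + by split=> h; [rewrite sb_l|rewrite sb_r].
Qed.

Let th_side s t : s <= 0 \/ 1 <= s -> mu g (th s t) = nu g t.
Proof.
move=> h; rewrite /th sg_0 // mul0r min_l // nuE.
by case: (lerP 0 (3 * cl t - 2)) => // h2; rewrite !mu_0 //; lra.
Qed.

Let th_0 s t : t <= 0 -> th s t = 0.
Proof. by move=> h; rewrite /th cl_0 // !mulr0 min_l ?max_l //; lra. Qed.

Let th_1 s t : 1 <= t -> th s t = 1.
Proof.
move=> h; rewrite /th cl_1 // min_r; last by have := sg_ge0 s; lra.
by rewrite max_r; have := sg_le1 s; lra.
Qed.

Let th_cts : continuous (fun z : R * R => th z.1 z.2).
Proof. by rewrite /th; cts. Qed.

(** The factor [1 - cl u] lowers the face onto its collapsed bottom; the top side sinks with it, as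
    [ph] records. *)
Let slide4 : slide V3 (fun z => mu g (th z.1 z.2)) (fun s => (sb s, 1)) (fun s => (sb s, 0)).
Proof.
have cm := @mu_cts g; have cf := @face_cts R X F w D g f.
have ct : continuous (fun x : R * R * R => th x.1.1 x.1.2).
  by apply: (cts_comp (u := fun x : R * R * R => x.1) th_cts); cts.
exists (fun x => ifle (th x.1.1 x.1.2) 2^-1 (mu g (th x.1.1 x.1.2))
   (fc g f (sb x.1.1, (1 - cl x.2) * (2 * th x.1.1 x.1.2 - 1)))).
exists (fun x => (sb x.1, 1 - cl x.2)); split=> /=.
- by cts => -[[s t] u] /= ->; rewrite mu_1 // face_side //; right; right; lra.
- by cts.
- move=> s t; rewrite cl00 cl11 subrr subr0 mul1r mul0r; split=> //.
  by rewrite /ifle; case: ifPn => // h; rewrite mu_1 ?face_side //; [right; right|lra].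
- by move=> s; rewrite cl00 cl11 subrr subr0.
- split=> [s t u h|s t u h|s t u h|s u].
  + rewrite /ifle; case: ifPn => h2; first by rewrite th_side.
    rewrite -(th_side t h) mu_1 ?face_side //; last by lra.
    by case: (sb_s h); [left|right; left].
  + by rewrite th_0 // /ifle ifT ?mu_0 //; lra.
  + rewrite th_1 // /ifle if_ltF; last by lra.
    by congr fc; congr (_, _); lra.
  + by split=> h; [rewrite sb_l|rewrite sb_r].
Qed.

Let slide5 : slide (fun z => mu g (th z.1 z.2)) (fun z => nu g z.2) (fun s => (sb s, 0)) (fun s => (sb s, 0)).
Proof.
have cm := @mu_cts g.
have ct : continuous (fun x : R * R * R => th x.1.1 x.1.2).
  by apply: (cts_comp (u := fun x : R * R * R => x.1) th_cts); cts.
exists (fun x => mu g ((1 - cl x.2) * th x.1.1 x.1.2 + cl x.2 * (3 * cl x.1.2 - 2))).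
exists (fun x => (sb x.1, 0)); split=> /=.
- by cts.
- by cts.
- by move=> s t; rewrite cl00 cl11 subrr subr0 !mul1r !mul0r addr0 add0r.
- by [].
- split=> [s t u h|s t u h|s t u h|s u]; have u0 := cl_ge0 u; have u1 := cl_le1 u.
  + rewrite nuE /th sg_0 // mul0r min_l //.
    case: (lerP 0 (3 * cl t - 2)) => h2; first by congr mu; lra.
    by rewrite !mu_0 //; nra.
  + by rewrite th_0 // (cl_0 h) mu_0 //; nra.
  + rewrite th_1 // (cl_1 h) mu_1; last by nra.
    by rewrite face_side //; right; right.
  + by split=> h; [rewrite sb_l|rewrite sb_r].
Qed.

Lemma face_slide : fhom (@bdZ R) (word_layer g (w f)) face_diff ->
  slide (word_contr g (w f)) (fun z => nu g z.2) (fun s => (s, 1)) (fun s => (sb s, 0)).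
Proof.
move=> h; apply: slide_trans (slide1 h) _; apply: slide_trans slide2 _.
by apply: slide_trans slide3 _; apply: slide_trans slide4 slide5.
Qed.

End Face.

Hypothesis layer_diff : forall g f, fhom (@bdZ R) (word_layer g (w f)) (face_diff g f).

Lemma contraction : exists H : Y * R -> Y, [/\ continuous H, forall y, H (y, 0) = y,
  forall y, H (y, 1) = vt 1%g & forall t, H (vt 1%g, t) = vt 1%g].
Proof.
have sl g f : exists Kp : (R * R * R -> Y) * (R * R -> R * R), [/\ continuous Kp.1, continuous Kp.2,
    forall s t, Kp.1 (s, t, 0) = word_contr g (w f) (s, t) /\ Kp.1 (s, t, 1) = nu g t,
    forall s, Kp.2 (s, 0) = (s, 1) /\ Kp.2 (s, 1) = (cl (3 * s - 1), 0) &
    [/\ forall s t u, s <= 0 \/ 1 <= s -> Kp.1 (s, t, u) = nu g t,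
        forall s t u, t <= 0 -> Kp.1 (s, t, u) = vt 1%g,
        forall s t u, 1 <= t -> Kp.1 (s, t, u) = fc g f (Kp.2 (s, u)) &
        forall s u, (s <= 0 -> (Kp.2 (s, u)).1 <= 0) /\ (1 <= s -> 1 <= (Kp.2 (s, u)).1)]].
  have [K [ph h]] := face_slide (layer_diff g f).
  by exists (K, ph).
have [Kp KpP] := choice (fun gf => sl gf.1 gf.2).
pose K g f := (Kp (g, f)).1; pose ph g f := (Kp (g, f)).2.
have KP g f : [/\ continuous (K g f), continuous (ph g f),
    forall s t, K g f (s, t, 0) = word_contr g (w f) (s, t) /\ K g f (s, t, 1) = nu g t,
    forall s, ph g f (s, 0) = (s, 1) /\ ph g f (s, 1) = (cl (3 * s - 1), 0) &
    [/\ forall s t u, s <= 0 \/ 1 <= s -> K g f (s, t, u) = nu g t,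
        forall s t u, t <= 0 -> K g f (s, t, u) = vt 1%g,
        forall s t u, 1 <= t -> K g f (s, t, u) = fc g f (ph g f (s, u)) &
        forall s u, (s <= 0 -> (ph g f (s, u)).1 <= 0) /\ (1 <= s -> 1 <= (ph g f (s, u)).1)]].
  exact: (KpP (g, f)).
clearbody K ph; clear Kp KpP sl.
have e11 : 1 - 1 = 0 :> R by lra.
(* a homotopy from the base point to a map [Phi] that maps every cell to itself *)
pose v1 (m : cM D) := nu m.
pose e1 (m : cM D) (x : X) := edge_contr m x.
(* The cube of [slide] is reread: its second parameter becomes the time and its third the depth
   below the top of the face. The top is then contracted by [word_contr], in agreement with its
   edges, and the bottom by [nu], like the vertex. *)
pose k1 (m : cM D) (f : F) (z : R * R * R) := K m f (z.1.1, z.2, 1 - cl z.1.2).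
pose H1 := cell_map v1 e1 k1.
have e1_0 m x s t : s <= 0 -> e1 m x (s, t) = v1 m t.
  move=> s0; apply: stack_side => //; first by left.
  by move=> t'; have [_ _ _ h _] := edge_fillP m x; exact: h.
have e1_1 m x s t : 1 <= s -> e1 m x (s, t) = v1 (cmv m (x, true)) t.
  move=> s1; apply: stack_side => //; first by right.
  by move=> t'; have [_ _ _ _ h] := edge_fillP m x; exact: h.
have k1_s m f s t u : s <= 0 \/ 1 <= s \/ t <= 0 -> t < 1 -> k1 m f (s, t, u) = v1 m u.
  have [_ _ K01 _ [Ks _ _ _]] := KP m f; rewrite /k1 /=.
  move=> [h|[h|h]] _; [by rewrite Ks //; left|by rewrite Ks //; right|].
  by rewrite cl_0 // subr0; have [_ ->] := K01 s u.
have H1_edge := cell_map_edge k1 e1_0 e1_1.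
have H1_vert m : H1 (vt m) = v1 m by [].
have H1_wp m u s t : H1 (wp m u s) t = word_contr m u (s, t).
  elim: u m s => [|a u IH] m s.
    rewrite (H1_vert m : H1 (wp m [::] s) = v1 m) /v1 /nu /word_contr /stack /ifle /=; case: ifPn => // h.
    by rewrite mu_0 //; lra.
  rewrite word_contr_cons /= /ifle; case: ifP => _; last exact: IH.
  by rewrite /ledge; case: (a.2); rewrite /H1 H1_edge.
have k1_t m f s t u : 1 <= t -> k1 m f (s, t, u) = H1 (wp m (w f) s) u.
  move=> t1; rewrite /k1 /= cl_1 // e11 H1_wp.
  by have [_ _ K01 _ _] := KP m f; have [->] := K01 s u.
have H1_face := cell_map_face k1_s k1_t.
have cH1 : continuous (fun z : Y * R => H1 z.1 z.2).
  apply: cell_map_cts => // [m|m x|m f].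
  - exact: nu_cts.
  - exact: edge_contr_cts.
  - by have [cK _ _ _ _] := KP m f; rewrite /k1; cts.
(* the straight-line homotopy from [Phi] to the identity *)
pose v2 (m : cM D) (t : R) : Y := vt m.
pose e2 (m : cM D) (x : X) (z : R * R) : Y := edg m x z.1.
pose k2 (m : cM D) (f : F) (z : R * R * R) : Y := fc m f
  ((1 - cl z.2) * (ph m f (z.1.1, 1 - cl z.1.2)).1 + cl z.2 * cl z.1.1,
   (1 - cl z.2) * (ph m f (z.1.1, 1 - cl z.1.2)).2 + cl z.2 * cl z.1.2).
pose H2 := cell_map v2 e2 k2.
have e2_0 m x s t : s <= 0 -> e2 m x (s, t) = v2 m t by exact: edge0.
have e2_1 m x s t : 1 <= s -> e2 m x (s, t) = v2 (cmv m (x, true)) t by exact: edge1.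
have k2_s m f s t u : s <= 0 \/ 1 <= s \/ t <= 0 -> t < 1 -> k2 m f (s, t, u) = v2 m u.
  have [_ _ _ p01 [_ _ _ pb]] := KP m f; rewrite /k2 /= => h _.
  have u0 := cl_ge0 u; have u1 := cl_le1 u.
  apply: face_side; case: h => [h|[h|h]].
  - by left; rewrite (cl_0 h); have [/(_ h) q _] := pb s (1 - cl t); nra.
  - by right; left; rewrite (cl_1 h); have [_ /(_ h) q] := pb s (1 - cl t); nra.
  - by right; right; rewrite (cl_0 h) subr0; have [_ ->] := p01 s; rewrite /= !mulr0 addr0.
have H2_edge := cell_map_edge k2 e2_0 e2_1.
have H2_wp m u s t : H2 (wp m u s) t = wp m u s.
  elim: u m s => [//|a u IH] m s /=; rewrite /ifle; case: ifP => _; last exact: IH.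
  by rewrite /ledge; case: (a.2); rewrite /H2 H2_edge.
have k2_t m f s t u : 1 <= t -> k2 m f (s, t, u) = H2 (wp m (w f) s) u.
  move=> t1; rewrite H2_wp /k2 /= (cl_1 t1) e11; have [_ _ _ p01 _] := KP m f.
  have [-> _] := p01 s; rewrite /= (_ : (1 - cl u) * 1 + cl u * 1 = 1); last by lra.
  rewrite face_top //; have u0 := cl_ge0 u; have u1 := cl_le1 u.
  case: (clP s) => h.
  - by rewrite !wpath0 //; nra.
  - by move=> h'; congr wp; lra.
  - by rewrite !wpath1 //; nra.
have H2_face := cell_map_face k2_s k2_t.
have cH2 : continuous (fun z : Y * R => H2 z.1 z.2).
  apply: cell_map_cts => // [m|m x|m f].
  - exact: cts_cst.
  - by have ce := @edge_cts R X F w D m x; rewrite /e2; cts.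
  - have [_ cp _ _ _] := KP m f; have cf := @face_cts R X F w D m f.
    by rewrite /k2; cts.
have H2_1 y : H2 y 1 = y.
  elim/cpx_case: y => [m|m x t ht|m f s t hs ht] //.
    by rewrite /H2 H2_edge.
  rewrite /H2 H2_face /k2 cl11 e11 !mul0r !mul1r !add0r /=; exact: face_cl.
have H12 y : H2 y 0 = H1 y 1.
  elim/cpx_case: y => [m|m x t ht|m f s t hs ht].
  - by rewrite H1_vert /v1 /nu mu_1 // cl11; lra.
  - rewrite /H2 H2_edge /H1 H1_edge /e2 /e1 /edge_contr stack_1 //=.
    by have [_ _ h _ _] := edge_fillP m x; rewrite h.
  - rewrite /H2 H2_face /H1 H1_face /k2 /k1 cl00 subr0 !mul1r !mul0r !addr0 /=.
    have [_ _ _ _ [_ _ K1 _]] := KP m f; rewrite K1 //.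
have H1_0 y : H1 y 0 = vt 1%g.
  elim/cpx_case: y => [m|m x t ht|m f s t hs ht].
  - by rewrite H1_vert /v1 /nu mu_0 // cl00; lra.
  - by rewrite /H1 H1_edge /e1 /edge_contr stack_0.
  - by rewrite /H1 H1_face /k1 /=; have [_ _ _ _ [_ K0 _ _]] := KP m f; rewrite K0.
exists (fun z => ifle z.2 2^-1 (H2 z.1 (1 - 2 * z.2)) (H1 z.1 (2 - 2 * z.2))); split=> /=.
- apply: cts_ifle; [by cts|by cts| | |].
  + by apply: (cts_comp (u := fun z : Y * R => (z.1, 1 - 2 * z.2)) cH2); cts.
  + by apply: (cts_comp (u := fun z : Y * R => (z.1, 2 - 2 * z.2)) cH1); cts.
  + move=> [y t] /= ->; rewrite mulfV ?pnatr_eq0 // e11 H12; congr (H1 _ _); lra.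
- move=> y; rewrite /ifle ifT; last by lra.
  by rewrite mulr0 subr0.
- move=> y; rewrite /ifle if_ltF; last by lra.
  by rewrite mulr1 subrr.
- move=> t; rewrite /ifle; case: ifP => _; first by [].
  by rewrite H1_vert /v1 /nu mu_one.
Qed.

End Layers.
End CayleyContraction.

(** * Cochains and the criterion for asphericity *)

Section CochainSum.
Variables (G : groupType) (X : choiceType) (rho : X -> G) (A : zmodType) (a : G -> X -> A).

Definition letter_sum (m : G) (b : X * bool) : A :=
  if b.2 then a m b.1 else - a (m * eval_letter rho b)%g b.1.

(** The value of the 1-cochain [a] on the edge path from [m] that reads [u]. On a relator this is
    the coboundary of [a] on the face at [m]. *)
Fixpoint word_sum (m : G) (u : seq (X * bool)) : A :=
  if u is b :: u' then letter_sum m b + word_sum (m * eval_letter rho b)%g u' else 0.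

End CochainSum.

(* The hypothesis is the vanishing of H^2 of the universal cover. *)
Theorem aspherical_KG1 (R : realType) (X F : finType) (rr : F -> freegroup X) (G : groupType)
    (rho : X -> G) (sec : G -> freegroup X) :
  (forall x, free_lift rho x = 1%g <-> normal_closure (range rr) x) ->
  (forall g, free_lift rho (sec g) = g) -> sec 1%g = 1%g ->
  (forall (A : zmodType) (K : G -> F -> A),
    exists a : G -> X -> A, forall g f, word_sum rho a g (word (rr f)) = K g f) ->
  has_finite_KG1 R 2 G.
Proof.
move=> ker secK sec1 H2.
pose D := gdata (rel_trivial ker); pose y1 := vert R (D := D) 1%g.
(* The obstruction cochain assigns to a face the class of its [face_diff]; a cochain with this
   coboundary prescribes the layers. *)
have [a aP] := H2 (pi2 R y1)
  (fun g f => qcls (S := pi2_pre R y1) (face_diff (R := R) ker secK g f)).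
have ex g x : exists p : R * R -> cpx R D, sph y1 p /\ a g x = qcls (S := pi2_pre R y1) p.
  by have [p] := qcls_surj (a g x); exists p.
have [l lP] := choice (fun gx => ex gx.1 gx.2).
pose layer g x := l (g, x).
have layer_sph g x : sph y1 (layer g x) by have [] := lP (g, x).
have layerE g x : qcls (S := pi2_pre R y1) (layer g x) = a g x by have [_ ->] := lP (g, x).
have wordE m u : qcls (S := pi2_pre R y1) (word_layer layer m u) = word_sum rho a m u.
  elim: u m => [//|b u IH] m.
  rewrite [LHS](@qcls_op (pi2_pre R y1)); last exact: word_layer_sph.
    rewrite IH; congr (_ + _); rewrite /letter_layer /letter_sum; case: (b.2).
      exact: layerE.
    rewrite [LHS](@qcls_inv (pi2_pre R y1)); first by rewrite layerE.
    exact: layer_sph.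
  exact: letter_layer_sph.
have diff g f : fhom (@bdZ R) (word_layer layer g (word (rr f))) (face_diff (R := R) ker secK g f).
  apply/(@qcls_eq (pi2_pre R y1)); [exact: word_layer_sph|exact: face_diff_sph|].
  by rewrite wordE aP.
have [H [cH H0 H1 Hb]] := contraction sec1 layer_sph diff.
exists (cpx R (udata (fun f => word (rr f)))); split; first exact: ucpx_CW.
exact: (cayley_KG1 cH H0 H1 Hb).
Qed.

(* Smith normal form turns the relation into a multiple of a basis vector, which torsion-freeness kills. *)
Lemma drop_generator (T : finType) (M : zmodType) (y : T -> M) (c : T -> int) (j0 : T) :
  (forall (a : M) n, a *+ n.+1 = 0 -> a = 0) ->
  \sum_j y j *~ c j = 0 -> c j0 != 0 ->
  exists2 s : seq M, size s = #|T|.-1 &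
    forall S : set M, S 0 -> (forall a b, S a -> S b -> S (a - b)) ->
      (forall a, a \in s -> S a) -> forall j, S (y j).
Proof.
move=> tf yc cj0.
have cT : #|T| = #|T|.-1.+1 by rewrite prednK //; apply/card_gt0P; exists j0.
move: cT; set n := _.-1 => cT.
pose ev (i : 'I_n.+1) : T := enum_val (cast_ord (esym cT) i).
pose rk (j : T) : 'I_n.+1 := cast_ord cT (enum_rank j).
have rkK : cancel rk ev by move=> j; rewrite /rk /ev cast_ordK enum_rankK.
have evK : cancel ev rk by move=> i; rewrite /rk /ev enum_valK cast_ordKV.
have evbij : bijective ev by exists rk.
pose v : 'rV[int]_n.+1 := \row_i c (ev i).
have [L Lu [U Uu [d _ vE]]] := int_Smith_normal_form v.
pose y' (i : 'I_n.+1) : M := \sum_k y (ev k) *~ U i k.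
have y'0 : y' ord0 = 0.
  (* Up to sign the greatest common divisor of the coefficients: the Smith form of a row has a
     single nonzero entry at most, so [v] is [e] times the first row of the unimodular [U]. *)
  pose e : int := L ord0 ord0 * d`_0.
  have vk k : v ord0 k = e * U ord0 k.
    rewrite {1}vE !mxE (bigD1 ord0) //= big1 => [|i i0].
      by rewrite addr0 !mxE big_ord1 mxE /= mulr1n.
    by rewrite !mxE big_ord1 mxE eq_sym -val_eqE /= in i0 *; rewrite (negPf i0) mulr0n mulr0 mul0r.
  have ey : y' ord0 *~ e = 0.
    rewrite -[RHS]yc (reindex ev) /=; last exact: onW_bij.
    rewrite /y' mulrz_suml; apply: eq_bigr => k _.
    by rewrite -mulrzA mulrC -vk mxE.
  have e0 : e != 0.
    apply: contra cj0 => /eqP e0; have := vk (rk j0).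
    by rewrite mxE rkK e0 mul0r => ->.
  move: ey e0; case: e {vk} => [[//|m]|m] /= h _; first exact: (tf _ m).
  by apply: (tf _ m); apply/eqP; rewrite -oppr_eq0; apply/eqP; rewrite -[RHS]h NegzE mulrNz.
have yE j : y j = \sum_i y' i *~ invmx U (rk j) i.
  under eq_bigr => i _ do rewrite /y' mulrz_suml.
  rewrite exchange_big /=.
  transitivity (\sum_k y (ev k) *~ (invmx U *m U) (rk j) k).
    rewrite mulVmx // (bigD1 (rk j)) //= rkK !mxE eqxx mulr1z big1 ?addr0 // => k kj.
    by rewrite mxE eq_sym (negPf kj) mulr0z.
  apply: eq_bigr => k _; rewrite mxE mulrz_sumr; apply: eq_bigr => i _.
  by rewrite -mulrzA mulrC.
exists [seq y' (lift ord0 i) | i <- enum 'I_n].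
  by rewrite size_map size_enum_ord.
move=> S S0 SB sS j.
have SN a : S a -> S (- a) by rewrite -sub0r; exact: SB.
have SD a b : S a -> S b -> S (a + b) by move=> Sa Sb; rewrite -[b]opprK; apply: SB => //; exact: SN.
have SZ a (z : int) : S a -> S (a *~ z).
  move=> Sa; have Sn m : S (a *+ m) by elim: m => // m IH; rewrite mulrS; exact: SD.
  by case: z => m; [exact: Sn|rewrite NegzE mulrNz; exact/SN/Sn].
rewrite yE; apply: (big_ind S) => // i _; apply: SZ.
case: (unliftP ord0 i) => [k ->|->]; last by rewrite y'0.
by apply: sS; apply: map_f; rewrite mem_enum.
Qed.

Local Open Scope group_scope.

(** * Relation modules *)

Section SubgroupFacts.
Variable F : groupType.
Implicit Types (A K N : set F) (x y : F).

Lemma subgroup1 K : is_subgroup K -> K 1. Proof. by case. Qed.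

Lemma subgroupV K x : is_subgroup K -> K x -> K x^-1.
Proof. by move=> [K1 Kd] Kx; rewrite -(mul1g x^-1); exact: Kd. Qed.

Lemma subgroupM K x y : is_subgroup K -> K x -> K y -> K (x * y).
Proof. by move=> sK Kx Ky; rewrite -(invgK y); apply: sK.2 => //; exact: subgroupV. Qed.

Lemma normalJV K x y : is_normal_subgroup K -> K x -> K (y * x * y^-1).
Proof. by move=> nK Kx; rewrite -mulgA -{1}(invgK y); exact: nK.2. Qed.

Lemma normal_closure_normal A : is_normal_subgroup (normal_closure A).
Proof.
split; [split|].
- by move=> K [[[]]].
- by move=> x y hx hy K [nK AK]; apply: nK.1.2; [apply: hx|apply: hy].
- by move=> x y hx K [nK AK]; apply: nK.2; apply: hx.
Qed.

Lemma sub_normal_closure A : A `<=` normal_closure A.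
Proof. by move=> x Ax K [_]; exact. Qed.

Lemma normal_closure_min A K : is_normal_subgroup K -> A `<=` K -> normal_closure A `<=` K.
Proof. by move=> nK AK x; apply. Qed.

Lemma derived_subgroup_subgroup N : is_subgroup (derived_subgroup N).
Proof.
split=> [K [[]] //|x y hx hy K [sK AK]].
by apply: sK.2; [apply: hx|apply: hy].
Qed.

Lemma derived_comm N x y : N x -> N y -> derived_subgroup N [~ x, y].
Proof. by move=> Nx Ny K [_]; apply; exists x, y. Qed.

Lemma derived_min N K : is_subgroup K -> (forall x y, N x -> N y -> K [~ x, y]) ->
  derived_subgroup N `<=` K.
Proof. by move=> sK h x; apply; split=> // _ [u [v [Nu Nv ->]]]; exact: h. Qed.

Lemma derived_sub N : is_subgroup N -> derived_subgroup N `<=` N.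
Proof.
move=> sN; apply: derived_min => // x y Nx Ny; rewrite /commg /conjg.
by do ?[apply: subgroupM => //]; exact: subgroupV.
Qed.

Lemma derived_normal N : is_normal_subgroup N -> is_normal_subgroup (derived_subgroup N).
Proof.
move=> nN; split=> [|x y Dx]; first exact: derived_subgroup_subgroup.
have sD := derived_subgroup_subgroup N.
move: x Dx; apply: (derived_min (K := [set x | derived_subgroup N (x ^ y)])) => /=.
  split=> [|u v /= Du Dv]; first by rewrite /= conj1g; exact: subgroup1.
  by rewrite conjMg conjVg; exact: sD.2.
by move=> u v Nu Nv; rewrite conjRg; apply: derived_comm; exact: nN.2.
Qed.

Lemma kernel_normal (G : groupType) (k : {multiplicative F -> G}) :
  is_normal_subgroup [set x | k x = 1].
Proof.
split; [split|] => /=; first exact: multiplicative1.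
  by move=> x y /= kx ky; rewrite gmulfM multiplicativeV kx ky invg1 mulg1.
by move=> x y /= kx; rewrite /conjg !gmulfM kx mul1g multiplicativeV mulVg.
Qed.

End SubgroupFacts.

Section Abelianisation.
Variables (F : groupType) (N : set F) (nN : is_normal_subgroup N).
Let D := derived_subgroup N.
Let sN : is_subgroup N := nN.1.
Let sD : is_subgroup D := derived_subgroup_subgroup N.
Let nD : is_normal_subgroup D := derived_normal nN.

Definition ab_pre : preab.
Proof.
refine (@PreAb F N (fun x y => D (x / y)) (fun x y => x * y) (fun x => x^-1) 1
  (subgroup1 sN) (fun x y => @subgroupM F N x y sN) (fun x => @subgroupV F N x sN) _ _ _ _ _ _ _ _).
- by move=> x _; rewrite mulgV; exact: (subgroup1 sD).
- by move=> x y _ _ h; rewrite -invgF; exact: (subgroupV sD).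
- by move=> x y z _ _ _ xy yz; rewrite -(divgKA y); exact: (subgroupM sD xy yz).
- move=> x x' y y' _ _ _ _ xx yy.
  have -> : x * y / (x' * y') = x * (y / y') * x^-1 * (x / x').
    by rewrite invgM !mulgA mulgVK.
  by apply: (subgroupM sD) => //; exact: (normalJV x nD yy).
- by move=> x y z _ _ _; rewrite mulgA mulgV; exact: (subgroup1 sD).
- move=> x y Nx Ny; rewrite (commgCV x y) mulgK; apply: derived_comm; exact: (subgroupV sN).
- by move=> x _; rewrite mul1g mulgV; exact: (subgroup1 sD).
- by move=> x _; rewrite mulVg mulgV; exact: (subgroup1 sD).
Defined.

Definition abelianisation : zmodType := quot ab_pre.

Definition abcls (x : F) : abelianisation := qcls (S := ab_pre) x.

Lemma abcls_surj c : exists2 x, N x & c = abcls x.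
Proof. exact: (@qcls_surj ab_pre). Qed.

Lemma abcls_mul x y : N x -> N y -> abcls (x * y) = (abcls x + abcls y)%R.
Proof. exact: (@qcls_op ab_pre). Qed.

Lemma abcls0 x : N x -> (abcls x = 0%R <-> D x).
Proof.
move=> Nx; rewrite -(qcls_one ab_pre) (@qcls_eq ab_pre) //; last exact: subgroup1.
by rewrite /= divg1.
Qed.

End Abelianisation.

(* A homomorphism from [N] to an abelian group, extended arbitrarily to [F]. *)
Definition additive_on (F : groupType) (N : set F) (A : zmodType) (k : F -> A) : Prop :=
  forall x y, N x -> N y -> k (x * y) = (k x + k y)%R.

Section AdditiveOn.
Variables (F : groupType) (N : set F) (sN : is_subgroup N) (A : zmodType) (k : F -> A).
Hypothesis kD : additive_on N k.

Lemma additive_on1 : k 1 = 0%R.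
Proof.
have N1 := subgroup1 sN; apply: (@addrI _ (k 1)).
by rewrite -kD // mulg1 addr0.
Qed.

Lemma additive_onV x : N x -> k x^-1 = (- k x)%R.
Proof.
move=> Nx; apply: (@addrI _ (k x)).
by rewrite -kD ?mulgV ?additive_on1 ?subrr //; exact: subgroupV.
Qed.

Lemma additive_on_derived x : derived_subgroup N x -> k x = 0%R.
Proof.
move=> Dx; suff [] : N x /\ k x = 0%R by [].
move: x Dx; apply: (derived_min (K := [set x | N x /\ k x = 0%R])).
  split=> /=; first by split; [exact: subgroup1|exact: additive_on1].
  move=> x y [Nx kx] [Ny ky]; split; first exact: sN.2.
  by rewrite kD ?additive_onV ?kx ?ky ?subrr //; exact: subgroupV.
move=> x y Nx Ny /=.
have [Vx Vy] := (subgroupV sN Nx, subgroupV sN Ny).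
have e : [~ x, y] = x^-1 * y^-1 * (x * y) by rewrite /commg /conjg !mulgA.
split; first by rewrite e; do ?apply: subgroupM.
rewrite e !kD //; try exact: subgroupM.
by rewrite !additive_onV // -opprD addrC (addrC (k x)) subrr.
Qed.

End AdditiveOn.

(** * Formal sums as signed lists *)

Section FormalSums.
Variables (T : eqType).

(** Terms are kept in a list with signs ([true] for plus) because the same list also records an
    ordered product in a nonabelian group; [coef] forgets the order. *)
Definition fsum (A : zmodType) (a : T -> A) (s : seq (bool * T)) : A :=
  (\sum_(e <- s) if e.1 then a e.2 else - a e.2)%R.

Definition coef (p : T) (s : seq (bool * T)) : int := fsum (fun q => (q == p)%:Z%R) s.

Lemma fsum_cat (A : zmodType) (a : T -> A) s s' : fsum a (s ++ s') = (fsum a s + fsum a s')%R.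
Proof. exact: big_cat. Qed.

Lemma fsum_keys (A : zmodType) (a : T -> A) s ks : uniq ks -> {subset map snd s <= ks} ->
  fsum a s = (\sum_(p <- ks) a p *~ coef p s)%R.
Proof.
move=> uk sk; under eq_bigr => p _ do rewrite /coef /fsum mulrz_sumr.
rewrite exchange_big /=; apply: eq_big_seq => e se.
have ek : e.2 \in ks by apply: sk; apply: map_f.
rewrite (bigD1_seq e.2) //= eqxx big1 => [|p pe].
  by rewrite addr0; case: e.1; rewrite ?mulNrz ?mulrNz.
by rewrite eq_sym (negPf pe); case: e.1; rewrite ?oppr0 mulr0z.
Qed.

Lemma fsum_coef0 (A : zmodType) (a : T -> A) s : (forall p, coef p s = 0%R) -> fsum a s = 0%R.
Proof.
move=> s0; rewrite (@fsum_keys _ a s (undup (map snd s))) ?undup_uniq //.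
  by rewrite big1 // => p _; rewrite s0 mulr0z.
by move=> p; rewrite mem_undup.
Qed.

End FormalSums.

Lemma fsum_fin (T : finType) (A : zmodType) (a : T -> A) s :
  fsum a s = (\sum_p a p *~ coef p s)%R.
Proof. by rewrite (@fsum_keys _ _ a s (index_enum T)) ?index_enum_uniq // => p _; rewrite mem_index_enum. Qed.

Lemma freegroup_elim (X : choiceType) (P : freegroup X -> Prop) : P 1 ->
  (forall t, P (free_gen t)) -> (forall x, P x -> P x^-1) ->
  (forall x y, P x -> P y -> P (x * y)) -> forall x, P x.
Proof.
move=> P1 Pg PV PM [w rw]; elim: w rw => [|a w IH] raw.
  by rewrite (_ : FreeGroup raw = 1) //; exact/val_inj.
have rw := reduced_behead raw.
have ra : reduced [:: a] by [].
rewrite (_ : FreeGroup raw = FreeGroup ra * FreeGroup rw); last first.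
  by apply/val_inj => /=; case: (w) raw {IH rw} => //= b v /andP[/negPf-> _].
apply: PM; last exact: IH.
case: a {raw} ra => t [] ra.
  by rewrite (_ : FreeGroup ra = free_gen t) //; exact/val_inj.
rewrite (_ : FreeGroup ra = (free_gen t)^-1); last exact/val_inj.
exact: PV.
Qed.

Lemma free_lift1 (X : choiceType) (G : groupType) (rho : X -> G) : free_lift rho 1 = 1.
Proof. exact: multiplicative1. Qed.

Lemma free_liftV (X : choiceType) (G : groupType) (rho : X -> G) x :
  free_lift rho x^-1 = (free_lift rho x)^-1.
Proof. exact: multiplicativeV. Qed.

(** * Crossed maps, telescoping and Fox derivatives *)

Section Crossed.
Variables (G : groupType) (X : choiceType) (rho : X -> G) (B : groupType).

Definition crossed_letter (a : G -> X -> B) (m : G) (b : X * bool) : B :=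
  if b.2 then a m b.1 else (a (m * eval_letter rho b) b.1)^-1.

Fixpoint crossed_word (a : G -> X -> B) (m : G) (u : seq (X * bool)) : B :=
  if u is b :: u' then crossed_letter a m b * crossed_word a (m * eval_letter rho b) u' else 1.

Definition crossed (a : G -> X -> B) (m : G) (x : freegroup X) : B := crossed_word a m (word x).

(** Multiplicativity along edge paths of the Cayley graph, where [m] is the starting vertex. With
    abelian values these are cochains and Fox derivatives, with values in a free group the
    Reidemeister-Schreier rewriting; the laws are shared. *)
Definition is_crossed (c : G -> freegroup X -> B) : Prop :=
  forall m x y, c m (x * y) = c m x * c (m * free_lift rho x) y.

Lemma crossed_letterV a m b :
  crossed_letter a m b * crossed_letter a (m * eval_letter rho b) (inv_letter b) = 1.
Proof.
rewrite /crossed_letter eval_inv_letter mulgK; case: b => x [] /=; [exact: mulgV|exact: mulVg].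
Qed.

Lemma crossed_cons_red a m b u : crossed_word a m (cons_red b u) =
  crossed_letter a m b * crossed_word a (m * eval_letter rho b) u.
Proof.
case: u => [//|c u] /=; case: eqP => [->|//].
by rewrite mulgA crossed_letterV mul1g eval_inv_letter mulgK.
Qed.

Lemma crossed_is_crossed a : is_crossed (crossed a).
Proof.
move=> m x y; rewrite /crossed /= /free_lift.
elim: (word x) m => [|b u IH] m /=; first by rewrite /eval_word big_nil mulg1 mul1g.
by rewrite crossed_cons_red IH /eval_word big_cons !mulgA.
Qed.

Lemma crossed_gen a m t : crossed a m (free_gen t) = a m t.
Proof. by rewrite /crossed /= mulg1. Qed.

Section Laws.
Variables (c : G -> freegroup X -> B) (cM : is_crossed c).

Lemma crossed1 m : c m 1 = 1.
Proof.
have := cM m 1 1; rewrite multiplicative1 !mulg1 => e.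
by apply: (@mulgI _ (c m 1)); rewrite -e mulg1.
Qed.

Lemma crossedV m x : c m x^-1 = (c (m * (free_lift rho x)^-1) x)^-1.
Proof.
apply/esym/mulg1_eq; have := cM (m / free_lift rho x) x x^-1.
by rewrite mulgVK mulgV crossed1.
Qed.

Lemma crossedJ m x y : c m (y * x * y^-1) =
  c m y * c (m * free_lift rho y) x * (c (m * free_lift rho (y * x * y^-1)) y)^-1.
Proof. by rewrite !cM crossedV !free_lift_mul free_liftV !mulgA. Qed.

End Laws.

Lemma crossed_unique c c' : is_crossed c -> is_crossed c' ->
  (forall m t, c m (free_gen t) = c' m (free_gen t)) -> forall x m, c m x = c' m x.
Proof.
move=> cM cM' cc; elim/freegroup_elim => [m|t m|x IH m|x y IHx IHy m].
- by rewrite !crossed1.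
- exact: cc.
- by rewrite !crossedV // IH.
- by rewrite cM cM' IHx IHy.
Qed.

End Crossed.

(* Makes the theory of group-valued crossed maps available for additive values. *)
Definition mulgrp (A : zmodType) : Type := A.
HB.instance Definition _ (A : zmodType) := Choice.on (mulgrp A).
HB.instance Definition _ (A : zmodType) := isGroup.Build (mulgrp A)
  (@addrA A) (@add0r A) (@addr0 A) (@addNr A) (@addrN A).

Section Telescoping.
Variables (G : groupType) (X : choiceType) (rho : X -> G) (A : zmodType).

(** The cellular 1-chain of the path from [m] reading [u]; for [m = 1] its coefficients are the Fox
    derivatives of [u]. *)
Fixpoint chain (m : G) (u : seq (X * bool)) : seq (bool * (G * X)) :=
  if u is b :: u' then (b.2, (if b.2 then m else m * eval_letter rho b, b.1)) ::
    chain (m * eval_letter rho b) u' else [::].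

Lemma word_sum_chain (a : G -> X -> A) m u : word_sum rho a m u = fsum (fun p => a p.1 p.2) (chain m u).
Proof.
elim: u m => [|b u IH] m /=; first by rewrite /fsum big_nil.
by rewrite IH [RHS]/fsum big_cons; congr (_ + _)%R; rewrite /letter_sum /=; case: b.2.
Qed.

Lemma word_sum_crossed (a : G -> X -> A) m x :
  word_sum rho a m (word x) = crossed rho (B := mulgrp A) a m x.
Proof. by rewrite /crossed; elim: (word x) m => [//|b u IH] m /=; rewrite IH. Qed.

Variables (sec : G -> freegroup X) (secK : forall g, free_lift rho (sec g) = g).
Variables (k : freegroup X -> A) (kD : additive_on [set x | free_lift rho x = 1] k).

(** Each edge contributes the loop that reaches it along [sec], crosses it and returns, and
    consecutive returns cancel. Formally, both sides are crossed maps with the same values on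
    generators. *)
Lemma telescoping g x :
  word_sum rho (fun g t => k (sec g * free_gen t * (sec (g * rho t))^-1)) g (word x) =
  k (sec g * x * (sec (g * free_lift rho x))^-1).
Proof.
rewrite word_sum_crossed.
apply: (crossed_unique (rho := rho) (c' := fun g x => k (sec g * x * (sec (g * free_lift rho x))^-1) : mulgrp A)).
- exact: crossed_is_crossed.
- move=> m y z; set m' := m * free_lift rho y.
  rewrite free_lift_mul (mulgA m) -/m'.
  set u := sec m * y * (sec m')^-1; set v := sec m' * z * (sec (m' * free_lift rho z))^-1.
  rewrite (_ : sec m * (y * z) * _ = u * v); last by rewrite /u /v !mulgA mulgVK.
  by apply: kD; rewrite /= !free_lift_mul free_liftV !secK mulgV.
- by move=> m t; rewrite crossed_gen free_lift_gen.
Qed.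

End Telescoping.

Lemma fsum_map (T T' : eqType) (A : zmodType) (h : T -> T') (a : T' -> A) s :
  fsum a [seq (e.1, h e.2) | e <- s] = fsum (a \o h) s.
Proof. exact: big_map. Qed.

(** * Identities among relators *)

Section RelatorProducts.
Variables (F : groupType) (J : eqType) (rr : J -> F).

Definition rel_letter (e : bool * (F * J)) : F :=
  e.2.1 * (if e.1 then rr e.2.2 else (rr e.2.2)^-1) * e.2.1^-1.

Definition rel_prod (l : seq (bool * (F * J))) : F := \prod_(e <- l) rel_letter e.

Lemma rel_prod_cat l l' : rel_prod (l ++ l') = rel_prod l * rel_prod l'.
Proof. exact: big_cat. Qed.

Definition rel_flip (e : bool * (F * J)) := (~~ e.1, e.2).

Lemma rel_letter_flip e : rel_letter (rel_flip e) = (rel_letter e)^-1.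
Proof.
rewrite /rel_letter /=; by case: e.1 => /=; rewrite !invgM !invgK ?mulgA.
Qed.

Lemma rel_prod_flip l : rel_prod (rev [seq rel_flip e | e <- l]) = (rel_prod l)^-1.
Proof.
elim: l => [|e l IH]; first by rewrite /rel_prod big_nil invg1.
rewrite /= rev_cons -cats1 rel_prod_cat IH /rel_prod big_seq1 big_cons.
by rewrite invgM rel_letter_flip.
Qed.

Lemma fsum_flip (A : zmodType) (a : F * J -> A) l :
  fsum a (rev [seq rel_flip e | e <- l]) = (- fsum a l)%R.
Proof.
rewrite /fsum big_rev /= big_map -sumrN.
by apply: eq_bigr => -[[] p] _ //=; rewrite opprK.
Qed.

Lemma normal_closure_prod x : normal_closure (range rr) x -> exists l, rel_prod l = x.
Proof.
move: x; apply: normal_closure_min => [|_ [j _ <-]].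
  split; [split|].
  - by exists [::]; rewrite /rel_prod big_nil.
  - move=> _ _ [l <-] [l' <-]; exists (l ++ rev [seq rel_flip e | e <- l']).
    by rewrite rel_prod_cat rel_prod_flip.
  - move=> _ y [l <-]; exists [seq (e.1, (y^-1 * e.2.1, e.2.2)) | e <- l].
    rewrite /rel_prod conjg_prod big_map; apply: eq_bigr => e _.
    by rewrite /rel_letter /= /conjg invgM invgK !mulgA.
by exists [:: (true, (1, j))]; rewrite /rel_prod big_seq1 /rel_letter /= invg1 mulg1 mul1g.
Qed.

End RelatorProducts.

(* Triviality of the second homotopy module of the presentation complex: the
   combinatorial identities among the relators all have zero coefficients. *)
Definition no_identities (X : choiceType) (J : eqType) (rr : J -> freegroup X) (G : groupType)
    (rho : X -> G) : Prop :=
  forall l, rel_prod rr l = 1 ->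
    forall p, coef p [seq (e.1, (free_lift rho e.2.1, e.2.2)) | e <- l] = 0%R.

Theorem no_identities_KG1 (R : realType) (X J : finType) (rr : J -> freegroup X) (G : groupType)
    (rho : X -> G) (sec : G -> freegroup X) :
  (forall x, free_lift rho x = 1 <-> normal_closure (range rr) x) ->
  (forall g, free_lift rho (sec g) = g) -> sec 1 = 1 ->
  no_identities rr rho -> has_finite_KG1 R 2 G.
Proof.
move=> ker secK sec1 inj; apply: (aspherical_KG1 R ker secK sec1) => A K.
pose Kf (p : freegroup X * J) : A := K (free_lift rho p.1) p.2.
(* Two expressions of one element as a product of conjugated relators differ by an identity, so the
   sum of the prescribed values depends on the element only and gives a homomorphism. *)
have wd l l' : rel_prod rr l = rel_prod rr l' -> fsum Kf l = fsum Kf l'.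
  move=> ll; apply/eqP; rewrite -subr_eq0 -fsum_flip -fsum_cat; apply/eqP.
  set l2 := _ ++ _; have /inj l20 : rel_prod rr l2 = 1.
    by rewrite rel_prod_cat rel_prod_flip ll mulgV.
  have := @fsum_coef0 _ A (fun p => K p.1 p.2) _ l20.
  by rewrite (fsum_map (fun p : freegroup X * J => (free_lift rho p.1, p.2))).
have ex x : exists l, free_lift rho x = 1 -> rel_prod rr l = x.
  have [/ker /normal_closure_prod [l <-]|nx] := pselect (free_lift rho x = 1); first by exists l.
  by exists [::].
have [l lP] := choice ex.
have kD : additive_on [set x | free_lift rho x = 1] (fun x => fsum Kf (l x)).
  move=> x y /= x1 y1; rewrite -fsum_cat; apply: wd.
  by rewrite rel_prod_cat !lP // free_lift_mul x1 y1 mulg1.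
exists (fun g t => fsum Kf (l (sec g * free_gen t * (sec (g * rho t))^-1))) => g f.
have rr1 : free_lift rho (rr f) = 1 by apply/ker; apply: sub_normal_closure; exists f.
have -> : K g f = fsum Kf [:: (true, (sec g, f))] by rewrite /fsum big_seq1 /Kf /= secK.
rewrite (telescoping secK kD) rr1 mulg1; apply: wd.
rewrite lP; first by rewrite /rel_prod big_seq1.
by rewrite !free_lift_mul free_liftV rr1 mulg1 mulgV.
Qed.

(** * Relation modules are torsion-free *)

Section TorsionFree.
Variables (X : choiceType) (G : groupType) (rho : X -> G) (sec : G -> freegroup X).
Hypotheses (secK : forall g, free_lift rho (sec g) = g) (sec1 : sec 1 = 1).
Variables (N : set (freegroup X)) (nN : is_normal_subgroup N).
Hypothesis NE : forall x, N x <-> free_lift rho x = 1.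

(* The exponent vector of [x] in the free Z[G]-module on the generators (Fox calculus):
   it is additive on [N], and by telescoping it determines the class of [x]. *)
Lemma abelianisation_torsion_free (c : abelianisation nN) (n : nat) :
  (c *+ n.+1 = 0 -> c = 0)%R.
Proof.
have [x Nx ->] := abcls_surj c; move=> xn.
pose chi p (x : freegroup X) := coef p (chain rho 1 (word x)).
have chiE p y : chi p y = crossed rho (B := mulgrp int) (fun g t => ((g, t) == p)%:Z%R) 1 y.
  rewrite -word_sum_crossed word_sum_chain /chi /coef.
  by apply: eq_bigr => -[b [g t]] _.
have chiD p : additive_on N (chi p).
  move=> y z /NE Ny /NE Nz; rewrite !chiE (@crossed_is_crossed _ _ rho).
  by rewrite Ny mulg1.
have abX m : N (x ^+ m) /\ abcls nN (x ^+ m) = (abcls nN x *+ m)%R /\ (forall p, chi p (x ^+ m) = (chi p x *+ m)%R).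
  elim: m => [|m [Nm [IH IH']]].
    split; first exact: subgroup1 nN.1.
    by split=> [//|p]; rewrite expg0 mulr0n; exact: (additive_on1 nN.1 (chiD p)).
  rewrite expgS; split; first exact: (subgroupM nN.1).
  split=> [|p]; first by rewrite abcls_mul // IH mulrS.
  by rewrite (chiD p) // IH' mulrS.
have [Nm [ab chin]] := abX n.+1.
have Dx : derived_subgroup N (x ^+ n.+1) by apply/(abcls0 nN Nm); rewrite ab.
have chi0 p : chi p x = 0%R.
  have := chin p; rewrite (additive_on_derived nN.1 (chiD p) Dx) => /esym/eqP.
  by rewrite mulrn_eq0 => /eqP.
have kD : additive_on [set x | free_lift rho x = 1] (abcls nN).
  by move=> y z /NE Ny /NE Nz; exact: abcls_mul.
have := telescoping secK kD 1 x; have /NE -> := Nx.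
rewrite mulg1 sec1 invg1 mulg1 mul1g => <-.
by rewrite word_sum_chain; exact: fsum_coef0.
Qed.

End TorsionFree.

Lemma least_spec (S : set nat) k : S k -> S (least S) /\ (least S <= k)%N.
Proof.
move=> Sk; pose Q n := `[< S n >].
have ex : exists n, Q n by exists k; apply/asboolP.
case: (ex_minnP ex) => m /asboolP Sm min_m.
have minS j : S j -> (m <= j)%N by move=> /asboolP; exact: min_m.
rewrite /least; case: xgetP => [_ -> [Sx minx]|/(_ m) []]; last by split.
by split=> //; exact: minx.
Qed.

(** * Generation of relation modules, and presentations without a gap *)

Section RelationModuleRank.
Variables (H : groupType) (P : finpres H).
Let F : groupType := freegroup (gens P).
Let N : set F := normal_closure [set` rels P].
Let D : set F := derived_subgroup N.
Let nN : is_normal_subgroup N := normal_closure_normal _.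
Let sN : is_subgroup N := nN.1.
Let nD : is_normal_subgroup D := derived_normal nN.
Let sD : is_subgroup D := nD.1.
Let DN : D `<=` N := derived_sub sN.

Lemma coset_div_lcoset (x y : F) : coset_div (lcoset D x) (lcoset D y) = lcoset D (x / y).
Proof.
apply/seteqP; split=> z /=.
  move=> [_ [_ [[d Dd <-] [e De <-] ->]]].
  exists (y * (d / e) * y^-1); first by apply: (normalJV _ nD); exact: sD.2.
  by rewrite invgM !mulgA mulgVK.
move=> [d Dd <-]; exists (x * (d ^ y)), (y * 1).
split; [by exists (d ^ y) => //; exact: nD.2|by exists 1 => //; exact: subgroup1 sD|].
by rewrite /conjg mulg1 !mulgA mulgK.
Qed.

Lemma relmod_act_lcoset (f n : F) : N n ->
  relmod_act (pres_map P f) (lcoset D n) = lcoset D (f * n * f^-1).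
Proof.
move=> Nn; apply/seteqP; split=> z /=.
  move=> [f' [_ [ff' [d Dd <-] ->]]].
  (* Another preimage differs from [f] by some [v] in [N], and conjugation by [v] changes [n] by a
     commutator in [D]. *)
  have [v Nv ->] : exists2 v, N v & f' = f * v.
    exists (f^-1 * f'); last by rewrite mulVKg.
    by apply/(pres_ker (f := P)); rewrite gmulfM multiplicativeV ff' mulVg.
  exists (f * (([~ n, v^-1]) * (v * d * v^-1)) * f^-1).
    apply: (normalJV _ nD); apply: (subgroupM sD).
      by apply: derived_comm => //; exact: (subgroupV sN).
    exact: (normalJV _ nD).
  by rewrite /commg /conjg !invgM !invgK !mulgA !mulgVK !mulgK.
move=> [d Dd <-]; exists f, (n * (d ^ f)); split=> //.
  by exists (d ^ f) => //; exact: nD.2.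
by rewrite /conjg !mulgA mulgK.
Qed.

Lemma relmod_submodule : is_submodule (@relmod H P).
Proof.
split=> //.
- by exists 1; [exact: (subgroup1 sN)|apply/seteqP; split=> [_ [d Dd <-]|d Dd]; rewrite ?mul1g //; exists d; rewrite ?mul1g].
- move=> _ _ [x Nx <-] [y Ny <-]; exists (x / y); first exact: sN.2.
  by rewrite coset_div_lcoset.
- move=> h _ [x Nx <-]; have [f <-] := pres_surj P h.
  by rewrite relmod_act_lcoset //; exists (f * x * f^-1) => //; exact: (normalJV _ nN).
Qed.

(** Translates module generation into normal generation modulo [D]: the elements of [N] whose coset
    lies in a given submodule form a normal subgroup of the free group. *)
Lemma relmod_rank_le (s : seq F) : (forall x, x \in s -> N x) ->
  [set` rels P] `<=` normal_closure (D `|` [set` s]) -> (relmod_rank P <= size s)%N.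
Proof.
move=> Ns rs; apply: (proj2 (least_spec _)).
exists (fun i => lcoset D (nth 1 s i)).
have mi i : (i < size s)%N -> N (nth 1 s i) by move=> si; apply: Ns; exact: mem_nth.
have mr : range (fun i : 'I_(size s) => lcoset D (nth 1 s i)) `<=` @relmod H P.
  by move=> _ [i _ <-]; exists (nth 1 s i) => //; exact: mi.
split=> //; apply/seteqP; split=> [A|_ [x Nx <-] M [[Mr M1 Md Ma] mM]].
  by apply; split=> //; exact: relmod_submodule.
pose K : set F := [set x | N x /\ M (lcoset D x)].
have nK : is_normal_subgroup K.
  split; [split|].
  - split; first exact: subgroup1 sN.
    suff -> : lcoset D 1 = D by [].
    by apply/seteqP; split=> [_ [d Dd <-]|d Dd]; rewrite ?mul1g //; exists d; rewrite ?mul1g.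
  - move=> u v [Nu Mu] [Nv Mv]; split; first exact: sN.2.
    by rewrite -coset_div_lcoset; exact: Md.
  - move=> u y [Nu Mu]; split; first exact: nN.2.
    have -> : u ^ y = y^-1 * u * y^-1^-1 by rewrite /conjg invgK mulgA.
    by rewrite -relmod_act_lcoset //; exact: Ma.
suff : K x by case.
move: x Nx; apply: normal_closure_min => // r rr; apply: (rs r rr K); split=> // d [Dd|sd].
  split; first exact: DN.
  rewrite (_ : lcoset D d = D) //; apply/seteqP; split=> [_ [e De <-]|e De].
    exact: (subgroupM sD).
  by exists (d^-1 * e); rewrite ?mulVKg //; apply: (subgroupM sD) => //; exact: (subgroupV sD).
split; first exact: Ns.
by apply: mM; exists (Ordinal (etrans (index_mem _ _) sd)) => //=; rewrite nth_index.
Qed.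

Lemma normal_rank_attained : exists r : 'I_(normal_rank P) -> F,
  range r `<=` N /\ normal_closure (range r) = N.
Proof.
suff h : [set k | exists r : 'I_k -> F, range r `<=` N /\ normal_closure (range r) = N] (size (rels P)).
  by have [] := least_spec h.
have rE : range (fun i : 'I_(size (rels P)) => nth 1 (rels P) i) = [set` rels P].
  apply/seteqP; split=> [_ [i _ <-]|x xr]; first exact: mem_nth.
  by exists (Ordinal (etrans (index_mem _ _) xr)) => //=; rewrite nth_index.
exists (fun i => nth 1 (rels P) i); rewrite rE; split=> //; exact: sub_normal_closure.
Qed.

(** Without a gap, as many relators as the module has generators already present the group on the
    same generators. Repeated relators coincide in a finite set, hence the inequality. *)
Lemma no_gap_presentation : ~ relation_gap P ->
  exists P' : finpres H, (#|gens P|%:Z - (relmod_rank P)%:Z <= pres_deficiency P')%R.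
Proof.
move=> /contrapT e; have [r [rN rE]] := normal_rank_attained.
pose rl := [fset x in [seq r i | i <- enum 'I_(normal_rank P)]]%fset.
have rlE : [set` rl] = range r.
  apply/seteqP; split=> [x|_ [i _ <-]] /=; first by rewrite !inE => /mapP[i _ ->]; exists i.
  by rewrite !inE; apply: map_f; rewrite mem_enum.
have ker w : pres_map P w = 1 <-> normal_closure [set` rl] w.
  by rewrite rlE rE; exact: pres_ker.
exists (FinPres (rels := rl) (@pres_surj _ P) ker).
rewrite /pres_deficiency /= lerD2l lerN2 lez_nat e.
have sub : {subset rl <= [seq r i | i <- enum 'I_(normal_rank P)]} by move=> x; rewrite inE.
by have := uniq_leq_size (fset_uniq rl) sub; rewrite size_map size_enum_ord.
Qed.

End RelationModuleRank.

(* Homomorphisms to the rationals: those from a group with presentation [P] form a space of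
   dimension at least [#|gens P| - #|rels P|], and embed into the functions on [gens P0]. *)
Lemma gens_rels_bound (H : groupType) (P P0 : finpres H) :
  (#|gens P| <= #|` rels P| + #|gens P0|)%N.
Proof.
pose B := mulgrp rat.
pose ex (x : gens P) : freegroup (gens P) -> B := free_lift (fun y => (y == x)%:R%R : B).
pose phi (v : 'rV[rat]_#|gens P|) := free_lift (fun y => v ord0 (enum_rank y) : B).
have phiE v w : phi v w = (\sum_i v ord0 i * ex (enum_val i) w)%R.
  elim/freegroup_elim: w => [|t|x IH|x y IHx IHy].
  - rewrite /phi free_lift1 big1 // => i _.
    by rewrite /ex free_lift1 mulr0.
  - rewrite /phi free_lift_gen (bigD1 (enum_rank t)) //= big1 => [|i it].
      by rewrite /ex free_lift_gen enum_rankK eqxx mulr1 addr0.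
    rewrite /ex free_lift_gen (_ : (t == _) = false) ?mulr0 //.
    by apply/negbTE; apply: contra it => /eqP ->; rewrite enum_valK.
  - rewrite /phi free_liftV -/(phi v) IH -[LHS]sumrN; apply: eq_bigr => i _.
    by rewrite /ex free_liftV mulrN.
  - rewrite /phi free_lift_mul -/(phi v) IHx IHy -[LHS]big_split; apply: eq_bigr => i _ /=.
    by rewrite /ex free_lift_mul -mulrDr.
have [W WP] := choice (fun y : gens P0 => pres_surj P (pres_map P0 (free_gen y))).
pose sg := free_lift W.
have sgP y : pres_map P (sg y) = pres_map P0 y.
  elim/freegroup_elim: y => [|t|x IH|x y IHx IHy].
  - by rewrite /sg free_lift1 !multiplicative1.
  - by rewrite /sg free_lift_gen.
  - by rewrite /sg free_liftV !multiplicativeV IH.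
  - by rewrite /sg free_lift_mul !gmulfM IHx IHy.
pose A : 'M[rat]_(#|gens P|, #|` rels P|) := \matrix_(i, j) ex (enum_val i) (nth 1 (rels P) j).
pose E : 'M[rat]_(#|gens P|, #|gens P0|) := \matrix_(i, j) ex (enum_val i) (W (enum_val j)).
(* A row [v] is the homomorphism [phi v] to the rationals. [v *m A = 0] makes it factor through [H],
   and [v *m E = 0] makes it vanish on the generators coming from [P0]; then it is zero. *)
suff : row_free (row_mx A E) by move=> /eqP <-; exact: rank_leq_col.
apply: inj_row_free => v; rewrite mul_mx_row -[0%R]row_mx0 => /eq_row_mx[vA vE].
have kA r : r \in rels P -> phi v r = 1.
  move=> rP; rewrite phiE.
  have jr : (index r (rels P) < #|` rels P|)%N by rewrite index_mem.
  have /rowP/(_ (Ordinal jr)) := vA; rewrite !mxE => e; rewrite -[RHS]e.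
  by apply: eq_bigr => i _; rewrite mxE /= nth_index.
have kE y : phi v (W y) = 1.
  rewrite phiE; have /rowP/(_ (enum_rank y)) := vE; rewrite !mxE => e; rewrite -[RHS]e.
  by apply: eq_bigr => i _; rewrite mxE /= enum_rankK.
have kN w : pres_map P w = 1 -> phi v w = 1.
  move=> /pres_ker; move: w.
  by apply: normal_closure_min => [|r]; [exact: (kernel_normal (phi v))|exact: kA].
have ksg y : phi v (sg y) = 1.
  elim/freegroup_elim: y => [|t|x IH|x y IHx IHy].
  - by rewrite /sg free_lift1 /phi free_lift1.
  - by rewrite /sg free_lift_gen.
  - by rewrite /sg free_liftV /phi free_liftV -/(phi v) IH invg1.
  - by rewrite /sg free_lift_mul /phi free_lift_mul -/(phi v) IHx IHy mulg1.
apply/rowP => i; rewrite mxE -(enum_valK i); set x := enum_val i.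
have [y yx] := pres_surj P0 (pres_map P (free_gen x)).
have : phi v ((sg y)^-1 * free_gen x) = 1.
  by apply: kN; rewrite gmulfM multiplicativeV sgP yx mulVg.
by rewrite /phi free_lift_mul free_liftV -/(phi v) ksg invg1 mul1g /phi free_lift_gen.
Qed.

(** By [gens_rels_bound] the generators of one fixed presentation bound all deficiencies; the least
    distance from this bound gives the maximum. *)
Lemma deficiency_attained (G : groupType) : finitely_presented G ->
  (exists P : finpres G, pres_deficiency P = deficiency G) /\
  forall P : finpres G, (pres_deficiency P <= deficiency G)%R.
Proof.
move=> [P0]; pose b := (#|gens P0|%:Z)%R.
have bd (P : finpres G) : (pres_deficiency P <= b)%R.
  by rewrite /pres_deficiency lerBlDl -PoszD lez_nat; exact: gens_rels_bound.
pose Q n := `[< exists P : finpres G, pres_deficiency P = b - n%:Z >]%R.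
have natE (P : finpres G) : (pres_deficiency P = b - (absz (b - pres_deficiency P))%:Z)%R.
  by rewrite gez0_abs ?subr_ge0 // opprB addrC subrK.
have exQ : exists n, Q n by exists (absz (b - pres_deficiency P0)); apply/asboolP; exists P0.
case: (ex_minnP exQ) => m /asboolP mP min_m.
have maxP (P : finpres G) : (pres_deficiency P <= b - m%:Z)%R.
  rewrite (natE P) lerD2l lerN2 lez_nat; apply: min_m; apply/asboolP; exists P; exact: natE.
rewrite /deficiency; case: xgetP => [d -> [dP dmax]|/(_ (b - m%:Z)%R) []]; first by split.
by split.
Qed.

(** * Presentations of subgroups of finite index *)

Section FiniteIndex.
Variable G : groupType.
Implicit Types (K : set G) (g x : G).

Lemma lcoset_eq K x y : is_subgroup K -> (lcoset K x = lcoset K y <-> K (y^-1 * x)).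
Proof.
move=> sK; split=> [/seteqP[h _]|Kxy].
  have [|k Kk <-] := h x; first by exists 1; [exact: subgroup1 sK|rewrite mulg1].
  by rewrite mulKg.
apply/seteqP; split=> _ [k Kk <-].
  exists (y^-1 * x * k); first exact: subgroupM.
  by rewrite -!mulgA mulVKg.
exists ((y^-1 * x)^-1 * k); first by apply: subgroupM => //; exact: subgroupV.
by rewrite invgM invgK -!mulgA mulVKg.
Qed.

Lemma finite_lcosetsI K K' : is_subgroup K -> is_subgroup K' ->
  finite_set (lcosets K) -> finite_set (lcosets K') -> finite_set (lcosets (K `&` K')).
Proof.
move=> sK sK' fK fK'; apply: sub_finite_set (finite_image (fun p => p.1 `&` p.2) (finite_setX fK fK')).
move=> _ [g _ <-]; exists (lcoset K g, lcoset K' g); first by split; exists g.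
apply/seteqP; split=> [_ [[k Kk <-] [k' Kk' /mulgI e]]|_ [k [Kk Kk'] <-]] /=.
  by exists k => //; split=> //; rewrite -e.
by split; exists k.
Qed.

Lemma separating_subgroup (s : seq G) : residually_finite G ->
  exists K, [/\ is_normal_subgroup K, finite_set (lcosets K) &
    forall g, g \in s -> K g -> g = 1].
Proof.
move=> rf; elim: s => [|g s [K [nK fK sepK]]].
  exists setT; split=> //.
  apply: sub_finite_set (finite_set1 (setT : set G)) => _ [g _ <-] /=.
  by apply/seteqP; split=> // y _; exists (g^-1 * y) => //; rewrite mulVKg.
have [->|/rf [H [nH fH gH]]] := eqVneq g 1.
  by exists K; split=> // x; rewrite inE => /orP[/eqP //|]; exact: sepK.
exists (K `&` [set` H]); split.
- split; [split|].
  + by split; apply: subgroup1; [exact: nK.1|exact: nH.1].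
  + by move=> x y [Kx Hx] [Ky Hy]; split; [exact: nK.1.2|exact: nH.1.2].
  + by move=> x y [Kx Hx]; split; [exact: nK.2|exact: nH.2].
- by apply: finite_lcosetsI => //; [exact: nK.1|exact: nH.1].
- move=> x; rewrite inE => /orP[/eqP -> [_ /= gH']|xs [Kx _]]; last exact: sepK.
  by rewrite gH' in gH.
Qed.

Lemma groupClosed_of_subgroup K : is_subgroup K -> exists H : groupClosed G, [set` H] = K.
Proof.
move=> sK; pose S : {pred G} := fun x => `[< K x >].
have S1 : 1 \in S by apply/asboolP; exact: subgroup1.
have SV : invg_closed S by move=> x /asboolP Kx; apply/asboolP; exact: subgroupV.
have SM : mulg_closed S.
  by move=> x y /asboolP Kx /asboolP Ky; apply/asboolP; exact: subgroupM.
pose H : groupClosed G := HB.pack S (isInvClosed.Build G S SV) (isMul1Closed.Build G S S1)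
  (isMulClosed.Build G S SM).
by exists H; apply/seteqP; split=> x /=; rewrite unfold_in => /asboolP.
Qed.

(** The index counts left cosets, whereas rewriting follows the right cosets, with [x / y] in [H];
    normality identifies them. *)
Lemma coset_finType (H : groupClosed G) : is_normal_subgroup [set` H] -> finite_index H ->
  exists (Q : finType) (cls : G -> Q), [/\ #|Q| = subgroup_index H, forall q, exists g, cls g = q &
    forall x y, cls x = cls y <-> x / y \in H].
Proof.
move=> nH fH; have sH := nH.1.
have inQ g : lcoset [set` H] g \in fset_set (lcosets [set` H]).
  by rewrite in_fset_set // inE; exists g.
exists (fset_set (lcosets [set` H])), (fun g => [` inQ g]%fset); split.
- by rewrite -cardfE.
- move=> q; have := fsvalP q; rewrite in_fset_set // inE => -[g _ gq].
  by exists g; apply/val_inj.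
- move=> x y; split=> [[/lcoset_eq - /(_ sH) h]|h].
    by have := nH.2 _ y^-1 h; rewrite /conjg invgK /= mulgA mulVKg.
  apply/val_inj/lcoset_eq => //=.
  by have := nH.2 _ y h; rewrite /conjg /= mulgVK.
Qed.

End FiniteIndex.

(** * Reidemeister-Schreier presentations *)

Section ReidemeisterSchreier.
Variables (X J : finType) (rr : J -> freegroup X) (G : groupType) (rho : X -> G).
Hypothesis ker : forall x, free_lift rho x = 1 <-> normal_closure (range rr) x.
Hypothesis surj : forall g, exists x, free_lift rho x = g.
Variables (H : groupClosed G) (Q : finType) (cls : G -> Q).
Hypothesis clsP : forall x y, cls x = cls y <-> x / y \in H.
Variable t : Q -> freegroup X.
Hypotheses (tP : forall q, cls (free_lift rho (t q)) = q) (t1 : t (cls 1) = 1).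

Local Notation pi := (free_lift rho).
Local Notation F' := (freegroup (X * Q)%type).

Lemma clsM x y z : cls x = cls y -> cls (x * z) = cls (y * z).
Proof. by move=> /clsP h; apply/clsP; rewrite mulgKA. Qed.

(* Reidemeister-Schreier rewriting, starting from the coset of [m]. *)
Definition schreier (m : G) (x : freegroup X) : F' :=
  crossed rho (fun g x => free_gen (x, cls g)) m x.

Let sM : is_crossed rho schreier. Proof. exact: crossed_is_crossed. Qed.

Lemma schreier_cls x m m' : cls m = cls m' -> schreier m x = schreier m' x.
Proof.
elim/freegroup_elim: x m m' => [|a|x IH|x y IHx IHy] m m' mm.
- by rewrite !(crossed1 sM).
- by rewrite /schreier !crossed_gen mm.
- by rewrite !(crossedV sM); congr _^-1; apply/IH/clsM.
- by rewrite !sM (IHx _ _ mm) (IHy _ _ (clsM _ mm)).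
Qed.

(* The generator [(x, q)] stands for the Schreier generator [t_q x t_(qx)^-1]. *)
Definition embed_gen (p : X * Q) : freegroup X :=
  t p.2 * free_gen p.1 * (t (cls (pi (t p.2) * rho p.1)))^-1.

Definition embed : F' -> freegroup X := free_lift embed_gen.

Lemma embed_schreier x m : embed (schreier m x) = t (cls m) * x * (t (cls (m * pi x)))^-1.
Proof.
apply: (crossed_unique (rho := rho) (c := fun m x => embed (schreier m x))
  (c' := fun m x => t (cls m) * x * (t (cls (m * pi x)))^-1)).
- by move=> u y z; rewrite sM /embed free_lift_mul.
- by move=> u y z; rewrite free_lift_mul !mulgA mulgVK.
- move=> u a; rewrite /schreier crossed_gen /embed !free_lift_gen /embed_gen /=.
  by rewrite (@clsM (pi (t (cls u))) u) // tP.
Qed.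

Lemma embed_in z : pi (embed z) \in H.
Proof.
elim/freegroup_elim: z => [|[a q]|x IH|x y IHx IHy]; rewrite /embed.
- by rewrite !free_lift1; exact: gpred1.
- rewrite free_lift_gen /embed_gen !free_lift_mul free_lift_gen free_liftV.
  by apply/clsP; rewrite tP.
- by rewrite !free_liftV gpredV.
- by rewrite !free_lift_mul; exact: gpredM.
Qed.

Definition subgen (p : X * Q) : subgroup_of H := Sub (pi (embed (free_gen p))) (embed_in _).

Lemma subgenE z : val (free_lift subgen z) = pi (embed z).
Proof.
elim/freegroup_elim: z => [|p|x IH|x y IHx IHy].
- by rewrite free_lift1 /embed !free_lift1.
- by rewrite free_lift_gen SubK.
- by rewrite free_liftV /embed !free_liftV -IH.
- by rewrite free_lift_mul /embed !free_lift_mul -IHx -IHy.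
Qed.

Lemma subgen_schreier x : pi x \in H -> val (free_lift subgen (schreier 1 x)) = pi x.
Proof.
move=> Hx; rewrite subgenE embed_schreier mul1g t1 mul1g.
rewrite (_ : cls (pi x) = cls 1); last by apply/clsP; rewrite divg1.
by rewrite t1 invg1 mulg1.
Qed.

Lemma subgen_surj h : exists z, free_lift subgen z = h.
Proof.
have [x xh] := surj (val h); exists (schreier 1 x).
by apply/val_inj; rewrite subgen_schreier xh //; exact: (valP h).
Qed.

(** The transversal is not assumed closed under prefixes, so no generators are deleted along a tree;
    the rewritten transversal elements are relators instead. By [t1] the one for the trivial coset
    is 1, which leaves at most [#|Q| - 1] nontrivial ones. *)
Definition sub_relator (i : Q + Q * J) : F' :=
  match i with
  | inl q => schreier 1 (t q)
  | inr (q, j) => schreier (pi (t q)) (rr j)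
  end.

Let K : set F' := normal_closure (range sub_relator).
Let nK : is_normal_subgroup K. Proof. exact: normal_closure_normal. Qed.

Lemma rr1 j : pi (rr j) = 1.
Proof. by apply/ker; apply: sub_normal_closure; exists j. Qed.

Lemma schreier_rel m j : schreier m (rr j) = sub_relator (inr (cls m, j)).
Proof. by rewrite /=; apply: schreier_cls; rewrite tP. Qed.

Lemma schreier_ker x m : pi x = 1 -> K (schreier m x).
Proof.
move=> /ker x1; suff [_] : pi x = 1 /\ forall m, K (schreier m x) by exact.
move: x x1 {m}; apply: normal_closure_min => [|_ [j _ <-]]; last first.
  split; first exact: rr1.
  by move=> m; rewrite schreier_rel; apply: sub_normal_closure; exists (inr (cls m, j)).
split; [split|].
- by split=> [|m]; rewrite ?free_lift1 // (crossed1 sM); exact: subgroup1 nK.1.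
- move=> x y [x1 Kx] [y1 Ky]; split; first by rewrite free_lift_mul free_liftV x1 y1 mulgV.
  move=> m; rewrite sM (crossedV sM) x1 y1 invg1 !mulg1.
  exact: nK.1.2.
- move=> x y [x1 Kx].
  have xy1 : pi (x ^ y) = 1 by rewrite /conjg !free_lift_mul free_liftV x1 mul1g mulVg.
  split=> // m; rewrite (_ : x ^ y = y^-1 * x * y^-1^-1); last by rewrite /conjg invgK mulgA.
  rewrite (crossedJ sM) (_ : y^-1 * x * y^-1^-1 = x ^ y); last by rewrite /conjg invgK mulgA.
  by rewrite xy1 mulg1; exact: (normalJV _ nK (Kx _)).
Qed.

(** Rewriting inverts [embed] modulo the relators: a Schreier generator is rewritten to its letter
    between two rewritten transversal elements, and these lie in [K]. *)
Lemma schreier_embed z : K (z^-1 * schreier 1 (embed z)).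
Proof.
have sE x : pi x \in H -> forall y, schreier 1 (x * y) = schreier 1 x * schreier 1 y.
  move=> Hx y; rewrite sM mul1g; congr (_ * _); apply: schreier_cls.
  by apply/clsP; rewrite divg1.
have sV x : pi x \in H -> schreier 1 x^-1 = (schreier 1 x)^-1.
  move=> Hx; rewrite (crossedV sM) mul1g; congr _^-1; apply: schreier_cls.
  by apply/clsP; rewrite divg1 gpredV.
elim/freegroup_elim: z => [|[a q]|x IH|x y IHx IHy].
- by rewrite /embed free_lift1 (crossed1 sM) mulVg; exact: subgroup1 nK.1.
- have Kt p : K (schreier 1 (t p)) by apply: sub_normal_closure; exists (inl p).
  rewrite /embed free_lift_gen /embed_gen /= !sM mul1g (crossedV sM).
  rewrite [schreier (pi (t q)) _]crossed_gen tP free_lift_mul free_lift_gen !mul1g mulgA.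
  set q' := cls _; set z := free_gen (a, q); rewrite (mulgA z^-1).
  apply: (subgroupM nK.1); first by have := nK.2 _ z (Kt q); rewrite /conjg mulgA.
  apply: (subgroupV nK.1); rewrite (@schreier_cls (t q') _ 1) //.
  by apply/clsP; rewrite divg1; apply/clsP; rewrite tP.
- rewrite invgK /embed free_liftV sV ?embed_in // -/(embed x).
  have := normalJV x nK (subgroupV nK.1 IH).
  by rewrite invgM invgK !mulgA mulgK.
- rewrite /embed free_lift_mul sE ?embed_in // -/(embed x) -/(embed y).
  have := subgroupM nK.1 (nK.2 _ y IHx) IHy.
  by rewrite /conjg invgM !mulgA mulgK.
Qed.

Lemma subgen_ker z : free_lift subgen z = 1 <-> K z.
Proof.
split=> [z1|].
  have e1 : pi (embed z) = 1 by rewrite -subgenE z1.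
  have := subgroupM nK.1 (schreier_ker 1 e1) (subgroupV nK.1 (schreier_embed z)).
  by rewrite invgM invgK mulgA mulgV mul1g.
move: z; apply: normal_closure_min; first exact: (kernel_normal (free_lift subgen)).
move=> _ [[q|[q j]] _ <-]; apply/val_inj; rewrite subgenE /= embed_schreier.
  by rewrite mul1g t1 mul1g tP mulgV free_lift1.
by rewrite rr1 mulg1 tP !free_lift_mul rr1 mulg1 free_liftV mulgV.
Qed.

Definition sub_rels : {fset F'} := [fset x in codom sub_relator]%fset.

Lemma sub_relsE : [set` sub_rels] = range sub_relator.
Proof.
apply/seteqP; split=> [x|_ [i _ <-]] /=; rewrite inE; last exact: codom_f.
by move=> /codomP[i ->]; exists i.
Qed.

Lemma sub_pres_ker z : free_lift subgen z = 1 <-> normal_closure [set` sub_rels] z.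
Proof. by rewrite sub_relsE; exact: subgen_ker. Qed.

Definition sub_pres : finpres (subgroup_of H) :=
  FinPres (gens := (X * Q)%type) (rels := sub_rels) (pres_map := free_lift subgen)
    subgen_surj sub_pres_ker.

Let N : set F' := normal_closure [set` rels sub_pres].
Let nN : is_normal_subgroup N. Proof. exact: normal_closure_normal. Qed.
Let sN : is_subgroup N := nN.1.
Let NE z : N z <-> free_lift subgen z = 1. Proof. by have [h1 h2] := sub_pres_ker z; split. Qed.

Lemma exists_section (A B : groupType) (k : {multiplicative A -> B}) : (forall b, exists a, k a = b) ->
  exists sec : B -> A, (forall b, k (sec b) = b) /\ sec 1 = 1.
Proof.
move=> /choice[sec secK]; exists (fun b => if b == 1 then 1 else sec b); rewrite eqxx; split=> // b.
by case: eqP => [->|_]; rewrite ?multiplicative1.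
Qed.

Let ab_tf (c : abelianisation nN) n : (c *+ n.+1 = 0 -> c = 0)%R.
Proof.
have [sec [secK sec1]] := exists_section (k := free_lift subgen) subgen_surj.
exact: (abelianisation_torsion_free secK sec1).
Qed.

Lemma sub_relator_in i : N (sub_relator i).
Proof. by apply: sub_normal_closure; rewrite sub_relsE; exists i. Qed.

Section IdentityAmongRelators.
Variables (l : seq (bool * (freegroup X * J))) (g0 : G) (j0 : J).
Hypothesis l1 : rel_prod rr l = 1.
Hypothesis l_coef : coef (g0, j0) [seq (e.1, (pi e.2.1, e.2.2)) | e <- l] != 0%R.
(** [t_l] places the rewritten conjugators of [l] in [N], and [cls_l] prevents the coefficient at
    [g0] from mixing with others when group elements are replaced by their cosets. *)
Hypothesis t_l : forall e, e \in l -> pi (t (cls (pi e.2.1))) = pi e.2.1.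
Hypothesis cls_l : forall e, e \in l -> cls (pi e.2.1) = cls g0 -> pi e.2.1 = g0.

Let y (p : Q * J) : abelianisation nN := abcls nN (sub_relator (inr p)).
Let l' := [seq (e.1, (cls (pi e.2.1), e.2.2)) | e <- l].

(* The identity among relators, rewritten: it holds since each [schreier 1 e.2.1] lies in [N], so
   that conjugation by it is trivial in the relation module. *)
Let y_relation : fsum y l' = 0%R.
Proof.
have kD : additive_on N (abcls nN) by move=> u v Nu Nv; exact: abcls_mul.
suff [_ <-] : N (schreier 1 (rel_prod rr l)) /\ abcls nN (schreier 1 (rel_prod rr l)) = fsum y l'.
  by rewrite l1 (crossed1 sM); exact: (additive_on1 sN kD).
rewrite /l'; elim: (l) t_l => [_|e s IH tl].
  rewrite /rel_prod big_nil (crossed1 sM) /fsum big_nil; split; first exact: subgroup1.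
  exact: (additive_on1 sN kD).
have [|Ns sE] := IH; first by move=> e' es; apply: tl; rewrite inE es orbT.
have te := tl e (mem_head _ _).
have r1 : pi (if e.1 then rr e.2.2 else (rr e.2.2)^-1) = 1.
  by case: e.1; rewrite ?free_liftV rr1 ?invg1.
have el1 : pi (rel_letter rr e) = 1.
  by rewrite /rel_letter !free_lift_mul r1 mulg1 free_liftV mulgV.
have Nf : N (schreier 1 e.2.1).
  apply/NE/val_inj; rewrite subgenE embed_schreier !mul1g t1 mul1g.
  by rewrite free_lift_mul free_liftV te mulgV.
rewrite {1 2}/rel_prod big_cons sM mul1g el1 -/(rel_prod rr s).
pose u := if e.1 then sub_relator (inr (cls (pi e.2.1), e.2.2))
          else (sub_relator (inr (cls (pi e.2.1), e.2.2)))^-1.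
have uE : schreier 1 (rel_letter rr e) = schreier 1 e.2.1 * u * (schreier 1 e.2.1)^-1.
  rewrite (crossedJ sM) -/(rel_letter rr e) el1 !mul1g; congr (_ * _ * _).
  rewrite /u; case: e.1; first exact: schreier_rel.
  by rewrite (crossedV sM) rr1 invg1 mulg1 schreier_rel.
have Nu : N u by rewrite /u; case: e.1; [|apply: (subgroupV sN)]; exact: sub_relator_in.
have NV := subgroupV sN Nf.
rewrite uE; split; first by do !apply: (subgroupM sN) => //.
rewrite !kD //; try by do !apply: (subgroupM sN) => //.
rewrite (additive_onV sN kD Nf) [(_ + abcls _ u)%R]addrC addrK sE.
rewrite /fsum big_cons /= -/(fsum y _); congr (_ + _)%R; rewrite /u /y.
by case: e.1; [reflexivity|exact: (additive_onV sN kD (sub_relator_in _))].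
Qed.

(** The first summand counts the rewritten transversal without the trivial coset, the second the
    classes of rewritten relators, of which the identity saves one. *)
Lemma sub_pres_rank : (relmod_rank sub_pres <= #|Q|.-1 + (#|Q| * #|J|).-1)%N.
Proof.
have y0 : (\sum_p y p *~ coef p l' = 0)%R by rewrite -fsum_fin.
have c0 : coef (cls g0, j0) l' != 0%R.
  rewrite (_ : coef _ _ = coef (g0, j0) [seq (e.1, (pi e.2.1, e.2.2)) | e <- l]) //.
  rewrite /coef /fsum !big_map /=; apply: eq_big_seq => e el /=.
  suff -> : ((cls (pi e.2.1), e.2.2) == (cls g0, j0)) = ((pi e.2.1, e.2.2) == (g0, j0)) by [].
  rewrite !xpair_eqE; congr (_ && _); apply/eqP/eqP => [|->//]; exact: cls_l.
have [s sz sP] := drop_generator ab_tf y0 c0.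
have [rep repP] := choice (fun c => let: ex_intro2 x Nx cx := abcls_surj (nN := nN) c in
  ex_intro (fun x => N x /\ c = abcls nN x) x (conj Nx cx)).
pose s1 := [seq sub_relator (inl q) | q <- rem (cls 1) (enum Q)].
have -> : (#|Q|.-1 + (#|Q| * #|J|).-1)%N = size (s1 ++ map rep s).
  by rewrite size_cat !size_map sz size_rem ?mem_enum // -cardE card_prod.
apply: relmod_rank_le => [x|r].
  by rewrite mem_cat => /orP[/mapP[q _ ->]|/mapP[c _ ->]]; [exact: sub_relator_in|have [] := repP c].
rewrite sub_relsE => -[i _ <-] K' [nK' KP].
have sK := nK'.1; case: i => [q|p].
  have [->|q1] := eqVneq q (cls 1); first by rewrite /= t1 (crossed1 sM); exact: (subgroup1 sK).
  have qs : q \in rem (cls 1) (enum Q) by rewrite mem_rem_uniq ?enum_uniq // !inE q1 mem_enum.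
  have qs1 : sub_relator (inl q) \in s1 ++ map rep s by rewrite mem_cat (map_f _ qs).
  by apply: KP; right.
(* The classes with a representative in [K']. Since [K'] contains the derived subgroup, all elements
   of such a class belong to [K']. *)
have [] := sP [set c | exists n, [/\ N n, K' n & c = abcls nN n]] _ _ _ p.
- by exists 1; split; [exact: subgroup1|exact: subgroup1|].
- move=> _ _ [u [Nu Ku ->]] [v [Nv Kv ->]]; exists (u / v).
  have Vv := subgroupV sN Nv; split; [exact: sN.2|exact: sK.2|].
  rewrite abcls_mul //; congr (_ + _)%R; apply/esym.
  by apply: (additive_onV sN _ Nv) => a b; exact: abcls_mul.
- move=> c cs; exists (rep c); have [Nr cE] := repP c; split=> //.
  by apply: KP; right; rewrite /= mem_cat (map_f rep cs) orbT.
move=> n [Nn Kn yn]; rewrite -(mulgVK n (sub_relator _)); apply: (subgroupM sK) => //.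
have [h _] := @qcls_eq (ab_pre nN) (sub_relator (inr p)) n (sub_relator_in _) Nn.
by apply: KP; left; rewrite -sub_relsE; exact: h.
Qed.

End IdentityAmongRelators.

End ReidemeisterSchreier.

Lemma separated_transversal (G : groupType) (Q : eqType) (cls : G -> Q) (s : seq G) :
  (forall q, exists g, cls g = q) -> {in s &, injective cls} ->
  exists c : Q -> G, (forall q, cls (c q) = q) /\ {in s, forall g, c (cls g) = g}.
Proof.
move=> /choice[c cK] inj.
exists (fun q => nth (c q) s (find (fun g => cls g == q) s)); split=> [q|g gs].
  have [h|h] := boolP (has (fun g => cls g == q) s); first exact/eqP/(nth_find _ h).
  by rewrite nth_default ?cK // hasNfind.
have h : has (fun g' => cls g' == cls g) s by apply/hasP; exists g.
apply: inj => //; first by rewrite mem_nth // -has_find.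
exact/eqP/(nth_find _ h).
Qed.

Theorem relation_gap_or_identities (G : groupType) (P : finpres G) :
  residually_finite G ->
  (forall H : groupClosed G, finite_index H ->
     (deficiency (subgroup_of H) - 1 = (subgroup_index H)%:Z * (pres_deficiency P - 1))%R) ->
  ~ no_identities (fun j : rels P => val j) (fun x => pres_map P (free_gen x)) ->
  exists H : groupClosed G, finite_index H /\ exists P' : finpres (subgroup_of H), relation_gap P'.
Proof.
move=> rf defH.
set rr := fun j : rels P => val j; set rho := fun x => pres_map P (free_gen x).
move=> /existsNP[l /not_implyP[l1 /existsNP[[g0 j0] /eqP lc]]].
have rrE : range rr = [set` rels P].
  apply/seteqP; split=> [_ [j _ <-]|x xP]; first exact: fsvalP.
  by exists [` xP]%fset.
have liftE : free_lift rho =1 pres_map P.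
  by apply: (free_lift_unique (g := free_lift rho)) => x; exact: free_lift_gen.
have ker x : free_lift rho x = 1 <-> normal_closure (range rr) x.
  by rewrite liftE rrE; exact: pres_ker.
have surj g : exists x, free_lift rho x = g.
  by have [x xg] := pres_surj P g; exists x; rewrite liftE.
have [sec [secK sec1]] := exists_section (k := free_lift rho) surj.
(* [1] is listed so that the trivial coset is represented by 1, as [t1] demands, and [g0] so that
   its coset meets the list in [g0] alone. Separating two elements means keeping their quotient out
   of the subgroup. *)
pose s := [:: g0, 1 & [seq free_lift rho e.2.1 | e <- l]].
have [K [nK fK sepK]] := separating_subgroup [seq a / b | a <- s, b <- s] rf.
have [H HK] := groupClosed_of_subgroup nK.1.
have nH : is_normal_subgroup [set` H] by rewrite HK.
have fH : finite_index H by rewrite /finite_index HK.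
have [Q [cls [cardQ cls_surj clsP]]] := coset_finType nH fH.
have inj : {in s &, injective cls}.
  move=> a b sa sb /clsP abH; apply: divg1_eq; apply: sepK; last by rewrite -HK.
  by apply/allpairsP; exists (a, b).
have [c [cK cs]] := separated_transversal cls_surj inj.
have ls e : e \in l -> free_lift rho e.2.1 \in s.
  by move=> el; rewrite !inE (map_f (fun e => free_lift rho e.2.1) el) !orbT.
have tP q : cls (free_lift rho (sec (c q))) = q by rewrite secK.
have t1 : sec (c (cls 1)) = 1 by rewrite cs ?sec1 // !inE eqxx orbT.
exists H; split=> //; exists (sub_pres ker surj clsP tP t1); apply: contrapT => /no_gap_presentation gap.
have rk : (relmod_rank (sub_pres ker surj clsP tP t1) <=
    #|Q|.-1 + (#|Q| * #|{: rels P}|).-1)%N.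
  apply: (sub_pres_rank ker surj clsP tP t1 (l := l) (g0 := g0) (j0 := j0)) => //.
  - by move=> e el /=; rewrite secK cs // ls.
  - by move=> e el /(inj _ _ (ls e el)) -> //; rewrite !inE eqxx.
have [P' P'd] := gap.
have [_ /(_ P') P'max] := deficiency_attained (inhabits P').
have := defH H fH; rewrite /pres_deficiency -cardQ cardfE => dH.
(* Positivity turns the truncated predecessors in [rk] into true subtractions; the contradiction has
   a margin of exactly one. *)
have Q0 : (0 < #|Q|)%N by apply/card_gt0P; exists (cls 1).
have J0 : (0 < #|{: rels P}|)%N by apply/card_gt0P; exists j0.
have QJ0 : (0 < #|Q| * #|{: rels P}|)%N by rewrite muln_gt0 Q0.
have := le_trans P'd P'max; rewrite /= card_prod => le1.
move: rk le1 dH; rewrite /=.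
set r := relmod_rank _; set d := deficiency _.
move: (#|gens P|) (#|Q|) (#|{: rels P}|) Q0 J0 QJ0 => x q j q0 j0' qj0 rk le1 dH; nia.
Qed.

Theorem theorem9 (R : realType) (G : groupType)
  (Gresfin : residually_finite G)
  (Gfp : finitely_presented G)
  (Gdef : forall H : groupClosed G, finite_index H ->
     (deficiency (subgroup_of H) - 1 =
      (subgroup_index H)%:Z * (deficiency G - 1))%R)
  (GnoK : ~ has_finite_KG1 R 2 G) :
  exists H : groupClosed G,
    finite_index H /\ exists P : finpres (subgroup_of H), relation_gap P.
Proof.
have [[P Pd] _] := deficiency_attained Gfp.
apply: (relation_gap_or_identities (P := P) Gresfin); first by rewrite Pd.
move=> ni; apply: GnoK.
have liftE : free_lift (fun x => pres_map P (free_gen x)) =1 pres_map P.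
  by apply: (free_lift_unique (g := free_lift _)) => x; exact: free_lift_gen.
have [|sec [secK sec1]] := exists_section (k := free_lift (fun x => pres_map P (free_gen x))).
  by move=> g; have [x <-] := pres_surj P g; exists x; exact: liftE.
apply: (no_identities_KG1 R _ secK sec1 ni) => x; rewrite [free_lift _ x]liftE.
rewrite (_ : range _ = [set` rels P]); first exact: pres_ker.
apply/seteqP; split=> [_ [j _ <-]|y yP]; first exact: fsvalP.
by exists [` yP]%fset.
Qed.
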